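(* Let $p\in(0,1)$ and $d\in\mathbb N$. Let $U$ be uniformly distributed on $[0,1)^d$ and let $\Phi$ be a stationary thinning of the stationary lattice $\mathbb Z^d+U$ which is solely $(-d+p)$-uniform and whose distribution is invariant under the isometries of the lattice. With $e_1$ the first unit vector, define the point process $$\Psi:=\sum_{z\in\mathbb Z^d}\Big(\mathbf 1\{\Phi(\{z+U\})=1\}\,\delta_{z+\frac12e_1+U}+\mathbf 1\{\Phi(\{z+U\})=0\}\,\delta_{z-\frac12e_1+U}\Big).$$ Then $\Psi$ is solely $(-d+2+p)$-uniform. This degree is negative if and only if $d\ge3$.
   Context: A stationary thinning of $\mathbb Z^d+U$ is a simple point process $\Phi$ on $\mathbb R^d$ whose points all lie in $\mathbb Z^d+U$, such that $\Phi$ and $\mathbb Z^d+U$ are jointly stationary (jointly invariant in distribution under translations of $\mathbb R^d$). Isometries of the lattice are the isometries of $\mathbb R^d$ that map $\mathbb Z^d$ to itself. $B_r=\{x\in\mathbb R^d:\|x\|<r\}$, $\hat f(k)=\int e^{-i\langle k,x\rangle}f(x)\,dx$, $\Phi(f)=\int f\,d\Phi$. For a stationary point process $\Phi$ on $\mathbb R^d$ with $\mathbb E[\Phi(B_1)^2]<\infty$, the Bartlett spectral measure $\hat\beta_\Phi$ is the unique locally finite measure on $\mathbb R^d$ with $\mathrm{Cov}[\Phi(f),\Phi(g)]=(2\pi)^{-d}\int\hat f\,\overline{\hat g}\,d\hat\beta_\Phi$ for all bounded measurable compactly supported $f,g$. For $s\in[-d,\infty)$, $\Phi$ is $s$-uniform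 if $\varepsilon^{-d}\hat\beta_\Phi(B_\varepsilon)=O(\varepsilon^s)$ as $\varepsilon\to0$, beyond $s$-uniform if this holds with $o(\varepsilon^s)$, and solely $s$-uniform if it is $s$-uniform but not beyond $s$-uniform. *)

(* Defs.v *)
From HB Require Import structures.
From mathcomp Require Import all_boot all_order all_algebra.
From mathcomp Require Import all_classical all_reals all_analysis.
From mathcomp Require Import measurable_realfun complex.

Set Implicit Arguments.
Unset Strict Implicit.
Unset Printing Implicit Defensive.

Import Order.TTheory GRing.Theory Num.Theory.
Import numFieldNormedType.Exports.

Local Open Scope classical_set_scope.
Local Open Scope ring_scope.

(* The library's measure instance on [pushforward mu f] takes a measurability
   proof as an argument; bundling [f] makes it inferable. *)
Section image_measure.
Local Open Scope ereal_scope.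
Context d1 d2 (T1 : measurableType d1) (T2 : measurableType d2) (R : realType).
Variables (f : {mfun T1 >-> T2}) (mu : {measure set T1 -> \bar R}).

Definition image_measure : set T2 -> \bar R := pushforward mu f.

Let image_measure0 : image_measure set0 = 0.
Proof. exact: measure0. Qed.

Let image_measure_ge0 A : 0 <= image_measure A.
Proof. exact: measure_ge0. Qed.

Let image_measure_sigma_additive : semi_sigma_additive image_measure.
Proof. exact: measure_semi_sigma_additive. Qed.

HB.instance Definition _ := isMeasure.Build _ _ _ image_measure
  image_measure0 image_measure_ge0 image_measure_sigma_additive.

End image_measure.

Section borel_space.
Context {R : realType} (n : nat).

(* R^n is equipped with the sigma-algebra generated by the coordinate maps,
   which is the Borel sigma-algebra. *)
Definition coordinate (i : 'I_n) (x : 'rV[R]_n) : R := x ord0 i.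

Let rV_set0 : g_sigma_preimage coordinate set0.
Proof. exact: sigma_algebra0. Qed.

Let rV_setC A : g_sigma_preimage coordinate A -> g_sigma_preimage coordinate (~` A).
Proof. exact: sigma_algebraC. Qed.

Let rV_bigcup (F : (set 'rV[R]_n)^nat) :
  (forall i, g_sigma_preimage coordinate (F i)) ->
  g_sigma_preimage coordinate (\bigcup_i F i).
Proof. exact: sigma_algebra_bigcup. Qed.

Definition rV_display : measure_display.
Proof. by constructor. Qed.

HB.instance Definition _ := @isMeasurable.Build rV_display
  'rV[R]_n (g_sigma_preimage coordinate) rV_set0 rV_setC rV_bigcup.

Lemma measurable_coordinate i : measurable_fun [set: 'rV[R]_n] (coordinate i).
Proof.
move=> _ Y mY; rewrite setTI; apply: sub_sigma_algebra => /=.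
rewrite -bigcup_seq/=; exists i => /=; first by rewrite mem_index_enum.
by exists Y => //; rewrite setTI.
Qed.

Lemma measurable_coordinateP d (T : measurableType d) (f : T -> 'rV[R]_n) :
  (forall i, measurable_fun [set: T] (coordinate i \o f)) ->
  measurable_fun [set: T] f.
Proof.
move=> mf; apply: (@measurability _ _ _ _ setT f
  (\big[setU/set0]_(i < n) preimage_set_system setT (coordinate i) measurable)) => //.
move=> _ [B + <-]; rewrite -bigcup_seq => -[i _ [C mC <-]].
by rewrite setTI; have := mf i measurableT C mC; rewrite !setTI comp_preimage.
Qed.

Definition translation (x y : 'rV[R]_n) : 'rV[R]_n := y + x.

Lemma measurable_translation x : measurable_fun setT (translation x).
Proof.
apply: measurable_coordinateP => i.
rewrite [X in measurable_fun _ X](_ : _ = fun y => coordinate i y + x ord0 i).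
  by apply: measurable_funD => //; exact: measurable_coordinate.
by apply/funext => y /=; rewrite /coordinate mxE.
Qed.

HB.instance Definition _ x :=
  @isMeasurableFun.Build _ _ _ _ (translation x) (measurable_translation x).

End borel_space.


Section lebesgue.
Context {R : realType}.

Definition rV_cons n (x : measurableTypeR R * 'rV[R]_n) : 'rV[R]_n.+1 :=
  \row_i oapp (x.2 ord0) x.1 (unlift ord0 i).

Lemma measurable_rV_cons n : measurable_fun setT (@rV_cons n).
Proof.
apply: measurable_coordinateP => i; case: (unliftP ord0 i) => [j|] ->.
  rewrite [X in measurable_fun _ X](_ : _ = coordinate j \o snd); last first.
    by apply/funext => x /=; rewrite /coordinate mxE liftK.
  by apply: measurableT_comp => //; exact: measurable_coordinate.
rewrite [X in measurable_fun _ X](_ : _ = fst)//.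
by apply/funext => x /=; rewrite /coordinate mxE unlift_none.
Qed.

Definition rV_uncons n (v : 'rV[R]_n.+1) : measurableTypeR R * 'rV[R]_n :=
  (v ord0 ord0, \row_j v ord0 (lift ord0 j)).

Lemma measurable_rV_uncons n : measurable_fun setT (@rV_uncons n).
Proof.
apply: measurable_fun_pair => /=; first exact: (measurable_coordinate ord0).
apply: measurable_coordinateP => j.
rewrite [X in measurable_fun _ X](_ : _ = coordinate (lift ord0 j)).
  exact: measurable_coordinate.
by apply/funext => x /=; rewrite /coordinate mxE.
Qed.

Lemma rV_consK n : cancel (@rV_cons n) (@rV_uncons n).
Proof.
case=> x v; rewrite /rV_uncons /rV_cons mxE unlift_none/=; congr pair.
by apply/rowP => j; rewrite !mxE liftK.
Qed.

HB.instance Definition _ n :=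
  @isMeasurableFun.Build _ _ _ _ (@rV_cons n) (@measurable_rV_cons n).

Section lebesgue_succ.
Local Open Scope ereal_scope.
Context n (mu : {sigma_finite_measure set 'rV[R]_n -> \bar R}).

Definition lebesgue_succ : set 'rV[R]_n.+1 -> \bar R :=
  image_measure (@rV_cons n) (@lebesgue_measure R \x mu).

HB.instance Definition _ := Measure.on lebesgue_succ.

Let lebesgue_succ_sigma_finite : sigma_finite setT lebesgue_succ.
Proof.
have /sigma_finiteP[F [TF ndF Foo]] := sigma_finiteT (@lebesgue_measure R).
have /sigma_finiteP[G [TG ndG Goo]] := sigma_finiteT mu.
exists (fun k => @rV_uncons n @^-1` (F k `*` G k)).
  apply/seteqP; split => // v _.
  have [i _ Fi] : (\bigcup_k F k) (rV_uncons v).1 by rewrite -TF.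
  have [j _ Gj] : (\bigcup_k G k) (rV_uncons v).2 by rewrite -TG.
  exists (maxn i j) => //; split => /=.
    by move: Fi; apply/subsetPset/ndF/leq_maxl.
  by move: Gj; apply/subsetPset/ndG/leq_maxr.
move=> k; have [mF Fk] := Foo k; have [mG Gk] := Goo k; split.
  rewrite -[X in measurable X]setTI; apply: measurable_rV_uncons => //.
  exact: measurableX.
rewrite /lebesgue_succ /image_measure /pushforward -comp_preimage.
rewrite (_ : _ \o _ = id); last by apply/funext => x; exact: rV_consK.
rewrite preimage_id.
rewrite [ltLHS](product_measure1E (@lebesgue_measure R) mu)//.
by rewrite lte_mul_pinfty// ge0_fin_numE.
Qed.

HB.instance Definition _ := @Measure_isSigmaFinite.Build _ _ _ lebesgue_succ
  lebesgue_succ_sigma_finite.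

End lebesgue_succ.

Fixpoint lebesgue_rV n : {sigma_finite_measure set 'rV[R]_n -> \bar R} :=
  match n return {sigma_finite_measure set 'rV[R]_n -> \bar R} with
  | 0 => \d_(0 : 'rV[R]_0)
  | m.+1 => lebesgue_succ (lebesgue_rV m)
  end.

End lebesgue.

Section lattice_sum.
Local Open Scope ereal_scope.
Context {R : realType} (n : nat).
Variable m : 'rV[int]_n -> {measure set 'rV[R]_n -> \bar R}.

Definition lattice_sum (A : set 'rV[R]_n) : \bar R :=
  \esum_(z in [set: 'rV[int]_n]) m z A.

Let lattice_sum0 : lattice_sum set0 = 0.
Proof. by rewrite /lattice_sum esum1. Qed.

Let lattice_sum_ge0 A : 0 <= lattice_sum A.
Proof. by apply: esum_ge0 => z _; exact: measure_ge0. Qed.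

Let lattice_sum_sigma_additive : semi_sigma_additive lattice_sum.
Proof.
move=> F mF tF mUF.
rewrite [X in _ --> X](_ : _ = \sum_(0 <= i <oo) lattice_sum (F i)).
  by apply: is_cvg_nneseries => i _ _; exact: lattice_sum_ge0.
rewrite nneseries_esumT; last by move=> i; exact: lattice_sum_ge0.
rewrite /lattice_sum esum_esum// (reindex_esum ([set: 'rV[int]_n] `*` [set: nat])
  _ (fun x => (x.2, x.1)))//=; last first.
  by split=> //= [[i1 i2] [j1 j2] _ _ [-> ->]//|[i1 i2] _]; exists (i2, i1).
rewrite -(esum_esum (J := fun=> setT) (a := fun z i => m z (F i)))//.
by apply: eq_esum => z _; rewrite -nneseries_esumT// measure_semi_bigcup.
Qed.

HB.instance Definition _ := isMeasure.Build _ _ _ lattice_sum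
  lattice_sum0 lattice_sum_ge0 lattice_sum_sigma_additive.

End lattice_sum.

Section configurations.
Context {R : realType} (n : nat).

(* The canonical sigma-algebra on measures, generated by the evaluations
   [mu |-> mu A] at Borel sets [A]. *)
Definition config : Type := {measure set 'rV[R]_n -> \bar R}.

HB.instance Definition _ := gen_eqMixin config.
HB.instance Definition _ := gen_choiceMixin config.
HB.instance Definition _ := isPointed.Build config mzero.

Definition config_ev (mu : config) (A : set 'rV[R]_n) : \bar R := mu A.

Definition config_measurable : set (set config) :=
  <<s \bigcup_(A in measurable)
        preimage_set_system [set: config] (config_ev ^~ A) measurable >>.

Let config_measurable0 : config_measurable set0.
Proof. exact: sigma_algebra0. Qed.

Let config_measurableC U : config_measurable U -> config_measurable (~` U).
Proof. exact: sigma_algebraC. Qed.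

Let config_measurableU (F : (set config)^nat) :
  (forall i, config_measurable (F i)) -> config_measurable (\bigcup_i F i).
Proof. exact: sigma_algebra_bigcup. Qed.

Definition config_display : measure_display.
Proof. by constructor. Qed.

HB.instance Definition _ := @isMeasurable.Build config_display config
  config_measurable config_measurable0 config_measurableC config_measurableU.

End configurations.
Arguments config : clear implicits.

Section euclidean.
Context {R : realType} (n : nat).

(* The library's norm on row vectors is the sup norm. *)
Definition enorm (x : 'rV[R]_n) : R := Num.sqrt (\sum_i x ord0 i ^+ 2).

Definition inner (x y : 'rV[R]_n) : R := \sum_i x ord0 i * y ord0 i.

Definition eball (r : R) : set 'rV[R]_n := [set x | enorm x < r].

Definition integer_lattice : set 'rV[R]_n :=
  range (map_mx intr : 'rV[int]_n -> 'rV[R]_n).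

Definition lattice_isometry (g : 'rV[R]_n -> 'rV[R]_n) : Prop :=
  (forall x y, enorm (g x - g y) = enorm (x - y)) /\
  g @` integer_lattice = integer_lattice.

Definition unit_cube : set 'rV[R]_n := [set x | forall i, 0 <= x ord0 i < 1].

End euclidean.

Section complex_integrals.
Local Open Scope complex_scope.
Context d (T : measurableType d) {R : realType}.

Definition cintegrable (mu : {measure set T -> \bar R}) (f : T -> R[i]) : Prop :=
  mu.-integrable setT (EFin \o (@complex.Re R \o f)) /\
  mu.-integrable setT (EFin \o (@complex.Im R \o f)).

Definition cintegral (mu : {measure set T -> \bar R}) (f : T -> R[i]) : R[i] :=
  (\int[mu]_x complex.Re (f x)) +i* (\int[mu]_x complex.Im (f x)).

Definition ccovariance (P : probability T R) (X Y : T -> R[i]) : R[i] :=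
  cintegral P (fun w => (X w - cintegral P X) * (Y w - cintegral P Y)^*).

End complex_integrals.

Section fourier.
Local Open Scope complex_scope.
Context {R : realType} (n : nat).

Definition fourier (f : 'rV[R]_n -> R[i]) (k : 'rV[R]_n) : R[i] :=
  cintegral (lebesgue_rV n)
    (fun x => (cos (inner k x) -i* sin (inner k x)) * f x).

Definition test_function (f : 'rV[R]_n -> R[i]) : Prop :=
  [/\ measurable_fun setT (@complex.Re R \o f) /\
        measurable_fun setT (@complex.Im R \o f),
      exists M : R, forall x, `|f x| <= M%:C &
      exists2 K : set 'rV[R]_n, compact K & forall x, ~ K x -> f x = 0].

End fourier.

Section point_processes.
Local Open Scope complex_scope.
Context {R : realType} (n : nat) d (Omega : measurableType d).
Variable P : probability Omega R.
Implicit Types Phi : Omega -> config R n.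

Definition eq_law d' (T : measurableType d') (X Y : Omega -> T) : Prop :=
  forall A, measurable A -> P (X @^-1` A) = P (Y @^-1` A).

Definition image_config (g : {mfun 'rV[R]_n >-> 'rV[R]_n})
  (mu : config R n) : config R n := image_measure g mu.

(* A random locally finite counting measure; multiple points are allowed. *)
Definition point_process Phi : Prop :=
  measurable_fun setT Phi /\
  forall w, (forall A, measurable A ->
               Phi w A = +oo%E \/ exists k : nat, Phi w A = k%:R%:E) /\
            (forall r, (Phi w (eball r) < +oo)%E).

Definition stationary Phi : Prop :=
  forall x, eq_law (fun w => image_config (translation x) (Phi w)) Phi.

Definition jointly_stationary Phi Psi : Prop :=
  forall x, eq_law
    (fun w => (image_config (translation x) (Phi w),
               image_config (translation x) (Psi w)))
    (fun w => (Phi w, Psi w)).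

(* [beta] is a Bartlett spectral measure of [Phi]; it is unique as a Borel
   measure.  The assumptions under which the notion is defined (stationary
   point process, square integrable counts) are part of the predicate, and the
   spectral integral is required to converge absolutely. *)
Definition bartlett_measure Phi
    (beta : {measure set 'rV[R]_n -> \bar R}) : Prop :=
  [/\ point_process Phi, stationary Phi,
      (\int[P]_w (Phi w (eball 1) ^+ 2) < +oo)%E,
      (forall r, (beta (eball r) < +oo)%E) &
      forall f g, test_function f -> test_function g ->
        let h k := fourier f k * (fourier g k)^* in
        cintegrable beta h /\
        ccovariance P (fun w => cintegral (Phi w) f)
                      (fun w => cintegral (Phi w) g) =
        ((2 * pi) ^- n)%:C * cintegral beta h].

Definition scaled_mass (beta : set 'rV[R]_n -> \bar R) (e : R) : R :=
  e ^- n * fine (beta (eball e)).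

Definition s_uniform Phi (s : R) : Prop :=
  exists2 beta : {measure set 'rV[R]_n -> \bar R}, bartlett_measure Phi beta &
    scaled_mass beta =O_ (0^'+) (fun e : R => e `^ s).

Definition beyond_s_uniform Phi (s : R) : Prop :=
  exists2 beta : {measure set 'rV[R]_n -> \bar R}, bartlett_measure Phi beta &
    scaled_mass beta =o_ (0^'+) (fun e : R => e `^ s).

Definition solely_s_uniform Phi (s : R) : Prop :=
  s_uniform Phi s /\ ~ beyond_s_uniform Phi s.

Definition uniform_on_cube (U : Omega -> 'rV[R]_n) : Prop :=
  measurable_fun setT U /\
  forall A, measurable A -> P (U @^-1` A) = lebesgue_rV n (A `&` @unit_cube R n).

Definition lattice_point (u : 'rV[R]_n) (z : 'rV[int]_n) : 'rV[R]_n := map_mx intr z + u.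

Definition stationary_lattice (U : Omega -> 'rV[R]_n) (w : Omega) : config R n :=
  lattice_sum (fun z => \d_(lattice_point (U w) z)).

Definition stationary_thinning (U : Omega -> 'rV[R]_n) Phi : Prop :=
  [/\ point_process Phi,
      {ae P, forall w, forall x, (Phi w [set x] <= 1)%E},
      {ae P, forall w, Phi w (~` range (lattice_point (U w))) = 0%E} &
      jointly_stationary Phi (stationary_lattice U)].

(* Isometries are continuous, so taking [g] measurable loses none of them. *)
Definition lattice_isometry_invariant Phi : Prop :=
  forall g : {mfun 'rV[R]_n >-> 'rV[R]_n}, lattice_isometry g ->
    eq_law (fun w => image_config g (Phi w)) Phi.

Definition unit_e1 : 'rV[R]_n := \row_i (val i == 0%N)%:R.

Definition ind_dirac (b : bool) (x : 'rV[R]_n) :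
    {measure set 'rV[R]_n -> \bar R} :=
  if b then (\d_x : {measure set _ -> \bar _}) else mzero.

Definition shifted_lattice (U : Omega -> 'rV[R]_n) Phi (w : Omega) :
    config R n :=
  lattice_sum (fun z => let x := lattice_point (U w) z in
    measure_add
      (ind_dirac (Phi w [set x] == 1%E) (x + 2^-1 *: unit_e1))
      (ind_dirac (Phi w [set x] == 0%E) (x - 2^-1 *: unit_e1))).

End point_processes.

(* Main.v *)
From HB Require Import structures.
Require Import Defs.
From mathcomp Require Import all_boot all_order all_algebra all_fingroup.
From mathcomp Require Import all_classical all_reals all_analysis.
From mathcomp Require Import measurable_realfun complex ring lra.

Set Implicit Arguments.
Unset Strict Implicit.
Unset Printing Implicit Defensive.

Import Order.TTheory GRing.Theory Num.Theory.
Import numFieldNormedType.Exports.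

Local Open Scope classical_set_scope.
Local Open Scope ring_scope.

(* Let e = e_1 / 2 and let L be the lattice Z^d + U. Moving the points of Phi by
   e and the other lattice points by -e gives, almost surely and for every test
   function f,
     Psi(f) = Phi(f(. + e) - f(. - e)) + L(f(. - e)).
   The two shifted copies of f differ by the translation by the lattice vector
   e_1, which fixes L, so by joint stationarity the first term is uncorrelated
   with all linear statistics of L. Hence Psi has the Bartlett measure
     4 sin(k_1 / 2)^2 beta_Phi(dk) + (2 pi)^d sum_(m <> 0) delta_(2 pi m),
   the second part being Parseval's identity on the torus. Near 0 only the
   density 4 sin(k_1 / 2)^2 ~ k_1^2 counts; it gives the upper bound at once.
   For the lower bound, a Bartlett measure is determined near 0, so beta_Phi is
   there invariant under permutations of the coordinates, and the k_1^2-moments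
   of small balls control their |k|^2-moments. If these were o(r^(2+p)), then
   Chebyshev's inequality on the shell between a r and r would turn
   beta_Phi(B_r) = O(r^p) into o(r^p). *)

(** * Complex integrals *)

(** Degrees are stated through the existence of some Bartlett measure. To exclude a better degree
    one therefore starts from a measure of Psi about which only the covariance identity is known.
    Uniqueness near 0 compares it with the explicit measure, and is used once more to turn
    invariance in law under coordinate permutations into symmetry of the spectral measure. It is
    proved only near the origin, where the Fourier transform of the unit cube is bounded away from
    0, and this is enough. Uniqueness and Parseval's identity rest on one density theorem: an
    algebra of bounded functions is dense in L2 of a finite measure once its closure contains the
    indicators of all measurable sets, which only has to be checked on half-spaces. Stationarity of
    Psi is not immediate. Only the joint law of Phi and the lattice is invariant, not U, so Psi has
    to be recovered from that pair outside a null set. Positivity of p enters in the last step: the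
    ball of radius a r has mass at most C a^p r^p, which is small against r^p once a is small, and a
    may be fixed before r tends to 0. *)

Section complex_integral_theory.
Local Open Scope complex_scope.
Context d (T : measurableType d) {R : realType}.
Implicit Types (mu : {measure set T -> \bar R}) (f g : T -> R[i]) (c : R[i]).

Lemma Re_conj (z : R[i]) : complex.Re z^*%R = complex.Re z.
Proof. by case: z. Qed.

Lemma Im_conj (z : R[i]) : complex.Im z^*%R = - complex.Im z.
Proof. by case: z. Qed.

Lemma cintegrableD mu f g : cintegrable mu f -> cintegrable mu g ->
  cintegrable mu (fun x => f x + g x).
Proof.
move=> [f1 f2] [g1 g2]; split.
  apply: eq_integrable (integrableD measurableT f1 g1) => // x _ /=.
  by case: (f x) (g x) => a b [a' b'].
apply: eq_integrable (integrableD measurableT f2 g2) => // x _ /=.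
by case: (f x) (g x) => a b [a' b'].
Qed.

Lemma cintegrableZ mu c f : cintegrable mu f -> cintegrable mu (fun x => c * f x).
Proof.
case: c => a b [f1 f2]; split.
  apply: eq_integrable (integrableB measurableT (integrableZl measurableT a f1)
    (integrableZl measurableT b f2)) => // x _ /=.
  by case: (f x).
apply: eq_integrable (integrableD measurableT (integrableZl measurableT a f2)
    (integrableZl measurableT b f1)) => // x _ /=.
by case: (f x).
Qed.

Lemma cintegralD mu f g : cintegrable mu f -> cintegrable mu g ->
  cintegral mu (fun x => f x + g x) = cintegral mu f + cintegral mu g.
Proof.
move=> [f1 f2] [g1 g2]; rewrite /cintegral /=; congr (_ +i* _).
  rewrite -RintegralD//; apply: eq_Rintegral => x _.
  by case: (f x) (g x) => a b [a' b'].
rewrite -RintegralD//; apply: eq_Rintegral => x _.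
by case: (f x) (g x) => a b [a' b'].
Qed.

Lemma cintegralZ mu c f : cintegrable mu f ->
  cintegral mu (fun x => c * f x) = c * cintegral mu f.
Proof.
case: c => a b [f1 f2]; rewrite /cintegral /=; congr (_ +i* _).
  rewrite -!RintegralZl// -RintegralB//; last 2 first.
    exact: (integrableZl measurableT a f1).
    exact: (integrableZl measurableT b f2).
  by apply: eq_Rintegral => x _; case: (f x).
rewrite -!RintegralZl// -RintegralD//; last 2 first.
  exact: (integrableZl measurableT a f2).
  exact: (integrableZl measurableT b f1).
by apply: eq_Rintegral => x _; case: (f x).
Qed.

Lemma cintegralJ mu f : cintegrable mu f ->
  cintegral mu (fun x => (f x)^*%R) = (cintegral mu f)^*%R.
Proof.
move=> [f1 f2]; rewrite /cintegral.
transitivity ((\int[mu]_x complex.Re (f x)) -i* (\int[mu]_x complex.Im (f x))) => //.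
congr (_ +i* _).
  by apply: eq_Rintegral => x _; rewrite Re_conj.
rewrite -[RHS]mulN1r -RintegralZl//; apply: eq_Rintegral => x _.
by rewrite Im_conj mulN1r.
Qed.

Lemma cintegralB mu f g : cintegrable mu f -> cintegrable mu g ->
  cintegral mu (fun x => f x - g x) = cintegral mu f - cintegral mu g.
Proof.
move=> fi gi; rewrite -mulN1r -cintegralZ// -cintegralD//; last exact: cintegrableZ.
by congr cintegral; apply/funext => x; rewrite mulN1r.
Qed.

Lemma cintegrableB mu f g : cintegrable mu f -> cintegrable mu g ->
  cintegrable mu (fun x => f x - g x).
Proof.
move=> fi gi; rewrite [X in cintegrable _ X](_ : _ = fun x => f x + (-1) * g x).
  by apply: cintegrableD => //; exact: cintegrableZ.
by apply/funext => x; rewrite mulN1r.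
Qed.

Lemma cintegrable0 mu : cintegrable mu (fun=> 0).
Proof. by split; exact: integrable0. Qed.

Lemma cintegral0 mu : cintegral mu (fun=> 0) = 0.
Proof. by rewrite /cintegral !Rintegral_cst//= !mul0r. Qed.

Lemma cintegrable_sum mu (I : Type) (s : seq I) (F : I -> T -> R[i]) :
  (forall i, cintegrable mu (F i)) -> cintegrable mu (fun x => \sum_(i <- s) F i x).
Proof.
move=> iF; elim: s => [|i s ih].
  rewrite [X in cintegrable _ X](_ : _ = fun=> 0); first exact: cintegrable0.
  by apply/funext => x; rewrite big_nil.
rewrite [X in cintegrable _ X](_ : _ = fun x => F i x + \sum_(i <- s) F i x).
  exact: cintegrableD.
by apply/funext => x; rewrite big_cons.
Qed.

Lemma cintegral_sum mu (I : Type) (s : seq I) (F : I -> T -> R[i]) :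
  (forall i, cintegrable mu (F i)) ->
  cintegral mu (fun x => \sum_(i <- s) F i x) = \sum_(i <- s) cintegral mu (F i).
Proof.
move=> iF; elim: s => [|i s ih].
  rewrite big_nil -[RHS](cintegral0 mu); congr cintegral.
  by apply/funext => x; rewrite big_nil.
rewrite big_cons -ih -cintegralD//; last exact: cintegrable_sum.
by congr cintegral; apply/funext => x; rewrite big_cons.
Qed.

Lemma ae_eq_cintegral mu f g :
  measurable_fun setT (@complex.Re R \o f) -> measurable_fun setT (@complex.Im R \o f) ->
  measurable_fun setT (@complex.Re R \o g) -> measurable_fun setT (@complex.Im R \o g) ->
  {ae mu, forall x, f x = g x} -> cintegral mu f = cintegral mu g.
Proof.
move=> mf1 mf2 mg1 mg2 fg; rewrite /cintegral /Rintegral; congr (fine _ +i* fine _).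
  apply: ae_eq_integral => //; [exact/measurable_EFinP|exact/measurable_EFinP|].
  by apply: filterS fg => x /= ->.
apply: ae_eq_integral => //; [exact/measurable_EFinP|exact/measurable_EFinP|].
by apply: filterS fg => x /= ->.
Qed.

Lemma eq_measure_cintegral (mu nu : {measure set T -> \bar R}) f :
  (forall A, measurable A -> mu A = nu A) -> cintegral mu f = cintegral nu f.
Proof.
move=> mn; rewrite /cintegral /Rintegral; congr (fine _ +i* fine _);
  by apply: eq_measure_integral => A mA _; exact: mn.
Qed.

(* Boundedness holds almost everywhere only: linear statistics of a thinning
   are bounded outside a null set. *)
Definition ess_bounded mu f : Prop :=
  [/\ measurable_fun setT (@complex.Re R \o f), measurable_fun setT (@complex.Im R \o f) &
   exists M : R, {ae mu, forall x, `|complex.Re (f x)| <= M /\ `|complex.Im (f x)| <= M}].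

Lemma ess_boundedD mu f g : ess_bounded mu f -> ess_bounded mu g ->
  ess_bounded mu (fun x => f x + g x).
Proof.
move=> [f1 f2 [M fM]] [g1 g2 [N gN]]; split.
- rewrite [X in measurable_fun _ X](_ : _ = (@complex.Re R \o f) \+ (@complex.Re R \o g)).
    exact: measurable_funD.
  by apply/funext => x /=; case: (f x) (g x) => ? ? [].
- rewrite [X in measurable_fun _ X](_ : _ = (@complex.Im R \o f) \+ (@complex.Im R \o g)).
    exact: measurable_funD.
  by apply/funext => x /=; case: (f x) (g x) => ? ? [].
exists (M + N); apply: filterS2 fM gN => x.
case: (f x) (g x) => a b [a' b'] /= [h1 h2] [h3 h4].
by split; apply: (le_trans (ler_normD _ _)); exact: lerD.
Qed.

Lemma ess_boundedM mu f g : ess_bounded mu f -> ess_bounded mu g ->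
  ess_bounded mu (fun x => f x * g x).
Proof.
move=> [f1 f2 [M fM]] [g1 g2 [N gN]]; split.
- rewrite [X in measurable_fun _ X](_ : _ = (@complex.Re R \o f) \* (@complex.Re R \o g)
      \- (@complex.Im R \o f) \* (@complex.Im R \o g)).
    by apply: measurable_funB; exact: measurable_funM.
  by apply/funext => x /=; case: (f x) (g x) => ? ? [].
- rewrite [X in measurable_fun _ X](_ : _ = (@complex.Re R \o f) \* (@complex.Im R \o g)
      \+ (@complex.Im R \o f) \* (@complex.Re R \o g)).
    by apply: measurable_funD; exact: measurable_funM.
  by apply/funext => x /=; case: (f x) (g x) => ? ? [].
exists (M * N + M * N); apply: filterS2 fM gN => x.
case: (f x) (g x) => a b [a' b'] /= [h1 h2] [h3 h4].
split.
  by apply: (le_trans (ler_normB _ _)); rewrite !normrM; apply: lerD; exact: ler_pM.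
by apply: (le_trans (ler_normD _ _)); rewrite !normrM; apply: lerD; exact: ler_pM.
Qed.

Lemma ess_boundedJ mu f : ess_bounded mu f -> ess_bounded mu (fun x => (f x)^*%R).
Proof.
move=> [f1 f2 [M fM]]; split.
- by rewrite [X in measurable_fun _ X](_ : _ = @complex.Re R \o f)//;
    apply/funext => x /=; rewrite Re_conj.
- rewrite [X in measurable_fun _ X](_ : _ = \- (@complex.Im R \o f)).
    exact: measurable_funN.
  by apply/funext => x /=; rewrite Im_conj.
by exists M; apply: filterS fM => x; rewrite Re_conj Im_conj normrN.
Qed.

Lemma ess_bounded_cst mu c : ess_bounded mu (fun=> c).
Proof.
split; [exact: measurable_cst|exact: measurable_cst|].
exists (`|complex.Re c| + `|complex.Im c|); apply: nearW => x.
by rewrite lerDl lerDr.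
Qed.

Lemma ess_boundedZ mu c f : ess_bounded mu f -> ess_bounded mu (fun x => c * f x).
Proof. by apply: ess_boundedM; exact: ess_bounded_cst. Qed.

Lemma ess_boundedB mu f g : ess_bounded mu f -> ess_bounded mu g ->
  ess_bounded mu (fun x => f x - g x).
Proof.
move=> fi gi; rewrite [X in ess_bounded _ X](_ : _ = fun x => f x + (-1) * g x).
  by apply: ess_boundedD => //; exact: ess_boundedZ.
by apply/funext => x; rewrite mulN1r.
Qed.

Lemma ess_bounded_sum mu (I : Type) (s : seq I) (F : I -> T -> R[i]) :
  (forall i, ess_bounded mu (F i)) -> ess_bounded mu (fun x => \sum_(i <- s) F i x).
Proof.
move=> iF; elim: s => [|i s ih].
  rewrite [X in ess_bounded _ X](_ : _ = fun=> 0); first exact: ess_bounded_cst.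
  by apply/funext => x; rewrite big_nil.
rewrite [X in ess_bounded _ X](_ : _ = fun x => F i x + \sum_(i <- s) F i x).
  exact: ess_boundedD.
by apply/funext => x; rewrite big_cons.
Qed.

Lemma ae_bounded_integrable mu (f : T -> R) (M : R) : (mu setT < +oo)%E ->
  measurable_fun setT f -> {ae mu, forall x, `|f x| <= M} ->
  mu.-integrable setT (EFin \o f).
Proof.
move=> muT mf fM; apply/integrableP; split; first exact/measurable_EFinP.
(* The absolute value guards against a negative [M], which the hypothesis allows when [mu]
   vanishes. *)
apply: (@le_lt_trans _ _ (\int[mu]_x (cst `|M|%:E x))%E).
  apply: ae_ge0_le_integral => //=.
  - by apply/measurable_EFinP; exact: measurableT_comp.
  - apply: filterS fM => x + _ /=; rewrite lee_fin => /le_trans; apply.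
    exact: ler_norm.
by rewrite integral_cst// lte_mul_pinfty// ?lee_fin// fin_numElt.
Qed.

Lemma ess_bounded_cintegrable mu f : (mu setT < +oo)%E ->
  ess_bounded mu f -> cintegrable mu f.
Proof.
move=> muT [f1 f2 [M fM]]; split; apply: (ae_bounded_integrable (M := M)) => //.
  by apply: filterS fM => x [].
by apply: filterS fM => x [].
Qed.

End complex_integral_theory.

(** * Density in L2 *)

Section polynomial_threshold.
Context {R : realType}.

(* By Bernoulli's inequality these tend to the indicator of [0, 1/2[ on [0, 1], so an
   L2-closed algebra contains the indicators of the sublevel sets of its members. *)
Definition threshold_poly (n : nat) (x : R) : R := (1 - x ^+ (n ^ 2)) ^+ (n * 2 ^ (n ^ 2)).

Lemma bernoulli_ge (x : R) n : 0 <= x <= 1 -> 1 - x *+ n <= (1 - x) ^+ n.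
Proof.
move=> /andP[x0 x1]; elim: n => [|n ih]; first by rewrite mulr0n subr0 expr0.
rewrite exprS mulrS.
have : (1 - x) * (1 - x *+ n) <= (1 - x) * (1 - x) ^+ n by rewrite ler_wpM2l// subr_ge0.
apply: le_trans; rewrite mulrBl mul1r mulrBr mulr1.
have : 0 <= x * x *+ n by rewrite mulrn_wge0// mulr_ge0.
rewrite -mulrnAr; lra.
Qed.

Lemma bernoulli_le (x : R) n : 0 <= x <= 1 -> (1 - x) ^+ n * (1 + x *+ n) <= 1.
Proof.
move=> /andP[x0 x1]; elim: n => [|n ih]; first by rewrite mulr0n addr0 expr0 mulr1.
apply: le_trans ih; rewrite exprSr -mulrA ler_wpM2l ?exprn_ge0 ?subr_ge0//.
rewrite mulrS mulrBl mul1r mulrDr mulr1.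
have : 0 <= x * x *+ n by rewrite mulrn_wge0// mulr_ge0.
have : 0 <= x * x by rewrite mulr_ge0.
rewrite mulrDr -mulrnAr; lra.
Qed.

Lemma bernoulli_expr_ge (x : R) n : 0 <= x -> 1 + x *+ n <= (1 + x) ^+ n.
Proof.
move=> x0; elim: n => [|n ih]; first by rewrite mulr0n addr0 expr0.
rewrite exprS mulrS.
have : (1 + x) * (1 + x *+ n) <= (1 + x) * (1 + x) ^+ n by rewrite ler_wpM2l// addr_ge0.
apply: le_trans; rewrite mulrDl mul1r mulrDr mulr1.
have : 0 <= x * x *+ n by rewrite mulrn_wge0// mulr_ge0.
rewrite -mulrnAr; lra.
Qed.

Lemma threshold_poly_bounded n (x : R) : 0 <= x <= 1 -> 0 <= threshold_poly n x <= 1.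
Proof.
move=> /andP[x0 x1]; rewrite /threshold_poly.
have h : 0 <= 1 - x ^+ (n ^ 2) <= 1.
  by rewrite subr_ge0 exprn_ile1//= gerBl exprn_ge0.
by case/andP: h => h1 h2; rewrite exprn_ge0//= exprn_ile1.
Qed.

Lemma cvg_of_bound (u : R^nat) (l C : R) :
  (forall n, (0 < n)%N -> `|u n - l| <= C / n%:R) -> u n @[n --> \oo] --> l.
Proof.
move=> uC; apply/cvgrPdist_le => e e0.
near=> n; rewrite distrC; apply: le_trans (uC n _) _; first by near: n; exists 1%N.
rewrite ler_pdivrMr; last by rewrite ltr0n; near: n; exists 1%N.
rewrite mulrC -ler_pdivrMr//.
near: n; exact: nbhs_infty_ger.
Unshelve. all: by end_near. Qed.

(** With y = x^(n^2) and N = n 2^(n^2) one has N y = n (2x)^(n^2), which tends to 0 for x < 1/2 and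
    is at least n for x >= 1/2. Bernoulli's inequality bounds (1 - y)^N below by 1 - N y in the
    first case, and above by 1 / (1 + N y) in the second. The point 1/2 falls on the side of the
    limit 0, so strict sublevel sets come out. *)
Lemma threshold_poly_cvg (x : R) : 0 <= x <= 1 ->
  threshold_poly n x @[n --> \oo] --> (if x < 2^-1 then 1 else 0 : R).
Proof.
move=> x01; have /andP[x0 x1] := x01.
have [xlt|xge] := ltP x 2^-1; last first.
  apply: (@cvg_of_bound _ _ 1) => n n0; rewrite subr0.
  have /andP[t0 _] := threshold_poly_bounded n x01.
  rewrite ger0_norm// ler_pdivlMr ?ltr0n//.
  have y01 : 0 <= x ^+ (n ^ 2) <= 1 by rewrite exprn_ge0//= exprn_ile1.
  apply: le_trans (bernoulli_le (n * 2 ^ (n ^ 2)) y01).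
  rewrite /threshold_poly ler_wpM2l//.
  suff : n%:R <= x ^+ (n ^ 2) *+ (n * 2 ^ (n ^ 2)) by lra.
  rewrite -[X in _ <= X]mulr_natr natrM natrX mulrCA -exprMn ler_peMr//.
  rewrite exprn_ege1//; lra.
have [->|xn0] := eqVneq x 0.
  apply: (@cvg_of_bound _ _ 0) => n n0; rewrite mul0r normr_le0 subr_eq0.
  by rewrite /threshold_poly expr0n/= muln_eq0/= -!leqn0 leqNgt n0/= subr0 expr1n.
have {xn0}xp : 0 < x by rewrite lt_neqAle eq_sym xn0.
(* Thus 2x = 1 / (1 + dl), and (2x)^(n^2) <= 1 / (1 + n^2 dl) absorbs the factor n; this is why the
   exponent is n^2 and not n. *)
pose dl := (2 * x)^-1 - 1.
have dl0 : 0 < dl.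
  by rewrite /dl subr_gt0 -invr1 ltf_pV2 ?posrE//; lra.
apply: (@cvg_of_bound _ _ dl^-1) => n n0.
have /andP[t0 t1] := threshold_poly_bounded n x01.
rewrite distrC ger0_norm ?subr_ge0//.
have y01 : 0 <= x ^+ (n ^ 2) <= 1 by rewrite exprn_ge0//= exprn_ile1.
have := bernoulli_ge (n * 2 ^ (n ^ 2)) y01; rewrite -/(threshold_poly n x) => h.
have {h} : 1 - threshold_poly n x <= x ^+ (n ^ 2) *+ (n * 2 ^ (n ^ 2)) by lra.
move=> /le_trans; apply.
rewrite -mulr_natr natrM natrX mulrCA -exprMn.
have xE : x * 2 = (1 + dl)^-1 by rewrite /dl addrC subrK invrK mulrC.
have dn0 : 0 < dl * n%:R by rewrite mulr_gt0// ltr0n.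
rewrite xE exprVn -invfM ler_pdivrMr; last by rewrite exprn_gt0//; lra.
rewrite mulrC ler_pdivlMr//.
have := bernoulli_expr_ge (n ^ 2) (ltW dl0).
rewrite -[_ *+ _]mulr_natr natrX; nra.
Qed.

End polynomial_threshold.

Section density.
Context d (T : measurableType d) {R : realType}.
Variable mu : {measure set T -> \bar R}.
Hypothesis mu_fin : (mu setT < +oo)%E.
Implicit Types (f g h k : T -> R) (c : R).

Definition bounded_measurable (f : T -> R) : Prop :=
  measurable_fun setT f /\ exists M, forall x, `|f x| <= M.

Lemma bounded_measurableD f g : bounded_measurable f -> bounded_measurable g ->
  bounded_measurable (f \+ g).
Proof.
move=> [mf [M fM]] [mg [N gN]]; split; first exact: measurable_funD.
by exists (M + N) => x /=; apply: (le_trans (ler_normD _ _)); exact: lerD.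
Qed.

Lemma bounded_measurableM f g : bounded_measurable f -> bounded_measurable g ->
  bounded_measurable (f \* g).
Proof.
move=> [mf [M fM]] [mg [N gN]]; split; first exact: measurable_funM.
by exists (M * N) => x /=; rewrite normrM; exact: ler_pM.
Qed.

Lemma bounded_measurable_cst c : bounded_measurable (cst c).
Proof. by split=> //; exists `|c|. Qed.

Lemma bounded_measurable_integrable f : bounded_measurable f ->
  mu.-integrable setT (EFin \o f).
Proof.
by move=> [mf [M fM]]; apply: (ae_bounded_integrable (M := M)) => //; exact: nearW.
Qed.

Variable H : set (T -> R).
Hypothesis H_bounded : H `<=` bounded_measurable.
Hypothesis H_cst : forall c, H (cst c).
Hypothesis H_add : forall f g, H f -> H g -> H (f \+ g).
Hypothesis H_mul : forall f g, H f -> H g -> H (f \* g).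

Definition sqdist (f g : T -> R) : \bar R := (\int[mu]_x ((f x - g x) ^+ 2)%:E)%E.

Definition L2_closure : set (T -> R) := [set f | bounded_measurable f /\
  forall e : R, 0 < e -> exists2 h, H h & (sqdist f h <= e%:E)%E].

Lemma measurable_sqdist f g : measurable_fun setT f -> measurable_fun setT g ->
  measurable_fun setT (fun x => ((f x - g x) ^+ 2)%:E).
Proof.
by move=> mf mg; apply/measurable_EFinP; apply: measurable_funX; exact: measurable_funB.
Qed.

Lemma sqdist_bound f g h k c : 0 <= c -> measurable_fun setT f -> measurable_fun setT g ->
  measurable_fun setT h -> measurable_fun setT k ->
  (forall x, (f x - g x) ^+ 2 <= c * (h x - k x) ^+ 2) ->
  (sqdist f g <= c%:E * sqdist h k)%E.
Proof.
move=> c0 mf mg mh mk fgh; rewrite /sqdist.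
rewrite -ge0_integralZl//; last 2 first.
- exact: measurable_sqdist.
- by move=> x _; rewrite lee_fin sqr_ge0.
apply: ge0_le_integral => //.
- by move=> x _; rewrite lee_fin sqr_ge0.
- exact: measurable_sqdist.
- by apply: measurable_funeM; exact: measurable_sqdist.
by move=> x _; rewrite -EFinM lee_fin.
Qed.

Lemma sqdist_triangle f g h : measurable_fun setT f -> measurable_fun setT g ->
  measurable_fun setT h -> (sqdist f h <= 2%:E * sqdist f g + 2%:E * sqdist g h)%E.
Proof.
move=> mf mg mh; rewrite /sqdist.
rewrite -!ge0_integralZl//; try exact: measurable_sqdist;
  try by move=> x _; rewrite lee_fin sqr_ge0.
rewrite -ge0_integralD//; last 4 first.
- by move=> x _; rewrite -EFinM lee_fin mulr_ge0// sqr_ge0.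
- by apply: measurable_funeM; exact: measurable_sqdist.
- by move=> x _; rewrite -EFinM lee_fin mulr_ge0// sqr_ge0.
- by apply: measurable_funeM; exact: measurable_sqdist.
apply: ge0_le_integral => //.
- by move=> x _; rewrite lee_fin sqr_ge0.
- exact: measurable_sqdist.
- by apply: emeasurable_funD; apply: measurable_funeM; exact: measurable_sqdist.
move=> x _; rewrite -!EFinM -EFinD lee_fin.
rewrite -subr_ge0 (_ : _ - _ = ((f x - g x) - (g x - h x)) ^+ 2); last by ring.
exact: sqr_ge0.
Qed.

Lemma L2_closureP f : bounded_measurable f ->
  (forall e : R, 0 < e -> exists2 h, L2_closure h & (sqdist f h <= e%:E)%E) -> L2_closure f.
Proof.
move=> bf fh; split=> // e e0.
have e40 : 0 < e / 4 by rewrite divr_gt0.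
have [h [bh clh] fhe] := fh _ e40.
have [k Hk hke] := clh _ e40; exists k => //.
apply: (le_trans (@sqdist_triangle f h k _ _ _)).
- by case: bf.
- by case: bh.
- by case: (H_bounded Hk).
apply: (@le_trans _ _ (2%:E * (e / 4)%:E + 2%:E * (e / 4)%:E)%E).
  by apply: leeD; apply: lee_wpmul2l.
by rewrite -!EFinM -EFinD lee_fin; lra.
Qed.

Lemma sub_L2_closure : H `<=` L2_closure.
Proof.
move=> h Hh; split; first exact: H_bounded.
move=> e e0; exists h => //; rewrite /sqdist integral0_eq ?lee_fin ?ltW//.
by move=> x _; rewrite subrr expr0n.
Qed.

Lemma L2_closure_cst c : L2_closure (cst c).
Proof. exact: sub_L2_closure. Qed.

Lemma sqdist_shift f g k : sqdist (f \+ k) (g \+ k) = sqdist f g.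
Proof. by rewrite /sqdist; apply: eq_integral => x _ /=; congr ((_ ^+ _)%:E); ring. Qed.

Lemma L2_closureD f g : L2_closure f -> L2_closure g -> L2_closure (f \+ g).
Proof.
move=> [bf clf] [bg clg]; split; first exact: bounded_measurableD.
move=> e e0; have e40 : 0 < e / 4 by rewrite divr_gt0.
have [h Hh fh] := clf _ e40; have [k Hk gk] := clg _ e40.
exists (h \+ k); first exact: H_add.
have [mh _] := H_bounded Hh; have [mk _] := H_bounded Hk.
have [mf _] := bf; have [mg _] := bg.
apply: (le_trans (@sqdist_triangle _ (h \+ g) _ _ _ _)); try exact: measurable_funD.
rewrite sqdist_shift (_ : sqdist (h \+ g) _ = sqdist g k); last first.
  by rewrite /sqdist; apply: eq_integral => x _ /=; congr ((_ ^+ _)%:E); ring.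
apply: (@le_trans _ _ (2%:E * (e / 4)%:E + 2%:E * (e / 4)%:E)%E).
  by apply: leeD; apply: lee_wpmul2l.
by rewrite -!EFinM -EFinD lee_fin; lra.
Qed.

(** L2 approximants carry no common bound, so the two factors of a product cannot be approximated at
    once. Here the fixed factor is a bounded member of the algebra; in [L2_closureM] it is the
    bounded function [f] itself. *)
Lemma L2_closure_mulH f h : L2_closure f -> H h -> L2_closure (f \* h).
Proof.
move=> [bf clf] Hh; have [mh [M hM]] := H_bounded Hh; have [mf _] := bf.
split; first exact: (bounded_measurableM bf (H_bounded Hh)).
(* The summand 1 keeps the divisor positive when the bound [M] is 0. *)
move=> e e0; have c0 : 0 < M ^+ 2 + 1 by rewrite ltr_pwDr// sqr_ge0.
have [k Hk fk] := clf _ (divr_gt0 e0 c0).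
have [mk _] := H_bounded Hk.
exists (k \* h); first exact: H_mul.
apply: (@le_trans _ _ ((M ^+ 2 + 1)%:E * sqdist f k)%E).
  apply: sqdist_bound => //; [exact: ltW|exact: measurable_funM|exact: measurable_funM|].
  move=> x /=; rewrite -mulrBl exprMn mulrC ler_wpM2r ?sqr_ge0//.
  have : h x ^+ 2 <= M ^+ 2 by rewrite -real_normK ?num_real// ler_sqr ?nnegrE// (le_trans _ (hM x)).
  lra.
apply: (@le_trans _ _ ((M ^+ 2 + 1)%:E * (e / (M ^+ 2 + 1))%:E)%E).
  by apply: lee_wpmul2l => //; rewrite lee_fin ltW.
by rewrite -EFinM lee_fin mulrC divfK// gt_eqF.
Qed.

Lemma L2_closureM f g : L2_closure f -> L2_closure g -> L2_closure (f \* g).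
Proof.
move=> clf [bg clg]; have [bf _] := clf; have [mf [M fM]] := bf; have [mg _] := bg.
apply: L2_closureP; first exact: bounded_measurableM.
move=> e e0; have c0 : 0 < M ^+ 2 + 1 by rewrite ltr_pwDr// sqr_ge0.
have [k Hk gk] := clg _ (divr_gt0 e0 c0).
have [mk _] := H_bounded Hk.
exists (f \* k); first exact: L2_closure_mulH.
apply: (@le_trans _ _ ((M ^+ 2 + 1)%:E * sqdist g k)%E).
  apply: sqdist_bound => //; [exact: ltW|exact: measurable_funM|exact: measurable_funM|].
  move=> x /=; rewrite -mulrBr exprMn ler_wpM2r ?sqr_ge0//.
  have : f x ^+ 2 <= M ^+ 2 by rewrite -real_normK ?num_real// ler_sqr ?nnegrE// (le_trans _ (fM x)).
  lra.
apply: (@le_trans _ _ ((M ^+ 2 + 1)%:E * (e / (M ^+ 2 + 1))%:E)%E).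
  by apply: lee_wpmul2l => //; rewrite lee_fin ltW.
by rewrite -EFinM lee_fin mulrC divfK// gt_eqF.
Qed.

Lemma L2_closureX f n : L2_closure f -> L2_closure (fun x => f x ^+ n).
Proof.
move=> clf; elim: n => [|n ih]; first exact: L2_closure_cst.
rewrite (_ : (fun _ => _) = f \* (fun x => f x ^+ n)); first exact: L2_closureM.
by apply/funext => x /=; rewrite exprS.
Qed.

Lemma L2_closureZ c f : L2_closure f -> L2_closure (fun x => c * f x).
Proof. by move=> clf; apply: (L2_closureM (L2_closure_cst c) clf). Qed.

Lemma L2_closure_sum (I : Type) (s : seq I) (F : I -> T -> R) :
  (forall i, L2_closure (F i)) -> L2_closure (fun x => \sum_(i <- s) F i x).
Proof.
move=> clF; elim: s => [|i s ih].
  rewrite (_ : (fun _ => _) = cst 0); first exact: L2_closure_cst.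
  by apply/funext => x; rewrite big_nil.
rewrite (_ : (fun _ => _) = F i \+ (fun x => \sum_(i <- s) F i x)); first exact: L2_closureD.
by apply/funext => x; rewrite big_cons.
Qed.

Lemma L2_closure_ae f g : bounded_measurable f -> L2_closure g ->
  {ae mu, forall x, f x = g x} -> L2_closure f.
Proof.
move=> bf clg fg; apply: L2_closureP => // e e0; exists g => //.
have [mf _] := bf; have [[mg _] _] := clg.
rewrite /sqdist (_ : (\int[mu]_x _)%E = 0%E) ?lee_fin ?ltW//.
rewrite -(@integral0 _ _ _ mu setT); apply: ae_eq_integral => //.
  exact: measurable_sqdist.
by apply: filterS fg => x /= -> _; rewrite subrr expr0n.
Qed.

(** Dominated convergence: the limit inherits the bound [M], so the squared differences stay below
    (2 M)^2, which is integrable because [mu] is finite. *)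
Lemma L2_closure_lim (F : (T -> R)^nat) f (M : R) :
  (forall n, L2_closure (F n)) -> (forall n x, `|F n x| <= M) ->
  (forall x, F n x @[n --> \oo] --> f x) -> L2_closure f.
Proof.
move=> clF FM Ff.
have mF n : measurable_fun setT (F n) by case: (clF n) => -[].
have mf : measurable_fun setT f by apply: (measurable_fun_cvg (h := F)) => // x _; exact: Ff.
have fM x : `|f x| <= M.
  rewrite -(cvg_lim _ (cvg_norm (Ff x)))//; apply: limr_le; last exact: nearW.
  by apply/cvg_ex; exists `|f x|; exact: cvg_norm (Ff x).
apply: L2_closureP => [|e e0]; first by split=> //; exists M.
have cvF : {ae mu, forall x, setT x ->
    (fun n => ((f x - F n x) ^+ 2)%:E) @ \oo --> cst 0%E x}.
  apply: nearW => x _; apply/fine_cvgP; split; first exact: nearW.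
  have fF : f x - F n x @[n --> \oo] --> f x - f x by apply: cvgB => //; exact: cvg_cst.
  rewrite (_ : 0 = (f x - f x) * (f x - f x)); last by rewrite subrr mulr0.
  exact: cvgM.
have ig : mu.-integrable setT (cst ((2 * M) ^+ 2)%:E).
  exact: (bounded_measurable_integrable (bounded_measurable_cst ((2 * M) ^+ 2))).
have Fg : {ae mu, forall x n, setT x ->
    (`|((f x - F n x) ^+ 2)%:E| <= cst ((2 * M) ^+ 2)%:E x)%E}.
  apply: nearW => x n _ /=; rewrite lee_fin ger0_norm ?sqr_ge0// -real_normK ?num_real//.
  rewrite ler_sqr ?nnegrE// ?mulr_ge0//; last exact: le_trans (fM x).
  by apply: (le_trans (ler_normB _ _)); rewrite mulr_natl mulr2n lerD.
have [_ _] := dominated_convergence measurableT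
  (fun n => measurable_sqdist mf (mF n)) (measurable_cst _) cvF ig Fg.
rewrite integral0 => cv.
have : \forall n \near \oo, (sqdist f (F n) < e%:E)%E.
  move: (cv [set y | (y < e%:E)%E]); apply; apply: open_nbhs_nbhs; split.
    exact: open_ereal_lt_ereal.
  by rewrite /= lte_fin.
by case=> n _ /(_ n (leqnn n)) /ltW sd; exists (F n).
Qed.

(** An affine change of scale puts the values into [0, 1] and sends c to 1/2, where the threshold
    polynomials jump; they then converge boundedly to the indicator. *)
Lemma L2_closure_lt f c : L2_closure f -> L2_closure (\1_[set x | f x < c]).
Proof.
move=> clf; have [[mf [M fM]] _] := clf.
pose K := `|M| + `|c| + 1.
have K0 : 0 < K by rewrite ltr_wpDl// addr_ge0.
pose g x := 2^-1 + (2 * K)^-1 * (f x - c).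
have clg : L2_closure g.
  apply: (L2_closureD (L2_closure_cst _)); apply: L2_closureZ.
  exact: (L2_closureD clf (L2_closure_cst _)).
have g01 x : 0 <= g x <= 1.
  have : `|f x - c| <= K.
    apply: (le_trans (ler_normB _ _)); rewrite /K.
    have := fM x; have := ler_norm M; lra.
  rewrite ler_norml /g => /andP[h1 h2].
  have K20 : 0 < 2 * K by rewrite mulr_gt0.
  have : (2 * K)^-1 * (f x - c) <= 2^-1.
    by rewrite mulrC ler_pdivrMr// mulrA mulVf// mul1r.
  have : - 2^-1 <= (2 * K)^-1 * (f x - c).
    by rewrite mulrC ler_pdivlMr// mulNr mulrA mulVf// mul1r.
  lra.
apply: (@L2_closure_lim (fun n x => threshold_poly n (g x)) _ 1).
- move=> n; apply: L2_closureX.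
  rewrite (_ : (fun _ => _) = cst 1 \+ (fun x => -1 * g x ^+ (n ^ 2))); last first.
    by apply/funext => x /=; rewrite mulN1r.
  apply: (L2_closureD (L2_closure_cst _)); apply: L2_closureZ.
  exact: L2_closureX.
- move=> n x; have /andP[t0 t1] := threshold_poly_bounded n (g01 x).
  by rewrite ger0_norm.
move=> x; rewrite indicE.
have -> : (x \in [set x | f x < c]) = (g x < 2^-1).
  rewrite (_ : _ \in _ = (f x < c)); last by apply/idP/idP; rewrite inE.
  by rewrite /g gtrDl pmulr_rlt0 ?subr_lt0// invr_gt0 mulr_gt0.
by have := threshold_poly_cvg (g01 x); case: ifPn.
Qed.

Definition L2_sets : set (set T) := [set A | measurable A /\ L2_closure (\1_A)].

Lemma L2_setsC A : L2_sets A -> L2_sets (~` A).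
Proof.
move=> [mA clA]; split; first exact: measurableC.
rewrite (_ : \1_(~` A) = cst 1 \+ (fun x => -1 * \1_A x)).
  exact: (L2_closureD (L2_closure_cst _) (L2_closureZ _ clA)).
by apply/funext => x /=; rewrite !indicE in_setC; case: (x \in A) => /=; lra.
Qed.

Lemma L2_setsI A B : L2_sets A -> L2_sets B -> L2_sets (A `&` B).
Proof.
move=> [mA clA] [mB clB]; split; first exact: measurableI.
rewrite (_ : \1_(A `&` B) = \1_A \* \1_B); first exact: L2_closureM.
by apply/funext => x /=; rewrite !indicE in_setI -natrM mulnb.
Qed.

Lemma L2_sets0 : L2_sets set0.
Proof. by split=> //; rewrite indic0; exact: L2_closure_cst. Qed.

Lemma L2_setsU A B : L2_sets A -> L2_sets B -> L2_sets (A `|` B).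
Proof.
move=> hA hB; rewrite -[_ `|` _]setCK setCU.
by apply: L2_setsC; apply: L2_setsI; exact: L2_setsC.
Qed.

Lemma L2_sets_bigcup (F : (set T)^nat) : (forall i, L2_sets (F i)) ->
  L2_sets (\bigcup_i F i).
Proof.
move=> hF; split; first by apply: bigcupT_measurable => i; case: (hF i).
pose G n := \big[setU/set0]_(i < n) F i.
have hG n : L2_sets (G n).
  rewrite /G; elim: n => [|n ih]; first by rewrite big_ord0; exact: L2_sets0.
  by rewrite big_ord_recr/=; exact: L2_setsU.
apply: (@L2_closure_lim (fun n => \1_(G n)) _ 1).
- by move=> n; case: (hG n).
- by move=> n x; rewrite indicE ger0_norm// lern1 leq_b1.
move=> x; rewrite indicE; case: (boolP (x \in \bigcup_i F i)).
  rewrite inE => -[i _ Fix].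
  apply: cvg_near_cst.
  exists i.+1 => // n /= ni; rewrite indicE mem_set// /G -bigcup_mkord.
  by exists i.
move=> xF; apply: cvg_near_cst.
apply: nearW => n; rewrite indicE memNset// /G -bigcup_mkord => -[i _ Fix].
by move/negP: xF; apply; rewrite inE; exists i.
Qed.

(** Approximability of all indicators thereby reduces to a generating family of sets. *)
Lemma L2_sets_sigma_algebra : sigma_algebra setT L2_sets.
Proof.
split; first exact: L2_sets0.
  by move=> A hA; rewrite setTD; exact: L2_setsC.
exact: L2_sets_bigcup.
Qed.

Lemma L2_sets_lt f c : L2_closure f -> L2_sets [set x | f x < c].
Proof.
move=> clf; split; last exact: L2_closure_lt.
have [[mf _] _] := clf.
have := mf measurableT _ (measurable_itv `]-oo, c[); rewrite setTI.
by rewrite (_ : _ @^-1` _ = [set y | f y < c]).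
Qed.

Lemma L2_sets_ge f c : L2_closure f -> L2_sets [set x | c <= f x].
Proof.
move=> clf; rewrite (_ : [set x | _] = ~` [set x | f x < c]).
  by apply: L2_setsC; exact: L2_sets_lt.
by apply/seteqP; split=> x /=; rewrite leNgt => /negP.
Qed.

Lemma L2_sets_gt f c : L2_closure f -> L2_sets [set x | c < f x].
Proof.
move=> clf; rewrite (_ : [set x | _] = [set x | -1 * f x < - c]).
  by apply: L2_sets_lt; exact: L2_closureZ.
by apply/seteqP; split=> x /=; rewrite mulN1r ltrN2.
Qed.

(** No uniform bound on the sequence is assumed, so [L2_closure_lim] does not apply. Instead each
    member is measurable for the sigma-algebra of approximable sets, and measurability passes to
    pointwise limits. *)
Lemma L2_sets_lim_lt (F : (T -> R)^nat) f c : (forall n, L2_closure (F n)) ->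
  (forall x, F n x @[n --> \oo] --> f x) -> L2_sets [set x | f x < c].
Proof.
move=> clF Ff; pose T' := g_sigma_algebraType L2_sets.
have mE : @measurable _ T' = L2_sets.
  by apply: sigma_algebra_id; exact: L2_sets_sigma_algebra.
have mf : measurable_fun (setT : set T') (f : T' -> R).
  apply: (@measurable_fun_cvg _ T' R setT F f) => [n|x _]; last exact: Ff.
  apply: (measurability _ (RGenInftyO.measurableE R)) => //.
  move=> _ [_ [x ->] <-]; rewrite setTI mE.
  rewrite (_ : _ @^-1` _ = [set y | F n y < x]); first exact: L2_sets_lt.
  by apply/seteqP; split=> y /=; rewrite in_itv.
have := mf measurableT _ (measurable_itv `]-oo, c[); rewrite setTI mE.
by rewrite (_ : _ @^-1` _ = [set y | f y < c]).
Qed.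

Import HBNNSimple.

Lemma L2_closure_dense : measurable `<=` L2_sets ->
  forall f, bounded_measurable f -> L2_closure f.
Proof.
move=> sub f bf.
suff main g : bounded_measurable g -> (forall x, 0 <= g x) -> L2_closure g.
  have [mf [M fM]] := bf.
  rewrite (_ : f = (f \+ cst M) \+ cst (- M)); last by apply/funext => x /=; rewrite addrK.
  apply: L2_closureD (L2_closure_cst _); apply: main.
    by apply: (bounded_measurableD bf); exact: bounded_measurable_cst.
  by move=> x /=; rewrite -lerBlDr sub0r; have := fM x; rewrite ler_norml => /andP[].
move=> [mg [M gM]] g0.
have mg' : measurable_fun setT (EFin \o g) by exact/measurable_EFinP.
pose G := nnsfun_approx measurableT mg'.
have Gg x : G n x @[n --> \oo] --> g x.
  have := @cvg_nnsfun_approx _ _ _ _ measurableT _ mg' (fun x _ => g0 x) x Logic.I.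
  by move/fine_cvgP => -[].
apply: (@L2_closure_lim G _ M) => //.
  move=> n; rewrite (_ : (G n : T -> R) = fun x => \sum_(r <- finmap.enum_fset (fset_set (range (G n))))
      (r * \1_((G n) @^-1` [set r]) x)); last first.
    by apply/funext => x; rewrite {1}fimfunE fsbig_finite.
  apply: L2_closure_sum => r; apply: L2_closureZ.
  by have [] := sub _ (@measurable_sfunP _ _ _ _ (G n) [set r] (measurable_set1 r)).
move=> n x; rewrite ger0_norm//; apply: le_trans (gM x); apply: le_trans (ler_norm _).
have /cvg_lim <-// := Gg x.
apply: nondecreasing_cvgn_le; last by apply/cvg_ex; exists (g x); exact: Gg.
by move=> i j ij; exact/lefP/nd_nnsfun_approx.
Qed.

End density.
Arguments bounded_measurable_cst {d T R} c.
Arguments L2_closure {d T R} mu H _.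
Arguments L2_sets {d T R} mu H _.

(** * Trigonometric polynomials and characteristic functions *)

Section trigonometric_bounds.
Context {R : realType}.
Implicit Types t : R.

Lemma norm_sin_le t : `|sin t| <= `|t|.
Proof.
wlog t0 : t / 0 <= t => [h|].
  have [|/ltW t0] := leP 0 t; first exact: h.
  by rewrite -normrN -sinN -(normrN t); apply: h; rewrite oppr_ge0.
have dsin x : x \in `]0, t[ -> is_derive x 1 sin (cos x) by move=> _; exact: is_derive_sin.
have csin : {within `[0, t], continuous (@sin R)}.
  by apply: continuous_subspaceT => x; exact: continuous_sin.
have [c _] := MVT_segment t0 dsin csin.
by rewrite sin0 !subr0 => ->; rewrite normrM ler_piMl// cos_max.
Qed.

Lemma norm_1B_cos_le t : `|1 - cos t| <= `|t|.
Proof.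
wlog t0 : t / 0 <= t => [h|].
  have [|/ltW t0] := leP 0 t; first exact: h.
  by rewrite -cosN -(normrN t); apply: h; rewrite oppr_ge0.
have dcos x : x \in `]0, t[ -> is_derive x 1 cos (- sin x) by move=> _; exact: is_derive_cos.
have ccos : {within `[0, t], continuous (@cos R)}.
  by apply: continuous_subspaceT => x; exact: continuous_cos.
have [c _] := MVT_segment t0 dcos ccos.
by rewrite cos0 subr0 distrC => ->; rewrite normrM normrN ler_piMl// sin_max.
Qed.

(** The mean value theorem gives sin t - t = (cos c - 1) t with c between 0 and t, and |1 - cos c|
    <= |c|. The order t^2 is cruder than Taylor's but sufficient. *)
Lemma norm_sinB_le t : `|sin t - t| <= t ^+ 2.
Proof.
wlog t0 : t / 0 <= t => [h|].
  have [|/ltW t0] := leP 0 t; first exact: h.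
  rewrite -sqrrN; have := h (- t); rewrite oppr_ge0 sinN -opprD normrN; exact.
have ds x : x \in `]0, t[ -> is_derive x 1 (fun x => sin x - x) (cos x - 1).
  by move=> _; exact: is_deriveB.
have cs : {within `[0, t], continuous (fun x : R => sin x - x)}.
  apply: continuous_subspaceT => x; apply: continuousB; first exact: continuous_sin.
  exact: id.
have [c ct] := MVT_segment t0 ds cs.
rewrite sin0 !subr0 => ->; rewrite normrM (ger0_norm t0) expr2 ler_wpM2r//.
rewrite distrC; apply: (le_trans (norm_1B_cos_le c)).
by move: ct; rewrite in_itv/= => /andP[c0 ct]; rewrite ger0_norm.
Qed.

Lemma cvg_sin_quotient t : m.+1%:R * sin (m.+1%:R^-1 * t) @[m --> \oo] --> t.
Proof.
apply: (@cvg_of_bound _ _ _ (t ^+ 2)) => m m0.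
have S0 : (0 : R) < m.+1%:R by rewrite ltr0n.
rewrite -[X in _ - X](mulVKf (lt0r_neq0 S0)) -mulrBr normrM gtr0_norm//.
apply: (@le_trans _ _ (m.+1%:R * (m.+1%:R^-1 * t) ^+ 2)).
  by rewrite ler_wpM2l ?norm_sinB_le// ltW.
rewrite exprMn mulrA expr2 mulVKf ?lt0r_neq0// mulrC ler_wpM2l ?sqr_ge0//.
by rewrite lef_pV2 ?posrE ?ltr0n// ler_nat.
Qed.

End trigonometric_bounds.

Section inner_product.
Context {R : realType} (n : nat).
Implicit Types x y z : 'rV[R]_n.

Lemma innerC x y : inner x y = inner y x.
Proof. by apply: eq_bigr => i _; rewrite mulrC. Qed.

Lemma innerDr x y z : inner x (y + z) = inner x y + inner x z.
Proof. by rewrite /inner -big_split; apply: eq_bigr => i _; rewrite mxE mulrDr. Qed.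

Lemma innerZr c x y : inner x (c *: y) = c * inner x y.
Proof. by rewrite /inner mulr_sumr; apply: eq_bigr => i _; rewrite mxE mulrCA. Qed.

Lemma innerNr x y : inner x (- y) = - inner x y.
Proof. by rewrite -scaleN1r innerZr mulN1r. Qed.

Lemma innerDl x y z : inner (x + y) z = inner x z + inner y z.
Proof. by rewrite innerC innerDr !(innerC z). Qed.

Lemma inner0r x : inner x 0 = 0.
Proof. by rewrite -(scale0r 0) innerZr mul0r. Qed.

Lemma inner_delta x c i : inner x (c *: delta_mx ord0 i) = c * x ord0 i.
Proof.
rewrite innerZr /inner (bigD1 i)//= mxE !eqxx mulr1 big1 ?addr0// => j ji.
by rewrite mxE eqxx/= (negbTE ji) mulr0.
Qed.

Lemma measurable_inner x : measurable_fun setT (fun y : 'rV[R]_n => inner y x).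
Proof.
apply: measurable_sum => i; apply: measurable_funM => //.
exact: measurable_coordinate.
Qed.

Lemma measurable_rV_sub_lt (S : set (set 'rV[R]_n)) : sigma_algebra setT S ->
  (forall i c, S [set x | x ord0 i < c]) -> measurable `<=` S.
Proof.
move=> sS Slt; apply: smallest_sub => // A.
rewrite -bigcup_seq/= => -[i _ [B mB <-]]; rewrite setTI.
pose SB := [set C : set R | S (coordinate i @^-1` C)].
have sSB : sigma_algebra setT SB.
  case: sS => S0 SC SU; split.
  - by rewrite /SB/= preimage_set0.
  - by move=> C; rewrite /SB/= => /SC; rewrite !setTD preimage_setC.
  - by move=> F hF; rewrite /SB/= preimage_bigcup; exact: SU.
suff : measurable `<=` SB by exact.
rewrite [X in X `<=` _](RGenInftyO.measurableE R).
apply: smallest_sub => // _ [x ->]; rewrite /SB/=.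
rewrite (_ : coordinate i @^-1` _ = [set y | y ord0 i < x])//.
Qed.

End inner_product.

Section trigonometric_polynomials.
Context {R : realType} (n : nat).
Implicit Types (G : set 'rV[R]_n) (x y k : 'rV[R]_n).

(** The set of frequencies is a parameter: the whole space serves characteristic functions, the
    lattice 2 pi Z^n serves the torus. *)
Inductive trig_poly G : ('rV[R]_n -> R) -> Prop :=
| trig_cos x of G x : trig_poly G (fun k => cos (inner k x))
| trig_sin x of G x : trig_poly G (fun k => sin (inner k x))
| trig_add f g of trig_poly G f & trig_poly G g : trig_poly G (f \+ g)
| trig_scale c f of trig_poly G f : trig_poly G (fun k => c * f k).

Lemma measurable_cos_inner x : measurable_fun setT (fun k => cos (inner k x)).
Proof.
apply: measurableT_comp; last exact: measurable_inner.
by apply: continuous_measurable_fun; exact: continuous_cos.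
Qed.

Lemma measurable_sin_inner x : measurable_fun setT (fun k => sin (inner k x)).
Proof.
apply: measurableT_comp; last exact: measurable_inner.
by apply: continuous_measurable_fun; exact: continuous_sin.
Qed.

Lemma trig_poly_bounded G f : trig_poly G f -> bounded_measurable f.
Proof.
elim=> [x _|x _|{}f g _ bf _ bg|c {}f _ bf].
- by split; [exact: measurable_cos_inner|exists 1 => k; exact: cos_max].
- by split; [exact: measurable_sin_inner|exists 1 => k; exact: sin_max].
- exact: bounded_measurableD.
- exact (bounded_measurableM (bounded_measurable_cst c) bf).
Qed.

Variable G : set 'rV[R]_n.
Hypothesis G0 : G 0.
Hypothesis GD : forall x y, G x -> G y -> G (x + y).
Hypothesis GN : forall x, G x -> G (- x).

Lemma trig_poly_cst c : trig_poly G (cst c).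
Proof.
rewrite (_ : cst c = fun k => c * cos (inner k 0)).
  by apply: trig_scale; exact: trig_cos.
by apply/funext => k; rewrite inner0r cos0 mulr1.
Qed.

Let trig_half f g : trig_poly G f -> trig_poly G g ->
  trig_poly G (fun k => 2^-1 * (f \+ g) k).
Proof. by move=> ? ?; apply: trig_scale; exact: trig_add. Qed.

Let trig_opp f : trig_poly G f -> trig_poly G (fun k => - f k).
Proof.
move=> tf; rewrite (_ : (fun _ => _) = fun k => -1 * f k); first exact: trig_scale.
by apply/funext => k; rewrite mulN1r.
Qed.

(** The product-to-sum formulas produce the frequencies x + y and x - y, hence the closure of [G]
    under sums and opposites. *)
Lemma trig_polyM f g : trig_poly G f -> trig_poly G g -> trig_poly G (f \* g).
Proof.
move=> tf; elim=> [y Gy|y Gy|g1 g2 _ h1 _ h2|c {}g _ h].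
- elim: tf => [x Gx|x Gx|f1 f2 _ h1 _ h2|c {}f _ h].
  + rewrite (_ : _ \* _ = fun k => 2^-1 * ((fun k => cos (inner k (x + y))) \+
      (fun k => cos (inner k (x - y)))) k).
      by apply: trig_half; apply: trig_cos; auto.
    by apply/funext => k /=; rewrite !innerDr innerNr cosB cosD; field.
  + rewrite (_ : _ \* _ = fun k => 2^-1 * ((fun k => sin (inner k (x + y))) \+
      (fun k => sin (inner k (x - y)))) k).
      by apply: trig_half; apply: trig_sin; auto.
    by apply/funext => k /=; rewrite !innerDr innerNr sinB sinD; field.
  + rewrite (_ : _ \* _ = (f1 \* fun k => cos (inner k y)) \+
       (f2 \* fun k => cos (inner k y))); first exact: trig_add.
    by apply/funext => k /=; rewrite mulrDl.
  + rewrite (_ : _ \* _ = fun k => c * (f \* fun k => cos (inner k y)) k).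
      exact: trig_scale.
    by apply/funext => k /=; rewrite mulrA.
- elim: tf => [x Gx|x Gx|f1 f2 _ h1 _ h2|c {}f _ h].
  + rewrite (_ : _ \* _ = fun k => 2^-1 * ((fun k => sin (inner k (y + x))) \+
      (fun k => sin (inner k (y - x)))) k).
      by apply: trig_half; apply: trig_sin; auto.
    by apply/funext => k /=; rewrite !innerDr innerNr sinB sinD; field.
  + rewrite (_ : _ \* _ = fun k => 2^-1 * ((fun k => cos (inner k (x - y))) \+
      (fun k => - cos (inner k (x + y)))) k).
      by apply: trig_half; [|apply: trig_opp]; apply: trig_cos; auto.
    by apply/funext => k /=; rewrite !innerDr innerNr cosB cosD; field.
  + rewrite (_ : _ \* _ = (f1 \* fun k => sin (inner k y)) \+
       (f2 \* fun k => sin (inner k y))); first exact: trig_add.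
    by apply/funext => k /=; rewrite mulrDl.
  + rewrite (_ : _ \* _ = fun k => c * (f \* fun k => sin (inner k y)) k).
      exact: trig_scale.
    by apply/funext => k /=; rewrite mulrA.
- rewrite (_ : _ \* _ = (f \* g1) \+ (f \* g2)); first exact: trig_add.
  by apply/funext => k /=; rewrite mulrDr.
- rewrite (_ : _ \* _ = fun k => c * (f \* g) k); first exact: trig_scale.
  by apply/funext => k /=; rewrite mulrCA.
Qed.

Lemma trig_poly_dense (mu : {measure set 'rV[R]_n -> \bar R}) :
  (mu setT < +oo)%E -> measurable `<=` L2_sets mu (trig_poly G) ->
  forall f, bounded_measurable f -> L2_closure mu (trig_poly G) f.
Proof.
move=> muT sub f bf; apply: L2_closure_dense => //.
- by move=> h /trig_poly_bounded.
- exact: trig_poly_cst.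
- exact: trig_add.
- exact: trig_polyM.
Qed.

Lemma trig_poly_closure_sets (mu : {measure set 'rV[R]_n -> \bar R}) :
  (mu setT < +oo)%E -> sigma_algebra setT (L2_sets mu (trig_poly G)).
Proof.
move=> muT; apply: L2_sets_sigma_algebra => //.
- by move=> h /trig_poly_bounded.
- exact: trig_poly_cst.
- exact: trig_add.
- exact: trig_polyM.
Qed.

End trigonometric_polynomials.

(** * Uniqueness of finite measures with given characteristic functions *)

Section characteristic_functions.
Context {R : realType} (n : nat).
Implicit Types mu nu : {measure set 'rV[R]_n -> \bar R}.

(** A coordinate is the pointwise limit of m sin (x_i / m), an unbounded sequence of trigonometric
    polynomials, and this makes half-spaces approximable. *)
Lemma trig_poly_dense_full mu : (mu setT < +oo)%E ->
  forall f, bounded_measurable f -> L2_closure mu (trig_poly setT) f.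
Proof.
move=> muT; apply: trig_poly_dense => //.
apply: measurable_rV_sub_lt; first exact: trig_poly_closure_sets.
move=> i c.
have trigB : trig_poly (setT : set 'rV[R]_n) `<=` @bounded_measurable _ _ R.
  by move=> h /trig_poly_bounded.
have trigC b : trig_poly (setT : set 'rV[R]_n) (cst b) by exact: trig_poly_cst.
have trigD := @trig_add R n setT.
have trigM f g : trig_poly (setT : set 'rV[R]_n) f -> trig_poly setT g -> trig_poly setT (f \* g).
  by apply: trig_polyM.
apply: (@L2_sets_lim_lt _ _ _ mu muT _ trigB trigC trigD trigM
  (fun m x => m.+1%:R * sin (inner x (m.+1%:R^-1 *: delta_mx ord0 i)))).
  by move=> m; apply: sub_L2_closure => //; apply: trig_scale; exact: trig_sin.
by move=> x; under eq_fun do rewrite inner_delta; exact: cvg_sin_quotient.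
Qed.

(** The elementary inequality |t| <= dl + t^2 / dl replaces Cauchy-Schwarz: the first term
    integrates to dl times the total mass, the second to at most dl. *)
Lemma approx_diff mu (f g : 'rV[R]_n -> R) (dl : R) : (mu setT < +oo)%E -> 0 < dl ->
  bounded_measurable f -> bounded_measurable g -> (sqdist mu f g <= (dl ^+ 2)%:E)%E ->
  `|(\int[mu]_x f x) - (\int[mu]_x g x)| <= dl * (fine (mu setT) + 1).
Proof.
move=> muT dl0 bf bg fg.
have bh : bounded_measurable (f \- g).
  rewrite (_ : f \- g = f \+ ((fun=> -1) \* g)).
    by apply: (bounded_measurableD bf); apply: bounded_measurableM => //; exact: bounded_measurable_cst.
  by apply/funext => x /=; rewrite mulN1r.
have ih := bounded_measurable_integrable muT bh.
have bq : bounded_measurable (fun x => dl + dl^-1 * (f x - g x) ^+ 2).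
  rewrite (_ : (fun _ => _) = (cst dl) \+ (cst dl^-1 \* ((f \- g) \* (f \- g)))).
    apply: bounded_measurableD; first exact: bounded_measurable_cst.
    apply: bounded_measurableM; first exact: bounded_measurable_cst.
    exact: bounded_measurableM.
  by apply/funext => x /=; rewrite expr2.
have bs : bounded_measurable (fun x => (f x - g x) ^+ 2).
  rewrite (_ : (fun _ => _) = ((f \- g) \* (f \- g))); first exact: bounded_measurableM.
  by apply/funext => x /=; rewrite expr2.
have iq := bounded_measurable_integrable muT bq.
have is2 := bounded_measurable_integrable muT bs.
rewrite -RintegralB//; [|exact: bounded_measurable_integrable|exact: bounded_measurable_integrable].
apply: (le_trans (le_normr_Rintegral measurableT ih)).
apply: (@le_trans _ _ (\int[mu]_x (dl + dl^-1 * (f x - g x) ^+ 2))).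
  apply: le_Rintegral => //.
    by apply: (bounded_measurable_integrable muT (f := fun x => `|f x - g x|)); case: bh => mh [M hM]; split;
      [exact: measurableT_comp|exists M => x; rewrite normr_id; exact: hM].
  move=> x _; rewrite -subr_ge0.
  have -> : dl + dl^-1 * (f x - g x) ^+ 2 - `|f x - g x| =
      dl^-1 * ((dl - `|f x - g x|) ^+ 2 + dl * `|f x - g x|).
    rewrite -(real_normK (num_real (f x - g x))); field; exact: lt0r_neq0.
  rewrite mulr_ge0 ?invr_ge0 ?(ltW dl0)// addr_ge0 ?sqr_ge0// mulr_ge0// ltW//.
rewrite (@RintegralD _ _ _ _ _ (fun=> dl) (fun x => dl^-1 * (f x - g x) ^+ 2))//; last 2 first.
- exact (bounded_measurable_integrable muT (bounded_measurable_cst dl)).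
- exact: (integrableZl measurableT dl^-1 is2).
rewrite RintegralZl// Rintegral_cst// mulrDr lerD2l mulr1.
rewrite ler_pdivrMl// -expr2 -lee_fin /Rintegral fineK//.
by rewrite ge0_fin_numE; [exact: le_lt_trans fg (ltry _)|apply: integral_ge0 => x _; rewrite lee_fin sqr_ge0].
Qed.

(** An indicator is approximated in L2 of the sum of the two measures, so that a single
    trigonometric polynomial is close to it for both, and on that polynomial the two integrals
    agree. [K] adds up the constants of [approx_diff] for the two measures. *)
Lemma char_fun_unique mu nu : (mu setT < +oo)%E -> (nu setT < +oo)%E ->
  (forall x, \int[mu]_k cos (inner k x) = \int[nu]_k cos (inner k x)) ->
  (forall x, \int[mu]_k sin (inner k x) = \int[nu]_k sin (inner k x)) ->
  forall A, measurable A -> mu A = nu A.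
Proof.
move=> muT nuT ec es A mA.
pose lam : {measure set _ -> \bar _} := measure_add mu nu.
have lamE B : lam B = (mu B + nu B)%E by exact: measure_addE.
have lamT : (lam setT < +oo)%E by rewrite lamE lte_add_pinfty.
have eh h : trig_poly setT h -> \int[mu]_x h x = \int[nu]_x h x.
  elim=> [x _|x _|f g /trig_poly_bounded bf ef /trig_poly_bounded bg eg|c f /trig_poly_bounded bf ef].
  - exact: ec.
  - exact: es.
  - rewrite !RintegralD ?ef ?eg//; exact: bounded_measurable_integrable.
  - rewrite !RintegralZl ?ef//; exact: bounded_measurable_integrable.
have bA : bounded_measurable (\1_A : _ -> R).
  by split; [exact: measurable_indic|exists 1 => x; rewrite indicE ger0_norm// lern1 leq_b1].
have finA (m : {measure set 'rV[R]_n -> \bar R}) : (m setT < +oo)%E -> (m A \is a fin_num)%E.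
  by move=> mT; rewrite ge0_fin_numE// (le_lt_trans _ mT)// le_measure ?inE.
have iA (m : {measure set 'rV[R]_n -> \bar R}) : \int[m]_x \1_A x = fine (m A).
  by rewrite /Rintegral integral_indic// setIT.
suff : fine (mu A) = fine (nu A).
  by move=> e1; rewrite -(fineK (finA _ muT)) -(fineK (finA _ nuT)) e1.
rewrite -!iA; apply/eqP; rewrite -subr_eq0 -normr_le0.
pose K := (fine (mu setT) + 1) + (fine (nu setT) + 1).
have K0 : 0 < K by rewrite addr_gt0// ltr_wpDl// fine_ge0.
apply/ler_addgt0Pr => e e0; rewrite add0r.
have dl0 : 0 < e / K by rewrite divr_gt0.
have [_ /(_ _ (exprn_gt0 2 dl0))[h th hA]] := trig_poly_dense_full lamT bA.
have bh := trig_poly_bounded th.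
have msq : measurable_fun setT (fun x => ((\1_A x - h x : R) ^+ 2)%:E).
  by apply: measurable_sqdist; [case: bA|case: bh].
have le1 : (sqdist mu \1_A h <= ((e / K) ^+ 2)%:E)%E.
  apply: le_trans hA; rewrite /sqdist ge0_integral_measure_add//.
    by rewrite leeDl// integral_ge0// => x _; rewrite lee_fin sqr_ge0.
  by move=> x _; rewrite lee_fin sqr_ge0.
have le2 : (sqdist nu \1_A h <= ((e / K) ^+ 2)%:E)%E.
  apply: le_trans hA; rewrite /sqdist ge0_integral_measure_add//.
    by rewrite leeDr// integral_ge0// => x _; rewrite lee_fin sqr_ge0.
  by move=> x _; rewrite lee_fin sqr_ge0.
have := approx_diff muT dl0 bA bh le1; have := approx_diff nuT dl0 bA bh le2.
rewrite (eh h th) distrC => d1 d2.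
apply: (le_trans (ler_distD (\int[nu]_x h x) _ _)).
apply: (le_trans (lerD d2 d1)); rewrite -mulrDr -/K divfK ?gt_eqF//.
Qed.

End characteristic_functions.

(** * Image measures, densities and test functions *)

Section image_measure_integral.
Context d1 d2 (T1 : measurableType d1) (T2 : measurableType d2) (R : realType).
Variables (g : {mfun T1 >-> T2}) (mu : {measure set T1 -> \bar R}).

Lemma ge0_integral_image (f : T2 -> \bar R) : measurable_fun setT f ->
  (forall x, 0 <= f x)%E ->
  (\int[image_measure g mu]_x f x = \int[mu]_x f (g x))%E.
Proof.
move=> mf f0; rewrite -[RHS](@ge0_integral_pushforward _ _ _ _ _ g _ mu setT f)//.
Qed.

Lemma integral_image (f : T2 -> \bar R) : measurable_fun setT f ->
  (\int[image_measure g mu]_x f x = \int[mu]_x f (g x))%E.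
Proof.
move=> mf; rewrite [LHS]integralE [RHS]integralE.
congr (_ - _)%E.
  transitivity (\int[mu]_x (f^\+ (g x)))%E; last by apply: eq_integral => x _; rewrite !funeposE.
  by rewrite (@ge0_integral_image (f^\+)%E)//; exact: measurable_funepos.
transitivity (\int[mu]_x (f^\- (g x)))%E; last by apply: eq_integral => x _; rewrite !funenegE.
by rewrite (@ge0_integral_image (f^\-)%E)//; exact: measurable_funeneg.
Qed.

Lemma integrable_image (f : T2 -> \bar R) :
  measurable_fun setT f ->
  mu.-integrable setT (f \o g) -> (image_measure g mu).-integrable setT f.
Proof.
move=> mf /integrableP[_ fi]; apply/integrableP; split=> //.
by rewrite integral_image//; exact: measurableT_comp.
Qed.

Lemma cintegral_image (f : T2 -> R[i]) :
  measurable_fun setT (@complex.Re R \o f) -> measurable_fun setT (@complex.Im R \o f) ->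
  cintegral (image_measure g mu) f = cintegral mu (f \o g).
Proof.
move=> mf1 mf2; rewrite /cintegral /Rintegral; congr Complex; congr fine;
  by apply: integral_image; exact/measurable_EFinP.
Qed.

End image_measure_integral.

Section lebesgue_boxes.
Context {R : realType}.
Local Notation lambda := (@lebesgue_measure R).

Lemma lebesgue_measure_shift (c : R) (A : set R) : measurable A ->
  lambda [set x | A (x + c)] = lambda A.
Proof.
move=> mA.
have ms : measurable_fun setT (fun x : measurableTypeR R => (x + c) : measurableTypeR R).
  exact: measurable_funD.
pose s := isMeasurableFun.Build _ _ _ _ _ ms.
pose sp : {mfun measurableTypeR R >-> measurableTypeR R} :=
  HB.pack (fun x : measurableTypeR R => (x + c) : measurableTypeR R) s.
apply/esym; rewrite -[RHS]/(image_measure sp lambda A).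
apply: lebesgue_measure_unique => //= _ [[a b]] _ <-.
rewrite /image_measure /pushforward.
rewrite (_ : sp @^-1` _ = `]a - c, b - c]%classic); last first.
  by apply/seteqP; split => x /=; rewrite !in_itv/= ltrBlDr lerBrDr.
by rewrite !lebesgue_measure_itv/= !lte_fin ltrD2r -!EFinB opprB addrA subrK.
Qed.

Lemma prode_lt_pinfty n (f : 'I_n -> \bar R) : (forall i, 0 <= f i)%E ->
  (forall i, f i < +oo)%E -> (\big[*%E/1%E]_(i < n) f i < +oo)%E.
Proof.
move=> f0 foo; pose K (x : \bar R) := (0 <= x)%E /\ (x < +oo)%E.
suff : K (\big[*%E/1%E]_(i < n) f i)%E by case.
elim/big_ind: _ => [|x y [x0 xo] [y0 yo]|i _]; [|split|by split].
- by split; [rewrite lee_fin|exact: ltry].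
- exact: mule_ge0.
- by apply: lte_mul_pinfty => //; rewrite ge0_fin_numE.
Qed.

Lemma lebesgue_itvcc_lt_pinfty (a b : R) : (lambda `[a, b]%classic < +oo)%E.
Proof. by rewrite lebesgue_measure_itv/=; case: ifPn => _; rewrite -?EFinD ltry. Qed.

Definition box n (A : 'I_n -> set R) : set 'rV[R]_n := [set x | forall i, A i (x ord0 i)].

Lemma measurable_box n (A : 'I_n -> set R) : (forall i, measurable (A i)) ->
  measurable (box A).
Proof.
move=> mA; rewrite (_ : box A = \bigcap_(i in setT) (coordinate i @^-1` A i)).
  apply: fin_bigcap_measurable => [|i _]; first exact: finite_finset.
  by rewrite -[X in measurable X]setTI; apply: measurable_coordinate.
by apply/seteqP; split => x /= h i; [move=> _; exact: h|exact: h].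
Qed.

Lemma lebesgue_rV_box n (A : 'I_n -> set R) : (forall i, measurable (A i)) ->
  lebesgue_rV n (box A) = (\big[*%E/1%E]_(i < n) lambda (A i))%E.
Proof.
elim: n A => [|n ih] A mA.
  rewrite big_ord0 /= (_ : box A = setT) ?diracT//.
  by apply/seteqP; split => // x _ [].
rewrite big_ord_recl -ih//.
have -> : lebesgue_rV n.+1 (box A) = (lambda \x lebesgue_rV n)%E (@rV_cons R n @^-1` box A) by [].
rewrite -(@product_measure1E _ _ _ _ _ lambda (lebesgue_rV n))//; last 2 first.
- exact: mA.
- exact: measurable_box.
congr (_ _); apply/seteqP; split => -[x v] /=.
  move=> h; split=> /= [|i].
    by have := h ord0; rewrite mxE unlift_none.
  by have := h (lift ord0 i); rewrite mxE liftK.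
move=> [/= h0 h] i; case: (unliftP ord0 i) => [j|] ->.
  by rewrite mxE liftK; exact: h.
by rewrite mxE unlift_none.
Qed.

Definition boxes n : set (set 'rV[R]_n) :=
  [set B | exists2 A, (forall i, measurable (A i)) & B = box A].

Lemma boxes_generate n : measurable = <<s @boxes n >>.
Proof.
apply/seteqP; split; last first.
  apply: smallest_sub; first exact: sigma_algebra_measurable.
  by move=> _ [A mA ->]; exact: measurable_box.
apply: measurable_rV_sub_lt; first exact: smallest_sigma_algebra.
move=> i c; apply: sub_sigma_algebra.
exists (fun j => if j == i then `]-oo, c[%classic else setT).
  by move=> j; case: ifP.
apply/seteqP; split=> x /=.
  by move=> xc j; case: ifPn => // /eqP ->; rewrite /= in_itv.
by move=> /(_ i); rewrite eqxx /= in_itv.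
Qed.

Lemma boxes_setI n : setI_closed (@boxes n).
Proof.
move=> _ _ [A mA ->] [B mB ->]; exists (fun i => A i `&` B i).
  by move=> i; exact: measurableI.
apply/seteqP; split=> x /=; first by move=> [h1 h2] i; split; [exact: h1|exact: h2].
by move=> h; split=> i; case: (h i).
Qed.

(** Boxes form a generating family closed under intersection, and the cubes [g k] exhaust the space
    with finite mass. Invariance of Lebesgue measure under translations and coordinate permutations
    then needs checking on boxes only. *)
Lemma lebesgue_rV_unique n (mu : {measure set 'rV[R]_n -> \bar R}) :
  (forall A, (forall i, measurable (A i)) ->
     mu (box A) = (\big[*%E/1%E]_(i < n) lambda (A i))%E) ->
  forall B, measurable B -> mu B = lebesgue_rV n B.
Proof.
move=> muE B mB.
pose g k := box (fun i : 'I_n => `[(- k%:R : R), k%:R]%classic).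
have mg k : forall i : 'I_n, measurable `[(- k%:R : R), k%:R]%classic by [].
apply: (measure_unique (@boxes n) g) => //.
- exact: boxes_generate.
- exact: boxes_setI.
- by move=> k; exists (fun i : 'I_n => `[(- k%:R : R), k%:R]%classic).
- apply/seteqP; split=> // x _.
  exists (Num.bound (\sum_i `|x ord0 i|)) => // i /=; rewrite in_itv/= -ler_norml.
  apply: ltW; apply: le_lt_trans (archi_boundP _); last by rewrite sumr_ge0.
  by rewrite (bigD1 i)//= lerDl sumr_ge0.
- by move=> _ [A mA ->]; rewrite muE// -lebesgue_rV_box.
by move=> k; rewrite muE// prode_lt_pinfty// => i; exact: lebesgue_itvcc_lt_pinfty.
Qed.

Lemma lebesgue_rV_translation n (x : 'rV[R]_n) B : measurable B ->
  lebesgue_rV n (translation x @^-1` B) = lebesgue_rV n B.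
Proof.
move=> mB; rewrite -[LHS]/(image_measure (translation x) (lebesgue_rV n) B).
apply: lebesgue_rV_unique => // A mA.
transitivity (lebesgue_rV n (translation x @^-1` box A)) => //.
rewrite (_ : translation x @^-1` _ = box (fun i => [set t | A i (t + x ord0 i)])).
  rewrite lebesgue_rV_box; last first.
    move=> i; rewrite -[X in measurable X]setTI.
    by apply: (measurable_funD (measurable_id (D:=setT)) (measurable_cst (x ord0 i))).
  by apply: eq_bigr => i _; exact: lebesgue_measure_shift.
by apply/seteqP; split=> y /= h i; have := h i; rewrite /= mxE.
Qed.

Definition coord_perm n (s : {perm 'I_n}) (x : 'rV[R]_n) : 'rV[R]_n := \row_i x ord0 (s i).

Lemma measurable_coord_perm n (s : {perm 'I_n}) : measurable_fun setT (coord_perm s).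
Proof.
apply: measurable_coordinateP => i.
rewrite (_ : _ \o _ = coordinate (s i)); first exact: measurable_coordinate.
by apply/funext => x /=; rewrite /coordinate mxE.
Qed.

HB.instance Definition _ n (s : {perm 'I_n}) :=
  @isMeasurableFun.Build _ _ _ _ (coord_perm s) (measurable_coord_perm s).

Lemma lebesgue_rV_perm n (s : {perm 'I_n}) B : measurable B ->
  lebesgue_rV n (coord_perm s @^-1` B) = lebesgue_rV n B.
Proof.
move=> mB; rewrite -[LHS]/(image_measure (coord_perm s) (lebesgue_rV n) B).
apply: lebesgue_rV_unique => // A mA.
transitivity (lebesgue_rV n (coord_perm s @^-1` box A)) => //.
rewrite (_ : coord_perm s @^-1` _ = box (fun i => A (s^-1 i)%g)).
  rewrite lebesgue_rV_box// [RHS](reindex_inj (@perm_inj _ s^-1%g))//.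
apply/seteqP; split=> y /= h i; last by have := h (s i); rewrite /= mxE permK.
by have := h (s^-1%g i); rewrite /= mxE permKV.
Qed.

Lemma cintegral_lebesgue_translation n (x : 'rV[R]_n) (f : 'rV[R]_n -> R[i]) :
  measurable_fun setT (@complex.Re R \o f) -> measurable_fun setT (@complex.Im R \o f) ->
  cintegral (lebesgue_rV n) (f \o translation x) = cintegral (lebesgue_rV n) f.
Proof.
move=> mf1 mf2; rewrite -cintegral_image//.
by apply: eq_measure_cintegral => A mA; exact: lebesgue_rV_translation.
Qed.

Lemma cintegral_lebesgue_perm n (s : {perm 'I_n}) (f : 'rV[R]_n -> R[i]) :
  measurable_fun setT (@complex.Re R \o f) -> measurable_fun setT (@complex.Im R \o f) ->
  cintegral (lebesgue_rV n) (f \o coord_perm s) = cintegral (lebesgue_rV n) f.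
Proof.
move=> mf1 mf2; rewrite -cintegral_image//.
by apply: eq_measure_cintegral => A mA; exact: lebesgue_rV_perm.
Qed.

Lemma unit_cubeE n : @unit_cube R n = box (fun=> `[0, 1[%classic).
Proof. by apply/seteqP; split=> x /= h i; have := h i; rewrite /= in_itv. Qed.

Lemma measurable_unit_cube n : measurable (@unit_cube R n).
Proof. by rewrite unit_cubeE; exact: measurable_box. Qed.

Lemma lebesgue_unit_cube n : lebesgue_rV n (@unit_cube R n) = 1%E.
Proof.
rewrite unit_cubeE lebesgue_rV_box// big1// => i _.
by rewrite lebesgue_measure_itv/= lte_fin ltr01 oppr0 adde0.
Qed.

Lemma norm_coord_le_enorm n (x : 'rV[R]_n) i : `|x ord0 i| <= enorm x.
Proof.
rewrite -sqrtr_sqr /enorm ler_sqrt ?sumr_ge0//; last by move=> j _; exact: sqr_ge0.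
by rewrite (bigD1 i)//= lerDl sumr_ge0// => j _; exact: sqr_ge0.
Qed.

Lemma measurable_enorm n : measurable_fun setT (@enorm R n).
Proof.
apply: (@measurableT_comp _ _ _ _ _ _ (@Num.sqrt R)).
  by apply: continuous_measurable_fun; exact: sqrt_continuous.
apply: measurable_sum => i; apply: measurable_funX; exact: measurable_coordinate.
Qed.

Lemma measurable_eball n (r : R) : measurable (@eball R n r).
Proof.
have := @measurable_enorm n measurableT _ (measurable_itv `]-oo, r[); rewrite setTI.
by rewrite (_ : _ @^-1` _ = eball r).
Qed.

Lemma lebesgue_eball n (r : R) : (lebesgue_rV n (@eball R n r) < +oo)%E.
Proof.
apply: (@le_lt_trans _ _ (lebesgue_rV n (box (fun=> `[(- `|r|), `|r|]%classic)))).
  apply: le_measure; rewrite ?inE; [exact: measurable_eball|exact: measurable_box|].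
  move=> x /= xr i; rewrite /= in_itv/= -ler_norml.
  by apply: (le_trans (norm_coord_le_enorm x i)); apply: ltW; apply: (lt_le_trans xr); exact: ler_norm.
by rewrite lebesgue_rV_box// prode_lt_pinfty// => i; exact: lebesgue_itvcc_lt_pinfty.
Qed.

Lemma enorm_bounded_coord n (M : R) : exists r, forall x : 'rV[R]_n,
  (forall i, `|x ord0 i| <= M) -> enorm x < r.
Proof.
exists (Num.sqrt (n%:R * M ^+ 2) + 1) => x xM.
have M2 : 0 <= n%:R * M ^+ 2 by rewrite mulr_ge0// sqr_ge0.
rewrite ltr_pwDr// /enorm ler_sqrt//.
rewrite mulr_natl -[n in _ *+ n]card_ord -sumr_const ler_sum// => i _.
have M0 : 0 <= M by exact: le_trans (xM i).
by rewrite -real_normK ?num_real// ler_sqr ?nnegrE.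
Qed.

Lemma compact_sub_eball n (K : set 'rV[R]_n) : compact K -> exists r, K `<=` eball r.
Proof.
move=> cK.
have bd i : exists M : R, forall x, K x -> `|x ord0 i| <= M.
  have : compact ((fun x : 'rV[R]_n => x ord0 i) @` K).
    apply: continuous_compact => //; apply: continuous_subspaceT.
    exact: coord_continuous.
  move=> /compact_bounded[M [_ Mb]]; exists (M + 1) => x Kx.
  by apply: (Mb (M + 1)); [rewrite ltrDl|exists x].
have [M MP] := choice bd.
have [r rP] := enorm_bounded_coord n (\sum_i `|M i|).
exists r => x Kx; apply: rP => i; apply: (le_trans (MP i x Kx)).
by apply: (le_trans (ler_norm _)); rewrite (bigD1 i)//= lerDl sumr_ge0.
Qed.

End lebesgue_boxes.

(** * Measures with a density *)

Section density_measure.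
Context d (T : measurableType d) {R : realType}.

Section def.
Local Open Scope ereal_scope.
Variables (g : {mfun T >-> R}) (mu : {measure set T -> \bar R}).

(* The absolute value makes this a measure for every measurable [g]. *)
Definition density (A : set T) : \bar R := \int[mu]_(x in A) (`|g x|%R)%:E.

Lemma measurable_density_fun : measurable_fun setT (fun x => (`|g x|%R)%:E).
Proof. by apply/measurable_EFinP; exact: measurableT_comp. Qed.

Let density0 : density set0 = 0.
Proof. by rewrite /density integral_set0. Qed.

Let density_ge0 A : 0 <= density A.
Proof. by apply: integral_ge0 => x _; rewrite lee_fin. Qed.

Let density_sigma_additive : semi_sigma_additive density.
Proof.
move=> F mF tF mUF; rewrite /density ge0_integral_bigcup//.
- by apply: is_cvg_nneseries => i _ _; exact: density_ge0.
- by apply: measurable_funTS; exact: measurable_density_fun.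
Qed.

HB.instance Definition _ := isMeasure.Build _ _ _ density
  density0 density_ge0 density_sigma_additive.

End def.

Variables (g : {mfun T >-> R}) (mu : {measure set T -> \bar R}).

Import HBNNSimple.
Local Open Scope ereal_scope.

Let ge0_integral_density_indic A : measurable A ->
  \int[density g mu]_x (\1_A x)%:E = \int[mu]_x (`|g x|%:E * (\1_A x)%:E).
Proof.
move=> mA; rewrite integral_indic// setIT /= /density integral_mkcond.
apply: eq_integral => x _; rewrite patchE indicE.
by case: ifPn => xA; rewrite ?mule1 ?mule0.
Qed.

Let ge0_integral_density_nnsfun (f : {nnsfun T >-> R}) :
  \int[density g mu]_x (f x)%:E = \int[mu]_x (`|g x|%:E * (f x)%:E).
Proof.
under [in LHS]eq_integral do rewrite fimfunE -fsumEFin//.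
rewrite ge0_integral_fsum//; last 2 first.
- by move=> r; exact/measurable_EFinP/measurableT_comp.
- by move=> r x _; rewrite nnfun_muleindic_ge0.
under [RHS]eq_integral => x _.
  rewrite fimfunE -fsumEFin// ge0_mule_fsumr; last first.
    by move=> r; rewrite EFinM nnfun_muleindic_ge0.
  over.
rewrite ge0_integral_fsum//; last 2 first.
- move=> r; apply: emeasurable_funM; first exact: measurable_density_fun.
  by exact/measurable_EFinP/measurableT_comp.
- by move=> r x _; rewrite mule_ge0//; rewrite EFinM nnfun_muleindic_ge0.
apply: eq_fsbigr => r _.
have [r0|r0] := leP 0%R r; last first.
  rewrite !integral0_eq// => x _; rewrite EFinM preimage_nnfun0// indic0 ?mule0//.
under eq_integral do rewrite EFinM.
rewrite ge0_integralZl//; last by exact/measurable_EFinP.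
rewrite ge0_integral_density_indic// -ge0_integralZl//.
- by apply: eq_integral => x _; rewrite EFinM muleCA.
- by apply: emeasurable_funM; [exact: measurable_density_fun|exact/measurable_EFinP].
Qed.

Lemma ge0_integral_density (f : T -> \bar R) : measurable_fun setT f ->
  (forall x, 0 <= f x) ->
  \int[density g mu]_x f x = \int[mu]_x (`|g x|%:E * f x).
Proof.
move=> mf f0; pose f_ := nnsfun_approx measurableT mf.
have fE x : f x = limn (fun n => (f_ n x)%:E).
  by apply/esym/cvg_lim => //; apply: cvg_nnsfun_approx.
transitivity (limn (fun n => \int[density g mu]_x (f_ n x)%:E)).
  rewrite -monotone_convergence//.
  - by apply: eq_integral => x _; exact: fE.
  - by move=> n; exact/measurable_EFinP/measurable_funTS.
  - by move=> *; rewrite lee_fin.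
  - by move=> x _ m n mn; rewrite lee_fin; exact/lefP/nd_nnsfun_approx.
under eq_fun do rewrite ge0_integral_density_nnsfun.
rewrite -monotone_convergence//.
- apply: eq_integral => x _; rewrite fE.
  apply: limeMl; last 1 first.
    by apply/cvg_ex; exists (f x); apply: cvg_nnsfun_approx.
  by [].
- move=> n; apply: emeasurable_funM; first exact: measurable_density_fun.
  exact/measurable_EFinP/measurable_funTS.
- by move=> *; rewrite mule_ge0 ?lee_fin.
- move=> x _ m n mn; apply: lee_wpmul2l; rewrite ?lee_fin//.
  exact/lefP/nd_nnsfun_approx.
Qed.

Lemma integral_density (f : T -> \bar R) : measurable_fun setT f ->
  \int[density g mu]_x f x = \int[mu]_x (`|g x|%:E * f x).
Proof.
move=> mf; rewrite [LHS]integralE [RHS]integralE.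
rewrite !ge0_integral_density//; [|exact: measurable_funeneg|exact: measurable_funepos].
congr (_ - _); apply: eq_integral => x _.
  by rewrite !funeposE maxe_pMr ?mule0// lee_fin.
by rewrite !funenegE maxe_pMr ?mule0 ?muleN// lee_fin.
Qed.

Lemma integrable_density (f : T -> \bar R) : measurable_fun setT f ->
  mu.-integrable setT (fun x => `|g x|%:E * f x) <->
  (density g mu).-integrable setT f.
Proof.
move=> mf.
have e : \int[density g mu]_x `|f x| = \int[mu]_x `| `|g x|%:E * f x|.
  rewrite integral_density//; last exact: measurableT_comp.
  by apply: eq_integral => x _; rewrite abseM /= normr_id.
split => /integrableP[mgf fi]; apply/integrableP; split => //; rewrite ?e// -?e//.
by apply: emeasurable_funM => //; exact: measurable_density_fun.
Qed.

End density_measure.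

Section complex_exponential.
Context {R : realType}.
Local Open Scope complex_scope.
Implicit Types s t : R.

Definition expi t : R[i] := cos t +i* sin t.

Lemma expi0 : expi 0 = 1.
Proof. by rewrite /expi cos0 sin0. Qed.

Lemma expiD s t : expi (s + t) = expi s * expi t.
Proof. by rewrite /expi cosD sinD; simpc; congr (_ +i* _); ring. Qed.

Lemma expiN t : expi (- t) = (expi t)^*%R.
Proof. by rewrite /expi cosN sinN. Qed.

Lemma expiMJ t : expi t * (expi t)^*%R = 1.
Proof. by rewrite -expiN -expiD subrr expi0. Qed.

Lemma norm_expi t : `|expi t| = 1.
Proof. by rewrite normc_def /= cos2Dsin2 sqrtr1. Qed.

Lemma Re_le_normc (z : R[i]) (M : R) : `|z| <= M%:C -> `|complex.Re z| <= M.
Proof.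
rewrite normc_def lecR; apply: le_trans; rewrite -sqrtr_sqr ler_sqrt ?addr_ge0 ?sqr_ge0//.
by rewrite lerDl sqr_ge0.
Qed.

Lemma Im_le_normc (z : R[i]) (M : R) : `|z| <= M%:C -> `|complex.Im z| <= M.
Proof.
rewrite normc_def lecR; apply: le_trans; rewrite -sqrtr_sqr ler_sqrt ?addr_ge0 ?sqr_ge0//.
by rewrite lerDr sqr_ge0.
Qed.

End complex_exponential.

(** * Test functions and their Fourier transforms *)

Section test_functions.
Context {R : realType} (n : nat).
Local Open Scope complex_scope.
Implicit Types (f g : 'rV[R]_n -> R[i]) (x k : 'rV[R]_n).

(** Compact support is rephrased as a coordinatewise bound on the support, a form in which sums,
    translations and permutations are handled by elementary inequalities. *)
Lemma test_functionP f : test_function f <->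
  [/\ measurable_fun setT (@complex.Re R \o f) /\ measurable_fun setT (@complex.Im R \o f),
      exists M : R, forall x, `|f x| <= M%:C &
      exists N : R, forall x, f x != 0 -> forall i, `|x ord0 i| <= N].
Proof.
split=> -[mf bf]; last first.
  move=> [N NP]; split=> //.
  exists [set x : 'rV[R]_n | forall i, `[- N, N]%classic (x ord0 i)].
    by apply: (@rV_compact R n (fun=> `[- N, N]%classic)) => i; exact: segment_compact.
  move=> x xN; apply/eqP; apply: contra_notT xN => fx0 i /=.
  by rewrite in_itv/= -ler_norml; exact: NP.
move=> [K cK fK]; split=> //.
have [r Kr] := compact_sub_eball cK; exists r => x fx0 i.
have : K x by apply: contrapT => /fK /eqP; apply/negP.
by move=> /Kr /= xr; apply: (le_trans (norm_coord_le_enorm x i)); exact: ltW.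
Qed.

Lemma test_function_support f : test_function f ->
  exists r, forall x, f x != 0 -> enorm x < r.
Proof.
move=> /test_functionP[_ _ [N NP]].
by have [r rP] := enorm_bounded_coord n N; exists r => x /NP; exact: rP.
Qed.

Lemma test_functionD f g : test_function f -> test_function g ->
  test_function (fun x => f x + g x).
Proof.
move=> /test_functionP[[f1 f2] [M fM] [N fN]] /test_functionP[[g1 g2] [M' gM] [N' gN]].
apply/test_functionP; split.
- split.
    rewrite [X in measurable_fun _ X](_ : _ = (@complex.Re R \o f) \+ (@complex.Re R \o g)).
      exact: measurable_funD.
    by apply/funext => x /=; case: (f x) (g x) => ? ? [].
  rewrite [X in measurable_fun _ X](_ : _ = (@complex.Im R \o f) \+ (@complex.Im R \o g)).
    exact: measurable_funD.
  by apply/funext => x /=; case: (f x) (g x) => ? ? [].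
- exists (M + M') => x; rewrite rmorphD/=; apply: (le_trans (ler_normD _ _)); exact: lerD.
exists (Num.max N N') => x fg0 i; rewrite le_max.
have [fx0|/fN->//] := eqVneq (f x) 0; rewrite gN ?orbT//.
by move: fg0; rewrite fx0 add0r.
Qed.

Lemma test_functionM (u : 'rV[R]_n -> R[i]) f (B : R) :
  measurable_fun setT (@complex.Re R \o u) -> measurable_fun setT (@complex.Im R \o u) ->
  (forall x, `|u x| <= B%:C) -> test_function f -> test_function (fun x => u x * f x).
Proof.
move=> u1 u2 uB /test_functionP[[f1 f2] [M fM] [N fN]].
apply/test_functionP; split.
- split.
    rewrite [X in measurable_fun _ X](_ : _ = (@complex.Re R \o u) \* (@complex.Re R \o f)
        \- (@complex.Im R \o u) \* (@complex.Im R \o f)).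
      by apply: measurable_funB; exact: measurable_funM.
    by apply/funext => x /=; case: (u x) (f x) => ? ? [].
  rewrite [X in measurable_fun _ X](_ : _ = (@complex.Re R \o u) \* (@complex.Im R \o f)
      \+ (@complex.Im R \o u) \* (@complex.Re R \o f)).
    by apply: measurable_funD; exact: measurable_funM.
  by apply/funext => x /=; case: (u x) (f x) => ? ? [].
- by exists (B * M) => x; rewrite rmorphM/= normrM ler_pM.
by exists N => x; rewrite mulf_eq0 negb_or => /andP[_ /fN].
Qed.

Lemma test_functionZ c f : test_function f -> test_function (fun x => c * f x).
Proof.
apply: (@test_functionM (fun=> c) _ (Normc.normc c)).
- exact: measurable_cst.
- exact: measurable_cst.
by move=> x; case: c.
Qed.

Lemma test_function_comp (phi : 'rV[R]_n -> 'rV[R]_n) f (C : R) :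
  measurable_fun setT phi ->
  (forall N x, (forall i, `|phi x ord0 i| <= N) -> forall i, `|x ord0 i| <= N + C) ->
  test_function f -> test_function (f \o phi).
Proof.
move=> mphi phiC /test_functionP[[f1 f2] [M fM] [N fN]].
apply/test_functionP; split; last by exists (N + C) => x /fN; exact: phiC.
  by split; [exact: (measurableT_comp f1 mphi)|exact: (measurableT_comp f2 mphi)].
by exists M => x; exact: fM.
Qed.

Lemma test_function_translation x f : test_function f -> test_function (f \o translation x).
Proof.
apply: (@test_function_comp _ _ (\sum_i `|x ord0 i|)); first exact: measurable_translation.
move=> N y yN i; have := yN i; rewrite mxE => h.
rewrite -[y ord0 i](addrK (x ord0 i)); apply: (le_trans (ler_normB _ _)).
by apply: lerD => //; rewrite (bigD1 i)//= lerDl sumr_ge0.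
Qed.

Lemma test_function_perm s f : test_function f -> test_function (f \o coord_perm s).
Proof.
apply: (@test_function_comp _ _ 0); first exact: measurable_coord_perm.
by move=> N y yN i; rewrite addr0; have := yN (s^-1 i)%g; rewrite mxE permKV.
Qed.

Definition locally_finite (mu : {measure set 'rV[R]_n -> \bar R}) : Prop :=
  forall r, (mu (eball r) < +oo)%E.

Lemma test_cintegrable (mu : {measure set 'rV[R]_n -> \bar R}) f :
  locally_finite mu -> test_function f -> cintegrable mu f.
Proof.
move=> lf tf; have [r fr] := test_function_support tf.
have [[f1 f2] [M fM] _] := tf.
have main (u : 'rV[R]_n -> R) : measurable_fun setT u -> (forall x, `|u x| <= M) ->
    (forall x, f x = 0 -> u x = 0) -> mu.-integrable setT (EFin \o u).
  move=> mu_ uM u0; apply/integrableP; split; first exact/measurable_EFinP.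
  apply: (@le_lt_trans _ _ (\int[mu]_x (M%:E * (\1_(@eball R n r) x)%:E))%E).
    apply: ge0_le_integral => //.
    - by apply/measurable_EFinP; exact: measurableT_comp.
    - by apply: measurable_funeM; apply/measurable_EFinP; apply: measurable_indic; exact: measurable_eball.
    move=> x _; rewrite -EFinM lee_fin indicE.
    have [fx0|/fr xr] := eqVneq (f x) 0.
      rewrite u0// normr0 mulr_ge0//; exact: le_trans (uM x).
    by rewrite mem_set// mulr1.
  rewrite integralZl//; last first.
    apply/integrableP; split.
      by apply/measurable_EFinP; apply: measurable_indic; exact: measurable_eball.
    under eq_integral do rewrite gee0_abs ?lee_fin//.
    by rewrite integral_indic//= ?setIT ?lf//; exact: measurable_eball.
  rewrite integral_indic//= ?setIT; last exact: measurable_eball.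
  by rewrite lte_mul_pinfty ?lee_fin// (le_trans _ (uM 0)).
split; apply: main => //.
- by move=> x; apply: Re_le_normc; exact: fM.
- by move=> x /= ->.
- by move=> x; apply: Im_le_normc; exact: fM.
- by move=> x /= ->.
Qed.

Lemma locally_finite_lebesgue : locally_finite (lebesgue_rV n).
Proof. by move=> r; exact: lebesgue_eball. Qed.

Lemma test_function_expi k f : test_function f ->
  test_function (fun x => expi (- inner k x) * f x).
Proof.
apply: (@test_functionM _ _ 1).
- rewrite [X in measurable_fun _ X](_ : _ = fun x => cos (inner x k)).
    exact: measurable_cos_inner.
  by apply/funext => x /=; rewrite cosN innerC.
- rewrite [X in measurable_fun _ X](_ : _ = \- (fun x => sin (inner x k))).
    by apply: measurable_funN; exact: measurable_sin_inner.
  by apply/funext => x /=; rewrite sinN innerC.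
by move=> x; rewrite norm_expi.
Qed.

Lemma fourierE f k :
  fourier f k = cintegral (lebesgue_rV n) (fun x => expi (- inner k x) * f x).
Proof. by congr cintegral; apply/funext => x; rewrite expiN. Qed.

Lemma fourierD f g k : test_function f -> test_function g ->
  fourier (fun x => f x + g x) k = fourier f k + fourier g k.
Proof.
move=> tf tg; rewrite !fourierE -cintegralD; first by congr cintegral; apply/funext => x; rewrite mulrDr.
  by apply: test_cintegrable; [exact: locally_finite_lebesgue|exact: test_function_expi].
by apply: test_cintegrable; [exact: locally_finite_lebesgue|exact: test_function_expi].
Qed.

Lemma fourierZ c f k : test_function f -> fourier (fun x => c * f x) k = c * fourier f k.
Proof.
move=> tf; rewrite !fourierE -cintegralZ; first by congr cintegral; apply/funext => x; rewrite mulrCA.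
by apply: test_cintegrable; [exact: locally_finite_lebesgue|exact: test_function_expi].
Qed.

(** [f \o translation x] is y |-> f (y + x), whence the positive sign in the phase. *)
Lemma fourier_translation x f k : test_function f ->
  fourier (f \o translation x) k = expi (inner k x) * fourier f k.
Proof.
move=> tf; have te := test_function_expi k tf; have [[m1 m2] _ _] := te.
rewrite !fourierE -(cintegral_lebesgue_translation x m1 m2) -cintegralZ.
  congr cintegral; apply/funext => y /=.
  rewrite mulrA; congr (_ * _).
  by rewrite /translation innerDr opprD expiD mulrCA -expiD subrr expi0 mulr1.
apply: test_cintegrable; first exact: locally_finite_lebesgue.
exact: (test_function_translation x te).
Qed.

Lemma inner_coord_perm s x k : inner (coord_perm s k) (coord_perm s x) = inner k x.
Proof.
rewrite /inner [RHS](reindex_inj (@perm_inj _ s))/=.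
by apply: eq_bigr => i _; rewrite !mxE.
Qed.

Lemma fourier_perm s f k : test_function f ->
  fourier (f \o coord_perm s) k = fourier f (coord_perm s k).
Proof.
move=> tf; have te := test_function_expi (coord_perm s k) tf; have [[m1 m2] _ _] := te.
rewrite !fourierE -(cintegral_lebesgue_perm s m1 m2).
by congr cintegral; apply/funext => y /=; rewrite inner_coord_perm.
Qed.

(** The cube serves twice: its Fourier transform does not vanish near 0, and each of its translates
    contains exactly one lattice point. *)
Definition cube_indicator (x : 'rV[R]_n) : R[i] := (\1_(@unit_cube R n) x)%:C.

Lemma test_cube_indicator : test_function cube_indicator.
Proof.
apply/test_functionP; split.
- split; last exact: measurable_cst.
  by apply: measurable_indic; exact: measurable_unit_cube.
- exists 1 => x; rewrite normc_def lecR /= expr0n addr0 sqrtr_sqr indicE ger0_norm//.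
  by rewrite lern1 leq_b1.
exists 1 => x x0 i; have : unit_cube x.
  apply: contrapT => xN; move: x0.
  by rewrite /cube_indicator indicE memNset// eqxx.
by move=> /(_ i)/andP[h1 h2]; rewrite ger0_norm// ltW.
Qed.

End test_functions.

Section complex_density.
Context d (T : measurableType d) {R : realType}.
Variables (g : {mfun T >-> R}) (mu : {measure set T -> \bar R}).
Hypothesis g0 : forall x, 0 <= g x.
Local Open Scope complex_scope.
Implicit Types h : T -> R[i].

Lemma cintegrable_density h :
  measurable_fun setT (@complex.Re R \o h) -> measurable_fun setT (@complex.Im R \o h) ->
  cintegrable mu (fun x => (g x)%:C * h x) <-> cintegrable (density g mu) h.
Proof.
move=> m1 m2; rewrite /cintegrable -!integrable_density; [|exact/measurable_EFinP|exact/measurable_EFinP].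
have -> : EFin \o (@complex.Re R \o (fun x => (g x)%:C * h x)) =
    fun x => (`|g x|%:E * (EFin \o (@complex.Re R \o h)) x)%E.
  by apply/funext => x /=; rewrite ger0_norm//; case: (h x) => a b /=; rewrite mul0r subr0.
have -> // : EFin \o (@complex.Im R \o (fun x => (g x)%:C * h x)) =
    fun x => (`|g x|%:E * (EFin \o (@complex.Im R \o h)) x)%E.
by apply/funext => x /=; rewrite ger0_norm//; case: (h x) => a b /=; rewrite mul0r addr0.
Qed.

Lemma cintegral_density h :
  measurable_fun setT (@complex.Re R \o h) -> measurable_fun setT (@complex.Im R \o h) ->
  cintegral (density g mu) h = cintegral mu (fun x => (g x)%:C * h x).
Proof.
move=> m1 m2; rewrite /cintegral /Rintegral !integral_density; [|exact/measurable_EFinP|exact/measurable_EFinP].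
congr (fine _ +i* fine _); apply: eq_integral => x _ /=.
  by rewrite ger0_norm//; case: (h x) => a b /=; rewrite mul0r subr0.
by rewrite ger0_norm//; case: (h x) => a b /=; rewrite mul0r addr0.
Qed.

End complex_density.

(** * Spectral measures and covariances *)

Section spectral_uniqueness.
Context {R : realType} (n : nat).
Local Open Scope complex_scope.
Implicit Types (beta : {measure set 'rV[R]_n -> \bar R}) (f g : 'rV[R]_n -> R[i]).

Definition spectral_product f g (k : 'rV[R]_n) : R[i] := fourier f k * (fourier g k)^*%R.

Arguments spectral_product : simpl never.

(** Integrability is included because, for f = g, it makes the measure |fourier f|^2 beta finite, as
    the comparison of characteristic functions requires. *)
Definition same_spectral_integrals beta beta' : Prop :=
  forall f g, test_function f -> test_function g ->
    [/\ cintegrable beta (spectral_product f g),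
        cintegrable beta' (spectral_product f g) &
        cintegral beta (spectral_product f g) = cintegral beta' (spectral_product f g)].

Lemma mulcJ (z : R[i]) : z * z^*%R = (complex.Re z ^+ 2 + complex.Im z ^+ 2)%:C.
Proof.
rewrite -[z^*%R]/(conjc z); case: z => a b /=; simpc.
by rewrite [b * a]mulrC addNr -!expr2.
Qed.

(** On the unit cube the hypothesis gives |<k, x>| <= 1/2, hence cos <k, x> >= 1/2. This bound fixes
    the neighbourhood of 0 in which spectral measures are shown to be unique. *)
Lemma near0_fourier_cube (k : 'rV[R]_n) : \sum_i `|k ord0 i| <= 2^-1 ->
  2^-1 <= complex.Re (fourier (@cube_indicator R n) k).
Proof.
move=> k1; have tc := @test_cube_indicator R n.
have fine_cube : \int[lebesgue_rV n]_x (2^-1 * \1_(@unit_cube R n) x) = 2^-1.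
  rewrite RintegralZl//; last first.
    have [ic _] := test_cintegrable (@locally_finite_lebesgue R n) tc.
    exact: ic.
  rewrite /Rintegral integral_indic//; last exact: measurable_unit_cube.
  by rewrite setIT [X in fine X]lebesgue_unit_cube /= mulr1.
rewrite -[leLHS]fine_cube fourierE /=.
have tk := test_function_expi k tc.
have [ik _] := test_cintegrable (@locally_finite_lebesgue R n) tk.
apply: le_Rintegral => //.
  have [ic _] := test_cintegrable (@locally_finite_lebesgue R n) (test_functionZ (2^-1)%:C tc).
  by apply: eq_integrable ic => // x _ /=; rewrite mul0r subr0.
move=> x _ /=; rewrite indicE; case: (boolP (x \in @unit_cube R n)) => xc; last first.
  by rewrite !mulr0 subrr.
rewrite mulr0 subr0 !mulr1 cosN.
have : `|inner k x| <= 2^-1.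
  apply: le_trans k1; apply: (le_trans (ler_norm_sum _ _ _)); apply: ler_sum => i _.
  rewrite normrM ler_piMr//; move: xc; rewrite inE => /(_ i)/andP[x0 x1].
  by rewrite ger0_norm// ltW.
have := norm_1B_cos_le (inner k x); rewrite ler_norml => /andP[_]; lra.
Qed.

(* Tested on translates of the cube indicator g, the spectral integrals are the
   characteristic function of the finite measure |fourier g|^2 beta, and fourier g
   does not vanish near 0. *)
Lemma spectral_measure_unique beta beta' : same_spectral_integrals beta beta' ->
  forall A, measurable A -> (forall k : 'rV[R]_n, A k -> \sum_i `|k ord0 i| <= 2^-1) ->
  beta A = beta' A.
Proof.
move=> same A mA A1.
pose chi := @cube_indicator R n; have tc : test_function chi := @test_cube_indicator R n.
pose q k := complex.Re (fourier chi k) ^+ 2 +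
            complex.Im (fourier chi k) ^+ 2.
have q0 k : 0 <= q k by rewrite addr_ge0 ?sqr_ge0.
have qE k : spectral_product chi chi k = (q k)%:C.
  by rewrite /spectral_product mulcJ.
have [[iq _] [iq' _] _] := same _ _ tc tc.
have mq : measurable_fun setT q.
  have /integrableP[/measurable_EFinP mq _] := iq.
  rewrite (_ : q = @complex.Re R \o spectral_product chi chi)//.
  by apply/funext => k; exact: (esym (congr1 (@complex.Re R) (qE k))).
pose qm : {mfun _ >-> _} := HB.pack q (isMeasurableFun.Build _ _ _ _ q mq).
have tr (x : 'rV[R]_n) k : spectral_product (chi \o translation x) chi k =
    (q k)%:C * expi (inner k x).
  by rewrite /spectral_product fourier_translation// -mulrA -/(spectral_product _ _ _) qE mulrC.
have fin (b : {measure set 'rV[R]_n -> \bar R}) :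
    b.-integrable setT (EFin \o (@complex.Re R \o spectral_product chi chi)) ->
    (density qm b setT < +oo)%E.
  move=> /integrableP[_]; congr (_ < _)%E; apply: eq_integral => k _.
  by congr (`|_|%:E); exact: (congr1 (@complex.Re R) (qE k)).
have mcos (x : 'rV[R]_n) : measurable_fun setT (fun k : 'rV[R]_n => (cos (inner k x))%:E).
  by apply/measurable_EFinP; exact: measurable_cos_inner.
have msin (x : 'rV[R]_n) : measurable_fun setT (fun k : 'rV[R]_n => (sin (inner k x))%:E).
  by apply/measurable_EFinP; exact: measurable_sin_inner.
have ecos (b : {measure set 'rV[R]_n -> \bar R}) x : \int[density qm b]_k cos (inner k x) =
    complex.Re (cintegral b (spectral_product (chi \o translation x) chi)).
  transitivity (\int[b]_k (`|q k| * cos (inner k x))).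
    by rewrite /Rintegral integral_density.
  apply: eq_Rintegral => k _; rewrite ger0_norm//.
  by rewrite tr [RHS]/= mul0r subr0.
have esin (b : {measure set 'rV[R]_n -> \bar R}) x : \int[density qm b]_k sin (inner k x) =
    complex.Im (cintegral b (spectral_product (chi \o translation x) chi)).
  transitivity (\int[b]_k (`|q k| * sin (inner k x))).
    by rewrite /Rintegral integral_density.
  apply: eq_Rintegral => k _; rewrite ger0_norm//.
  by rewrite tr [RHS]/= mul0r addr0.
have muE : forall B, measurable B -> density qm beta B = density qm beta' B.
  apply: char_fun_unique; [exact: fin|exact: fin| |] => x.
    by rewrite !ecos; have [_ _ ->] := same _ _ (test_function_translation x tc) tc.
  by rewrite !esin; have [_ _ ->] := same _ _ (test_function_translation x tc) tc.
have mqV : measurable_fun setT (fun k => (q k)^-1).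
  rewrite (_ : (fun _ => _) = fun k => powR (q k) (-1)).
    by apply: (measurableT_comp (@measurable_powR R (-1)) mq).
  by apply/funext => k; rewrite powR_inv1.
have mF : measurable_fun setT (fun k => (\1_A k * (q k)^-1)%:E).
  by apply/measurable_EFinP; apply: measurable_funM => //; exact: measurable_indic.
(* The weight is undone by dividing by q, which is positive on [A] because the Fourier transform of
   the cube has real part at least 1/2 there. *)
have bE (b : {measure set 'rV[R]_n -> \bar R}) :
    b A = (\int[density qm b]_k (\1_A k * (q k)^-1)%:E)%E.
  rewrite integral_density// -[A in LHS]setIT -integral_indic//.
  apply: eq_integral => k _; rewrite -EFinM ger0_norm//=.
  rewrite indicE; case: (boolP (k \in A)) => kA; rewrite ?mul0r ?mulr0//.
  rewrite mul1r mulfV// gt_eqF// /q ltr_pwDl ?sqr_ge0// exprn_gt0//.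
  have := near0_fourier_cube (A1 k _); rewrite inE in kA => /(_ kA); lra.
by rewrite !bE; apply: eq_measure_integral => B mB _; exact: muE.
Qed.

End spectral_uniqueness.

(** * Covariances of essentially bounded variables *)

Section covariance_theory.
Context d (T : measurableType d) {R : realType} (P : probability T R).
Implicit Types X Y Z : T -> R[i].

Lemma probability_lt_pinfty : (P setT < +oo)%E.
Proof. by rewrite probability_setT ltry. Qed.

Lemma ess_bounded_P X : ess_bounded P X -> cintegrable P X.
Proof. by apply: ess_bounded_cintegrable; exact: probability_lt_pinfty. Qed.

Lemma cintegral_cst (c : R[i]) : cintegral P (fun=> c) = c.
Proof.
rewrite /cintegral !Rintegral_cst//= probability_setT/= !mulr1.
by case: c.
Qed.

Lemma ccovarianceE X Y : ess_bounded P X -> ess_bounded P Y ->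
  ccovariance P X Y =
  cintegral P (fun w => X w * (Y w)^*%R) - cintegral P X * (cintegral P Y)^*%R.
Proof.
move=> bX bY; rewrite /ccovariance.
set a := cintegral P X; set b := cintegral P Y.
have bXY : ess_bounded P (fun w => X w * (Y w)^*%R).
  by apply: ess_boundedM => //; exact: ess_boundedJ.
have bX' : ess_bounded P (fun w => b^*%R * X w) by exact: ess_boundedZ.
have bY' : ess_bounded P (fun w => a * (Y w)^*%R) by apply: ess_boundedZ; exact: ess_boundedJ.
have bc : ess_bounded P (fun _ : T => a * b^*%R) by exact: ess_bounded_cst.
rewrite (_ : (fun w => _) = fun w => (X w * (Y w)^*%R - b^*%R * X w) - (a * (Y w)^*%R - a * b^*%R)); last first.
  by apply/funext => w; rewrite rmorphB/=; ring.
rewrite !cintegralB; try exact: ess_bounded_P; try by apply: ess_bounded_P; exact: ess_boundedB.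
rewrite (cintegral_cst (a * b^*%R)) !cintegralZ; try exact: ess_bounded_P; try by apply: ess_bounded_P; exact: ess_boundedJ.
rewrite cintegralJ; last exact: ess_bounded_P.
by rewrite -/a -/b; ring.
Qed.

Lemma ae_eq_ccovariance X Y X' Y' : ess_bounded P X -> ess_bounded P Y ->
  ess_bounded P X' -> ess_bounded P Y' ->
  {ae P, forall w, X w = X' w} -> {ae P, forall w, Y w = Y' w} ->
  ccovariance P X Y = ccovariance P X' Y'.
Proof.
move=> bX bY bX' bY' XX' YY'; rewrite !ccovarianceE//.
have [mX1 mX2 _] := bX; have [mX1' mX2' _] := bX'.
have [mY1 mY2 _] := bY; have [mY1' mY2' _] := bY'.
rewrite (ae_eq_cintegral mX1 mX2 mX1' mX2' XX') (ae_eq_cintegral mY1 mY2 mY1' mY2' YY').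
congr (_ - _).
have [m1 m2 _] : ess_bounded P (fun w => X w * (Y w)^*%R).
  by apply: ess_boundedM => //; exact: ess_boundedJ.
have [m1' m2' _] : ess_bounded P (fun w => X' w * (Y' w)^*%R).
  by apply: ess_boundedM => //; exact: ess_boundedJ.
by apply: ae_eq_cintegral => //; apply: filterS2 XX' YY' => w -> ->.
Qed.

Lemma ccovarianceDl X Y Z : ess_bounded P X -> ess_bounded P Y -> ess_bounded P Z ->
  ccovariance P (fun w => X w + Y w) Z = ccovariance P X Z + ccovariance P Y Z.
Proof.
move=> bX bY bZ; rewrite !ccovarianceE//; last exact: ess_boundedD.
have bJ := ess_boundedJ bZ.
rewrite cintegralD ?(ess_bounded_P bX) ?(ess_bounded_P bY)//; try exact: ess_bounded_P.
rewrite (_ : (fun w => _ * _) = fun w => X w * (Z w)^*%R + Y w * (Z w)^*%R); last first.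
  by apply/funext => w; rewrite mulrDl.
rewrite cintegralD; try by apply: ess_bounded_P; exact: ess_boundedM.
by ring.
Qed.

Lemma ccovarianceZl c X Z : ess_bounded P X -> ess_bounded P Z ->
  ccovariance P (fun w => c * X w) Z = c * ccovariance P X Z.
Proof.
move=> bX bZ; rewrite !ccovarianceE//; last exact: ess_boundedZ.
have bJ := ess_boundedJ bZ.
rewrite cintegralZ; last exact: ess_bounded_P.
rewrite (_ : (fun w => _ * _) = fun w => c * (X w * (Z w)^*%R)); last first.
  by apply/funext => w; rewrite mulrA.
rewrite cintegralZ; last by apply: ess_bounded_P; exact: ess_boundedM.
by ring.
Qed.

Lemma ccovarianceC X Y : ess_bounded P X -> ess_bounded P Y ->
  ccovariance P Y X = (ccovariance P X Y)^*%R.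
Proof.
move=> bX bY; rewrite !ccovarianceE// rmorphB rmorphM/= conjCK [in RHS]mulrC.
rewrite -(cintegralJ (f := fun w => X w * (Y w)^*%R)); last first.
  by apply: ess_bounded_P; apply: ess_boundedM => //; exact: ess_boundedJ.
congr (cintegral _ _ - _); apply/funext => w.
by rewrite rmorphM/= conjCK mulrC.
Qed.

Lemma ccovarianceDr X Y Z : ess_bounded P X -> ess_bounded P Y -> ess_bounded P Z ->
  ccovariance P Z (fun w => X w + Y w) = ccovariance P Z X + ccovariance P Z Y.
Proof.
move=> bX bY bZ; have bXY := ess_boundedD bX bY.
by rewrite (ccovarianceC bXY bZ) ccovarianceDl// rmorphD/= -!ccovarianceC.
Qed.

Lemma ccovarianceZr c X Z : ess_bounded P X -> ess_bounded P Z ->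
  ccovariance P Z (fun w => c * X w) = c^*%R * ccovariance P Z X.
Proof.
move=> bX bZ; have bcX := ess_boundedZ c bX.
by rewrite (ccovarianceC bcX bZ) ccovarianceZl// rmorphM/= -ccovarianceC.
Qed.

End covariance_theory.

(** * The stationary lattice *)

Section countable_sums.
Local Open Scope ereal_scope.
Context {R : realType} (Z : countType).
Implicit Types a : Z -> \bar R.

(** Series give access to monotone convergence. [pickle_inv] is defined on codes only, so every z is
    counted once, and the remaining indices contribute 0. *)
Lemma esum_series a : (forall z, 0 <= a z) ->
  \esum_(z in [set: Z]) a z = \sum_(k <oo) oapp a 0 (pickle_inv k).
Proof.
move=> a0; have a'0 k : 0 <= oapp a 0 (@pickle_inv Z k) by case: pickle_inv => [z|]//=.
rewrite nneseries_esumT//.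
transitivity (\esum_(k in range (@pickle Z)) oapp a 0 (@pickle_inv Z k)).
  rewrite esum_image; last by move=> x y _ _; exact: (pcan_inj (@pickleK_inv Z)).
  by apply: eq_esum => z _; rewrite pickleK_inv.
rewrite esum_mkcond; apply: eq_esum => k _.
case: ifPn => //; rewrite notin_setE => h.
by have := @pickle_invK Z k; case: pickle_inv => [z|]//= zk; case: h; exists z.
Qed.

Lemma esum_single z0 a : (forall z, z != z0 -> a z = 0) -> 0 <= a z0 ->
  \esum_(z in [set: Z]) a z = a z0.
Proof.
move=> a0 az0; rewrite -[RHS](@esum_set1 _ _ z0 a)// [RHS]esum_mkcond.
apply: eq_esum => z _; case: ifPn => //; rewrite notin_setE => /= zz0.
by rewrite a0//; exact/eqP.
Qed.

Context d (T : measurableType d) (mu : {measure set T -> \bar R}).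

Lemma ge0_integral_esum (f : Z -> T -> \bar R) :
  (forall z, measurable_fun setT (f z)) -> (forall z x, 0 <= f z x) ->
  \int[mu]_x (\esum_(z in [set: Z]) f z x) = \esum_(z in [set: Z]) \int[mu]_x f z x.
Proof.
move=> mf f0; rewrite esum_series; last by move=> z; exact: integral_ge0.
under eq_integral do rewrite esum_series//.
rewrite (eq_integral (fun x => \sum_(k <oo) oapp f (cst 0) (pickle_inv k) x)); last first.
  by move=> x _; apply: eq_eseriesr => k _; case: pickle_inv.
rewrite integral_nneseries//.
- by apply: eq_eseriesr => k _; case: pickle_inv => //=; rewrite integral0.
- by move=> k; case: pickle_inv => //=; exact: measurable_cst.
- by move=> k x _; case: pickle_inv => //=.
Qed.

Lemma measurable_esum (f : Z -> T -> \bar R) :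
  (forall z, measurable_fun setT (f z)) -> (forall z x, 0 <= f z x) ->
  measurable_fun setT (fun x => \esum_(z in [set: Z]) f z x).
Proof.
move=> mf f0; under eq_fun do rewrite esum_series//.
apply: ge0_emeasurable_sum => [k x _ _|k _].
  by case: pickle_inv => //=.
case: pickle_inv => [z|]/=; [exact: mf|exact: measurable_cst].
Qed.

End countable_sums.

Section lattice_sum_integral.
Local Open Scope ereal_scope.
Context {R : realType} (n : nat).
Variable m : 'rV[int]_n -> {measure set 'rV[R]_n -> \bar R}.

Lemma ge0_integral_lattice_sum (h : 'rV[R]_n -> \bar R) : measurable_fun setT h ->
  (forall x, 0 <= h x) ->
  \int[lattice_sum m]_x h x = \esum_(z in [set: 'rV[int]_n]) \int[m z]_x h x.
Proof.
move=> mh h0; rewrite esum_series; last by move=> z; exact: integral_ge0.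
pose m' k : {measure set 'rV[R]_n -> \bar R} :=
  if pickle_inv k is Some z then m z else mzero.
transitivity (\int[mseries m' 0]_x h x).
  apply: eq_measure_integral => A mA _; rewrite /= /lattice_sum esum_series; last first.
    by move=> z; exact: measure_ge0.
  by apply: eq_eseriesr => k _; rewrite /m'; case: pickle_inv.
rewrite ge0_integral_measure_series//; apply: eq_eseriesr => k _; rewrite /m'.
by case: pickle_inv => //=; rewrite integral_measure_zero.
Qed.

End lattice_sum_integral.

Section stationary_lattice_theory.
Context {R : realType} (n : nat).
Implicit Types (u x y : 'rV[R]_n) (z : 'rV[int]_n).
Local Notation ZZ := [set: 'rV[int]_n].

(** This is [stationary_lattice] at a fixed shift, so that lattice statistics become functions of u
    alone. *)
Definition lattice_measure u : {measure set 'rV[R]_n -> \bar R} :=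
  lattice_sum (fun z => \d_(lattice_point u z)).

Definition floor_rV u : 'rV[int]_n := \row_i Num.floor (u ord0 i).

Lemma unit_cube_floor u z : unit_cube (u - map_mx intr z) <-> z = floor_rV u.
Proof.
split=> [uz|->] .
  apply/rowP => i; rewrite mxE; apply/esym/floor_def.
  by have := uz i; rewrite !mxE subr_ge0 ltrBlDr intrD addrC => /andP[-> ->].
move=> i; rewrite !mxE subr_ge0 floor_le_tmp ltrBlDr addrC.
by have := floorD1_gt (u ord0 i); rewrite intrD.
Qed.

Lemma lattice_measureE u A : lattice_measure u A =
  (\esum_(z in ZZ) (\1_A (lattice_point u z))%:E)%E.
Proof. by []. Qed.

Lemma ge0_integral_lattice_measure u (h : 'rV[R]_n -> \bar R) : measurable_fun setT h ->
  (forall x, 0 <= h x)%E ->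
  (\int[lattice_measure u]_x h x = \esum_(z in ZZ) h (lattice_point u z))%E.
Proof.
move=> mh h0; rewrite ge0_integral_lattice_sum//; apply: eq_esum => z _.
by rewrite integral_dirac// diracT mul1e.
Qed.

Lemma lattice_measure_cube u x : lattice_measure u [set y | unit_cube (y - x)] = 1%E.
Proof.
(* z + u - x lies in the half-open unit cube exactly when -z is the integer part of u - x. *)
rewrite lattice_measureE (esum_single (z0 := - floor_rV (u - x))).
- rewrite indicE mem_set//= /lattice_point.
  have := (unit_cube_floor (u - x) (floor_rV (u - x))).2 erefl.
  by congr (unit_cube _); rewrite map_mxN [- _ + u]addrC [RHS]addrAC.
- move=> z zN; rewrite indicE memNset//= => uz.
  move: zN; rewrite -(opprK z); rewrite (unit_cube_floor (u - x) (- z)).1 ?eqxx//.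
  by move: uz; congr (unit_cube _); rewrite /lattice_point map_mxN opprK [RHS]addrAC [u + _]addrC.
- by rewrite lee_fin.
Qed.

Lemma measure_bigsetU_le (mu : {measure set 'rV[R]_n -> \bar R}) (I : Type) (s : seq I)
    (A : I -> set 'rV[R]_n) : (forall i, measurable (A i)) ->
  (mu (\big[setU/set0]_(i <- s) A i) <= \sum_(i <- s) mu (A i))%E.
Proof.
move=> mA; elim: s => [|i s ih]; first by rewrite !big_nil measure0.
rewrite !big_cons; apply: (le_trans (measureU2 _ _ _)) => //.
  exact: bigsetU_measurable.
exact: leeD.
Qed.

Lemma measurable_cube_translate x : measurable [set y : 'rV[R]_n | unit_cube (y - x)].
Proof.
have := @measurable_translation R n (- x) measurableT _ (@measurable_unit_cube R n).
by rewrite setTI.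
Qed.

Lemma measurable_cube_shift x :
  measurable_fun setT (fun y : 'rV[R]_n => (\1_(@unit_cube R n) (y - x) : R)).
Proof.
rewrite (_ : (fun _ => _) = \1_[set y : 'rV[R]_n | unit_cube (y - x)]).
  by apply: measurable_indic; exact: measurable_cube_translate.
apply/funext => y; rewrite !indicE; congr (nat_of_bool _)%:R.
Qed.

(** Unit cubes with corners in {-N, ..., N - 1}^n cover the ball and each carries one lattice point.
    The bound is therefore uniform in the shift, which makes the linear statistics bounded. *)
Lemma lattice_measure_eball r : exists M : R, forall u, (lattice_measure u (eball r) <= M%:E)%E.
Proof.
pose N := (Num.bound `|r|).
pose c (v : {ffun 'I_n -> 'I_(N + N)}) : 'rV[R]_n := \row_i ((v i)%:R - N%:R).
exists (#|{ffun 'I_n -> 'I_(N + N)}|)%:R => u.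
apply: (@le_trans _ _ (lattice_measure u (\big[setU/set0]_(v <- index_enum {ffun 'I_n -> 'I_(N + N)})
    [set y | unit_cube (y - c v)]))).
  apply: le_measure; rewrite ?inE; first exact: measurable_eball.
    by apply: bigsetU_measurable => v _; exact: measurable_cube_translate.
  move=> y yr.
  have yN i : - N%:R <= y ord0 i < N%:R.
    have : `|y ord0 i| < N%:R.
      apply: (le_lt_trans (norm_coord_le_enorm y i)); apply: (lt_le_trans yr).
      by apply: (le_trans (ler_norm r)); apply: ltW; exact: archi_boundP.
    by rewrite ltr_norml => /andP[/ltW -> ->].
  pose k i := Num.floor (y ord0 i + N%:R).
  have k0 i : 0 <= k i by rewrite floor_ge_int; have := yN i; lra.
  have kN i : (`|k i| < N + N)%N.
    rewrite -(ltr_nat R) natrD -[X in X%:R]/(absz _) natr_absz ger0_norm ?k0//.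
    apply: le_lt_trans (floor_le_tmp _) _; have /andP[_ ] := yN i; lra.
  rewrite -bigcup_seq; exists [ffun i => Ordinal (kN i)]; first exact: mem_index_enum.
  move=> i /=; rewrite !mxE ffunE/= natr_absz ger0_norm ?k0//.
  have := floor_le_tmp (y ord0 i + N%:R); have := floorD1_gt (y ord0 i + N%:R).
  rewrite -/(k i) intrD; lra.
apply: (le_trans (measure_bigsetU_le _ _ _)); first by move=> v; exact: measurable_cube_translate.
rewrite (eq_bigr (fun=> 1%:E)); last by move=> v _; exact: lattice_measure_cube.
by rewrite sumEFin lee_fin sumr_const.
Qed.

Lemma locally_finite_lattice u : locally_finite (lattice_measure u).
Proof.
move=> r; have [M MP] := lattice_measure_eball r.
by apply: le_lt_trans (MP u) _; exact: ltry.
Qed.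

Lemma measurable_lattice_point z : measurable_fun setT (fun u : 'rV[R]_n => lattice_point u z).
Proof.
apply: measurable_coordinateP => i.
rewrite (_ : _ \o _ = (cst ((z ord0 i)%:~R : R)) \+ coordinate i).
  by apply: measurable_funD => //; exact: measurable_coordinate.
by apply/funext => u /=; rewrite /coordinate /lattice_point !mxE.
Qed.

End stationary_lattice_theory.

(** * Campbell's formula for the lattice *)

Section campbell.
Context {R : realType} (n : nat) d (Omega : measurableType d) (P : probability Omega R).
Variable U : Omega -> 'rV[R]_n.
Hypothesis U_uniform : uniform_on_cube P U.
Local Notation ZZ := [set: 'rV[int]_n].

Lemma integral_uniform (h : 'rV[R]_n -> \bar R) : measurable_fun setT h ->
  (forall x, 0 <= h x)%E ->
  (\int[P]_w h (U w) = \int[lebesgue_rV n]_x (h x * (\1_(@unit_cube R n) x)%:E))%E.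
Proof.
have [mU UE] := U_uniform => mh h0.
pose Um : {mfun _ >-> _} := HB.pack U (isMeasurableFun.Build _ _ _ _ U mU).
transitivity (\int[image_measure Um P]_x h x)%E; first by rewrite ge0_integral_image.
transitivity (\int[mrestr (lebesgue_rV n) (@measurable_unit_cube R n)]_x h x)%E.
  by apply: eq_measure_integral => A mA _; exact: UE.
pose chi := \1_(@unit_cube R n) : 'rV[R]_n -> R.
have mchi : measurable_fun setT chi by apply: measurable_indic; exact: measurable_unit_cube.
pose chim : {mfun _ >-> _} := HB.pack chi (isMeasurableFun.Build _ _ _ _ chi mchi).
transitivity (\int[density chim (lebesgue_rV n)]_x h x)%E.
  apply: eq_measure_integral => A mA _.
  rewrite /= /density (eq_integral (fun x => (\1_(@unit_cube R n) x)%:E)); last first.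
    by move=> x _; rewrite ger0_norm.
  by rewrite integral_indic//; [rewrite /mrestr setIC|exact: measurable_unit_cube].
rewrite ge0_integral_density//; apply: eq_integral => x _.
by rewrite ger0_norm// muleC.
Qed.

(** Integration over the uniform shift turns the point with index z into Lebesgue measure on the
    unit cube at z, and these cubes tile the space. *)
Lemma campbell (h : 'rV[R]_n -> \bar R) : measurable_fun setT h ->
  (forall x, 0 <= h x)%E ->
  (\int[P]_w (\int[lattice_measure (U w)]_x h x) = \int[lebesgue_rV n]_x h x)%E.
Proof.
move=> mh h0; have [mU _] := U_uniform.
under eq_integral do rewrite ge0_integral_lattice_measure//.
have mhz z : measurable_fun setT (fun u => h (lattice_point u z)).
  exact: (measurableT_comp mh (measurable_lattice_point z)).
rewrite ge0_integral_esum//; last by move=> z; exact: (measurableT_comp (mhz z) mU).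
transitivity (\esum_(z in ZZ) \int[lebesgue_rV n]_y
    (h y * (\1_(@unit_cube R n) (y - map_mx intr z))%:E))%E.
  apply: eq_esum => z _; rewrite (integral_uniform (mhz z))//.
  have mind : measurable_fun setT (fun y : 'rV[R]_n =>
      (h y * (\1_(@unit_cube R n) (y - map_mx intr z))%:E)%E).
    apply: emeasurable_funM => //; apply/measurable_EFinP.
    exact: measurable_cube_shift.
  transitivity (\int[image_measure (translation (map_mx intr z)) (lebesgue_rV n)]_y
      (h y * (\1_(@unit_cube R n) (y - map_mx intr z))%:E))%E.
    rewrite ge0_integral_image//; last by move=> y; rewrite mule_ge0// lee_fin.
    by apply: eq_integral => y _; rewrite /translation addrK /lattice_point addrC.
  by apply: eq_measure_integral => A mA _; exact: lebesgue_rV_translation.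
rewrite -ge0_integral_esum//; last 2 first.
- move=> z; apply: emeasurable_funM => //; apply/measurable_EFinP.
  exact: measurable_cube_shift.
- by move=> z y; rewrite mule_ge0// lee_fin.
apply: eq_integral => y _.
rewrite (esum_single (z0 := floor_rV y)).
- by rewrite indicE mem_set ?mule1//; exact/unit_cube_floor.
- move=> z zN; rewrite indicE memNset ?mule0// => /unit_cube_floor zE.
  by move: zN; rewrite zE eqxx.
- by rewrite mule_ge0// lee_fin.
Qed.

End campbell.

(** * Exponentials on the torus and their density *)

Section exponentials_on_the_torus.
Context {R : realType} (n : nat).
Local Open Scope complex_scope.
Implicit Types (u x y : 'rV[R]_n) (m z : 'rV[int]_n).

Definition freq m : 'rV[R]_n := (2 * pi) *: map_mx intr m.

Lemma freq0 : freq 0 = 0.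
Proof. by rewrite /freq map_mx0 scaler0. Qed.

Lemma freqD m l : freq (m + l) = freq m + freq l.
Proof. by rewrite /freq map_mxD scalerDr. Qed.

Lemma freqN m : freq (- m) = - freq m.
Proof. by rewrite /freq map_mxN scalerN. Qed.

Lemma expi_2pi_int (k : int) : expi (2 * pi * k%:~R : R) = 1.
Proof.
have expi_nat j : expi (2 * pi * j%:R : R) = 1.
  elim: j => [|j ih]; first by rewrite mulr0 expi0.
  rewrite -[j.+1%:R]natr1 mulrDr mulr1 expiD ih mul1r /expi mulr_natl.
  by rewrite cos2pi sin2pi.
case: k => j; first exact: expi_nat.
by rewrite NegzE mulrNz mulrN expiN -[_%:~R]/(j.+1%:R) expi_nat rmorph1.
Qed.

Lemma expi_lattice_point u z m :
  expi (inner (lattice_point u z) (freq m)) = expi (inner u (freq m)).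
Proof.
rewrite /lattice_point innerDl expiD.
rewrite (_ : inner _ _ = 2 * pi * (\sum_i z ord0 i * m ord0 i)%:~R).
  by rewrite expi_2pi_int mul1r.
rewrite /freq innerZr /inner rmorph_sum/=; congr (_ * _); apply: eq_bigr => i _.
by rewrite !mxE intrM.
Qed.

(** The coefficients vanish off [S], so that two sums can be added over the union of their index
    lists. *)
Definition exponential_sum (F : 'rV[R]_n -> R[i]) : Prop :=
  exists (S : seq 'rV[int]_n) (b : 'rV[int]_n -> R[i]),
  [/\ uniq S, forall m, m \notin S -> b m = 0 &
      forall u, F u = \sum_(m <- S) b m * expi (inner u (freq m))].

Lemma sum_extend (V : nmodType) (S S' : seq 'rV[int]_n) (F : 'rV[int]_n -> V) :
  uniq S -> uniq S' -> {subset S <= S'} -> (forall m, m \notin S -> F m = 0) ->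
  \sum_(m <- S') F m = \sum_(m <- S) F m.
Proof.
move=> uS uS' SS' F0; rewrite (bigID (mem S))/= [X in _ + X]big1 ?addr0.
  rewrite -big_filter; apply: perm_big; apply: uniq_perm => //; first exact: filter_uniq.
  by move=> m; rewrite mem_filter; case: (boolP (m \in S)) => // /SS' ->.
by move=> m /F0.
Qed.

Lemma exponential_sum1 c m : exponential_sum (fun u => c * expi (inner u (freq m))).
Proof.
exists [:: m], (fun l => if l == m then c else 0); split=> //.
  by move=> l; rewrite inE => /negbTE ->.
by move=> u; rewrite big_seq1 eqxx.
Qed.

Lemma exponential_sumD F G : exponential_sum F -> exponential_sum G ->
  exponential_sum (fun u => F u + G u).
Proof.
move=> [S [b [uS b0 FE]]] [S' [b' [uS' b0' GE]]].
exists (undup (S ++ S')), (fun m => b m + b' m); split=> [||u]; first exact: undup_uniq.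
  by move=> m; rewrite mem_undup mem_cat negb_or => /andP[/b0 -> /b0' ->]; rewrite addr0.
rewrite FE GE.
rewrite -(@sum_extend _ S (undup (S ++ S')))//; last 3 first.
- exact: undup_uniq.
- by move=> m mS; rewrite mem_undup mem_cat mS.
- by move=> m /b0 ->; rewrite mul0r.
rewrite -(@sum_extend _ S' (undup (S ++ S')))//; last 3 first.
- exact: undup_uniq.
- by move=> m mS; rewrite mem_undup mem_cat mS orbT.
- by move=> m /b0' ->; rewrite mul0r.
by rewrite -big_split; apply: eq_bigr => m _; rewrite mulrDl.
Qed.

Lemma exponential_sumZ c F : exponential_sum F -> exponential_sum (fun u => c * F u).
Proof.
move=> [S [b [uS b0 FE]]]; exists S, (fun m => c * b m); split=> //.
  by move=> m /b0 ->; rewrite mulr0.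
by move=> u; rewrite FE mulr_sumr; apply: eq_bigr => m _; rewrite mulrA.
Qed.

Lemma trig_poly_exponential_sum h : trig_poly (range freq) h ->
  exponential_sum (fun u => (h u)%:C).
Proof.
elim=> [_ [m _ <-]|_ [m _ <-]|f g _ hf _ hg|c f _ hf].
- have := exponential_sumD (exponential_sum1 (2^-1)%:C m) (exponential_sum1 (2^-1)%:C (- m)).
  congr exponential_sum; apply/funext => u; rewrite freqN innerNr /expi cosN sinN.
  by simpc; congr (_ +i* _); field.
- have := exponential_sumD (exponential_sum1 (0 -i* 2^-1) m) (exponential_sum1 (0 +i* 2^-1) (- m)).
  congr exponential_sum; apply/funext => u; rewrite freqN innerNr /expi cosN sinN.
  by simpc; congr (_ +i* _); field.
- have := exponential_sumD hf hg; congr exponential_sum; apply/funext => u.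
  by rewrite rmorphD.
have := exponential_sumZ c%:C hf; congr exponential_sum; apply/funext => u.
by rewrite rmorphM.
Qed.

End exponentials_on_the_torus.

(* On [0, 1) the coordinate is determined by its cosine and the sign of its sine. *)
Lemma coord_lt_trig (R : realType) (t c : R) : 0 <= t < 1 ->
  (t < c) = ((1 <= c) || ((0 < c) && (
    ((c <= 2^-1) && ((0 <= sin (2 * pi * t)) && (cos (2 * pi * c) < cos (2 * pi * t)))) ||
    ((2^-1 < c) && ~~ ((sin (2 * pi * t) < 0) && (cos (2 * pi * c) <= cos (2 * pi * t))))))).
Proof.
move=> /andP[t0 t1].
have pi0 := pi_gt0 R.
have [c1|c1] /= := leP 1 c; first by rewrite (lt_le_trans t1).
have [c0|c0] /= := ltP 0 c; last by apply/negbTE; rewrite -leNgt (le_trans c0).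
have half (s : R) : 0 <= s <= 2^-1 -> 2 * pi * s \in `[0, (pi : R)].
  by move=> /andP[s0 s1]; rewrite in_itv/=; apply/andP; split; nra.
have sin_low : t <= 2^-1 -> 0 <= sin (2 * pi * t).
  by move=> t2; apply: sin_ge0_pi; have := half t; rewrite in_itv/= t0 t2; exact.
(* The reflection s |-> 1 - s moves the upper half period to the lower one, where cos is strictly
   decreasing. *)
have cosr (s : R) : cos (2 * pi * (1 - s)) = cos (2 * pi * s).
  rewrite mulrBr mulr1 mulr_natl addrC cosD2pi cosN//.
have sinr (s : R) : sin (2 * pi * (1 - s)) = - sin (2 * pi * s).
  by rewrite mulrBr mulr1 mulr_natl addrC sinD2pi sinN.
have sin_high : 2^-1 < t -> sin (2 * pi * t) < 0.
  move=> t2; rewrite -oppr_gt0 -sinr; apply: sin_gt0_pi.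
  by apply/andP; split; nra.
have [c2|c2] /= := leP c 2^-1.
  rewrite orbF; have [t2|t2] := leP t 2^-1.
    rewrite sin_low//= ltr_cos ?half ?t0 ?(ltW c0)//.
    by rewrite ltr_pM2l// mulr_gt0.
  by rewrite leNgt sin_high//=; apply/negbTE; rewrite -leNgt; lra.
have [t2|t2] := leP t 2^-1.
  rewrite (le_lt_trans t2 c2) (_ : (sin (2 * pi * t) < 0) = false)//.
  by apply/negbTE; rewrite -leNgt sin_low.
rewrite sin_high//= -ltNge -(cosr t) -(cosr c) ltr_cos ?half//; last 2 first.
- by apply/andP; split; lra.
- by apply/andP; split; lra.
by rewrite ltr_pM2l ?mulr_gt0// ltrD2l ltrN2.
Qed.

Section density_on_the_torus.
Context {R : realType} (n : nat).
Variable mu : {measure set 'rV[R]_n -> \bar R}.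
Hypothesis mu_fin : (mu setT < +oo)%E.
Hypothesis mu_cube : {ae mu, forall u, @unit_cube R n u}.
Local Notation trig := (trig_poly (range (@freq R n))).

Let G0 : range (@freq R n) 0.
Proof. by exists 0 => //; rewrite freq0. Qed.
Let GD x y : range (@freq R n) x -> range (@freq R n) y -> range (@freq R n) (x + y).
Proof. by move=> [m _ <-] [l _ <-]; exists (m + l) => //; rewrite freqD. Qed.
Let GN x : range (@freq R n) x -> range (@freq R n) (- x).
Proof. by move=> [m _ <-]; exists (- m) => //; rewrite freqN. Qed.

Let trigB : trig `<=` @bounded_measurable _ _ R.
Proof. by move=> h /trig_poly_bounded. Qed.
Let trigC c : trig (cst c).
Proof. exact: trig_poly_cst. Qed.
Let trigD := @trig_add R n (range (@freq R n)).
Let trigM f g : trig f -> trig g -> trig (f \* g).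
Proof. exact: trig_polyM. Qed.

(** On the cube a half-space is a Boolean combination of level sets of the periodic functions [co]
    and [si]. Off the cube this fails, hence the comparison almost everywhere. *)
Lemma trig_poly_dense_torus f : bounded_measurable f -> L2_closure mu trig f.
Proof.
move=> bf; apply: trig_poly_dense => //.
have sS : sigma_algebra setT (L2_sets mu trig) by exact: trig_poly_closure_sets.
apply: measurable_rV_sub_lt => // i c.
pose co (u : 'rV[R]_n) := cos (inner u (freq (delta_mx ord0 i))).
pose si (u : 'rV[R]_n) := sin (inner u (freq (delta_mx ord0 i))).
have clco : L2_closure mu trig co.
  by apply: sub_L2_closure => //; apply: trig_cos; exists (delta_mx ord0 i).
have clsi : L2_closure mu trig si.
  by apply: sub_L2_closure => //; apply: trig_sin; exists (delta_mx ord0 i).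
have fE u : inner u (freq (delta_mx ord0 i)) = 2 * pi * u ord0 i.
  by rewrite /freq map_delta_mx/= -inner_delta.
pose A : set 'rV[R]_n := [set u | (1 <= c) || ((0 < c) && (
    ((c <= 2^-1) && ((0 <= si u) && (cos (2 * pi * c) < co u))) ||
    ((2^-1 < c) && ~~ ((si u < 0) && (cos (2 * pi * c) <= co u)))))].
have LA : L2_sets mu trig A.
  have [S0 SC _] := sS.
  rewrite /A; case: (1 <= c) => /=.
    have := SC _ S0; rewrite setD0 (_ : [set u | _] = setT)//.
    by apply/seteqP; split.
  case: (0 < c) => /=; last first.
    by rewrite (_ : [set u | _] = set0)//; apply/seteqP; split.
  have [_|_] /= := leP c 2^-1.
    rewrite (_ : [set u | _] = [set u | 0 <= si u] `&` [set u | cos (2 * pi * c) < co u]).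
      by apply: L2_setsI => //; [exact: L2_sets_ge|exact: L2_sets_gt].
    by apply/seteqP; split=> u /=; rewrite orbF => /andP.
  rewrite (_ : [set u | _] = ~` ([set u | si u < 0] `&` [set u | cos (2 * pi * c) <= co u])).
    by apply: L2_setsC => //; apply: L2_setsI => //; [exact: L2_sets_lt|exact: L2_sets_ge].
  apply/seteqP; split=> u /=; first by move=> /negP h [h1 h2]; apply: h; exact/andP.
  by move=> h; apply/negP => /andP hh; exact: h.
have mi : measurable [set u : 'rV[R]_n | u ord0 i < c].
  have := @measurable_coordinate R n i measurableT _ (measurable_itv `]-oo, c[).
  by rewrite setTI.
split=> //; have [mA clA] := LA.
apply: (L2_closure_ae _ _ clA) => //.
  by split; [exact: measurable_indic|exists 1 => u; rewrite indicE ger0_norm// lern1 leq_b1].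
apply: filterS mu_cube => u uc; rewrite !indicE; congr (nat_of_bool _)%:R.
by apply/idP/idP; rewrite !inE /A /= /co /si !fE -coord_lt_trig//; exact: uc.
Qed.

End density_on_the_torus.

Section integral_kernels.
Context {R : realType} (n : nat) d (T : measurableType d).
Variable l : T -> {measure set 'rV[R]_n -> \bar R}.
Hypothesis ml : forall A, measurable A -> measurable_fun setT (fun w => l w A).

Lemma measurable_integral_kernel (f : 'rV[R]_n -> \bar R) : measurable_fun setT f ->
  measurable_fun setT (fun w => (\int[l w]_x f x)%E).
Proof.
move=> mf; under eq_fun do rewrite integralE.
apply: emeasurable_funB; apply: measurable_fun_integral_kernel => //.
- exact: measurable_funepos.
- exact: measurable_funeneg.
Qed.

Lemma measurable_Rintegral_kernel (f : 'rV[R]_n -> R) : measurable_fun setT f ->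
  measurable_fun setT (fun w => \int[l w]_x f x).
Proof.
move=> mf; apply: measurableT_comp => //.
by apply: measurable_integral_kernel; exact/measurable_EFinP.
Qed.

Lemma measurable_cintegral_kernel (f : 'rV[R]_n -> R[i]) :
  measurable_fun setT (@complex.Re R \o f) -> measurable_fun setT (@complex.Im R \o f) ->
  measurable_fun setT (fun w => complex.Re (cintegral (l w) f)) /\
  measurable_fun setT (fun w => complex.Im (cintegral (l w) f)).
Proof. by move=> m1 m2; split; exact: measurable_Rintegral_kernel. Qed.

End integral_kernels.

Section test_integral_bounds.
Context {R : realType} (n : nat).
Implicit Types (mu : {measure set 'rV[R]_n -> \bar R}) (f : 'rV[R]_n -> R[i]).

Lemma Rintegral_test_bound mu f (u : 'rV[R]_n -> R) (M r C : R) :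
  measurable_fun setT u -> (forall x, `|u x| <= M) -> (forall x, u x != 0 -> enorm x < r) ->
  mu.-integrable setT (EFin \o u) ->
  (mu (eball r) <= C%:E)%E -> `|\int[mu]_x u x| <= M * C.
Proof.
move=> mu_ uM ur iu muC.
have M0 : 0 <= M by exact: le_trans (uM 0).
apply: (le_trans (le_normr_Rintegral measurableT iu)).
have le : (\int[mu]_x (`|u x|)%:E <= (M * C)%:E)%E.
  apply: (@le_trans _ _ (\int[mu]_x (M%:E * (\1_(@eball R n r) x)%:E))%E).
    apply: ge0_le_integral => //.
    - by apply/measurable_EFinP; exact: measurableT_comp.
    - by apply: measurable_funeM; apply/measurable_EFinP; apply: measurable_indic; exact: measurable_eball.
    move=> x _; rewrite -EFinM lee_fin indicE.
    have [ux0|/ur xr] := eqVneq (u x) 0; first by rewrite ux0 normr0 mulr_ge0.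
    by rewrite mem_set// mulr1.
  rewrite ge0_integralZl//; last first.
    by apply/measurable_EFinP; apply: measurable_indic; exact: measurable_eball.
  rewrite integral_indic//= ?setIT; last exact: measurable_eball.
  by rewrite EFinM lee_wpmul2l// lee_fin.
rewrite /Rintegral -lee_fin fineK//.
rewrite ge0_fin_numE; first exact: le_lt_trans le (ltry _).
by apply: integral_ge0 => x _; rewrite lee_fin.
Qed.

(** r and M are chosen before the measure, so one pair serves all configurations at once. *)
Lemma test_cintegral_bound f : test_function f -> exists r M : R,
  forall mu C, locally_finite mu -> (mu (eball r) <= C%:E)%E ->
  `|complex.Re (cintegral mu f)| <= M * C /\ `|complex.Im (cintegral mu f)| <= M * C.
Proof.
move=> tf; have [r fr] := test_function_support tf.
have [[f1 f2] [M fM] _] := tf.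
exists r, M => mu C lf muC; have [i1 i2] := test_cintegrable lf tf; split.
- apply: (Rintegral_test_bound f f1 _ _ i1 muC).
    by move=> x; apply: Re_le_normc; exact: fM.
  by move=> x /eqP fx; apply: fr; apply/eqP => fx0; apply: fx; rewrite /= fx0.
- apply: (Rintegral_test_bound f f2 _ _ i2 muC).
    by move=> x; apply: Im_le_normc; exact: fM.
  by move=> x /eqP fx; apply: fr; apply/eqP => fx0; apply: fx; rewrite /= fx0.
Qed.

End test_integral_bounds.

Section lattice_statistics.
Context {R : realType} (n : nat) d (Omega : measurableType d) (P : probability Omega R).
Variable U : Omega -> 'rV[R]_n.
Hypothesis U_uniform : uniform_on_cube P U.
Implicit Types (f : 'rV[R]_n -> R[i]) (m z : 'rV[int]_n) (u x : 'rV[R]_n).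

Lemma measurable_lattice_measure A : measurable A ->
  measurable_fun setT (fun u => @lattice_measure R n u A).
Proof.
move=> mA; apply: (@measurable_esum R) => z; last by move=> x; rewrite lee_fin.
apply/measurable_EFinP.
apply: (measurableT_comp _ (measurable_lattice_point z)).
exact: measurable_indic.
Qed.

Lemma lattice_statistic_bounded f : test_function f -> exists M : R,
  forall u, `|complex.Re (cintegral (lattice_measure u) f)| <= M /\
            `|complex.Im (cintegral (lattice_measure u) f)| <= M.
Proof.
move=> tf; have [r [M MP]] := test_cintegral_bound tf.
have [C CP] := @lattice_measure_eball R n r.
by exists (M * C) => u; apply: MP => //; exact: locally_finite_lattice.
Qed.

Lemma measurable_lattice_statistic f : test_function f ->
  measurable_fun setT (fun u => complex.Re (cintegral (lattice_measure u) f)) /\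
  measurable_fun setT (fun u => complex.Im (cintegral (lattice_measure u) f)).
Proof.
move=> [[f1 f2] _ _]; apply: measurable_cintegral_kernel => //.
exact: measurable_lattice_measure.
Qed.

(** [campbell] covers nonnegative functions, so the positive and negative parts are integrated
    separately; both have finite expectation because g is integrable for Lebesgue measure. *)
Lemma Rintegral_campbell (g : 'rV[R]_n -> R) : measurable_fun setT g ->
  (forall mu : {measure set 'rV[R]_n -> \bar R}, locally_finite mu ->
     mu.-integrable setT (EFin \o g)) ->
  \int[P]_w (\int[lattice_measure (U w)]_x g x) = \int[lebesgue_rV n]_x g x.
Proof.
move=> mg ig; have [mU _] := U_uniform.
have mg' : measurable_fun setT (EFin \o g) by exact/measurable_EFinP.
pose A w := (\int[lattice_measure (U w)]_x (EFin \o g)^\+ x)%E.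
pose B w := (\int[lattice_measure (U w)]_x (EFin \o g)^\- x)%E.
have il := ig _ (@locally_finite_lebesgue R n).
have iA : P.-integrable setT A.
  apply/integrableP; split.
    apply: (measurableT_comp (measurable_integral_kernel measurable_lattice_measure _) mU).
    exact: measurable_funepos.
  under eq_integral do rewrite gee0_abs ?integral_ge0//.
  rewrite campbell//; last exact: measurable_funepos.
  have /integrableP[_] := integrable_funepos measurableT il.
  by under eq_integral do rewrite gee0_abs//.
have iB : P.-integrable setT B.
  apply/integrableP; split.
    apply: (measurableT_comp (measurable_integral_kernel measurable_lattice_measure _) mU).
    exact: measurable_funeneg.
  under eq_integral do rewrite gee0_abs ?integral_ge0//.
  rewrite campbell//; last exact: measurable_funeneg.
  have /integrableP[_] := integrable_funeneg measurableT il.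
  by under eq_integral do rewrite gee0_abs//.
rewrite /Rintegral; congr fine.
transitivity (\int[P]_w (A w - B w))%E.
  apply: eq_integral => w _; rewrite fineK; first by rewrite integralE.
  exact: integrable_fin_num (ig _ (locally_finite_lattice (U w))).
rewrite integralB// /A /B !campbell//; [|exact: measurable_funeneg|exact: measurable_funepos].
by rewrite [RHS]integralE.
Qed.

Lemma cintegral_campbell f : test_function f ->
  cintegral P (fun w => cintegral (lattice_measure (U w)) f) = cintegral (lebesgue_rV n) f.
Proof.
move=> tf; have [[f1 f2] _ _] := tf; congr Complex; apply: Rintegral_campbell => //.
- by move=> mu /test_cintegrable /(_ tf) [].
- by move=> mu /test_cintegrable /(_ tf) [].
Qed.

Lemma measurable_rV_set1 x : measurable [set x].
Proof.
rewrite (_ : [set x] = box (fun i => [set x ord0 i])); first exact: measurable_box.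
by apply/seteqP; split=> y /=; [move=> -> i|move=> h; apply/rowP => i; exact: h].
Qed.

Lemma measurable_lattice_range u : measurable (range (lattice_point u)).
Proof.
rewrite (_ : range _ = \bigcup_k oapp (fun z => [set lattice_point u z]) set0 (@pickle_inv 'rV[int]_n k)).
  by apply: bigcupT_measurable => k; case: pickle_inv => //= z; exact: measurable_rV_set1.
apply/seteqP; split=> x /=; first by move=> [z _ <-]; exists (pickle z) => //; rewrite pickleK_inv.
by move=> [k _]; case: pickle_inv => //= z ->; exists z.
Qed.

Lemma lattice_measure_ae u (Q : 'rV[R]_n -> Prop) : (forall z, Q (lattice_point u z)) ->
  {ae lattice_measure u, forall x, Q x}.
Proof.
move=> Qz; exists (~` range (lattice_point u)); split.
- by apply: measurableC; exact: measurable_lattice_range.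
- rewrite lattice_measureE esum1// => z _; rewrite indicE memNset//=.
  by apply; exists z.
- by move=> x /= nQ [z _ zx]; apply: nQ; rewrite -zx.
Qed.

Definition em m (w : Omega) : R[i] := expi (inner (U w) (freq m)).

Lemma ess_bounded_em m : ess_bounded P (em m).
Proof.
have [mU _] := U_uniform; split.
- exact: (measurableT_comp (measurable_cos_inner (freq m)) mU).
- exact: (measurableT_comp (measurable_sin_inner (freq m)) mU).
by exists 1; apply: nearW => w; rewrite /em /expi/= cos_max sin_max.
Qed.

Lemma ess_bounded_lattice f : test_function f ->
  ess_bounded P (fun w => cintegral (lattice_measure (U w)) f).
Proof.
have [mU _] := U_uniform.
move=> tf; have [m1 m2] := measurable_lattice_statistic tf.
split; [exact: (measurableT_comp m1 mU)|exact: (measurableT_comp m2 mU)|].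
by have [M MP] := lattice_statistic_bounded tf; exists M; apply: nearW => w; exact: MP.
Qed.

(** Poisson summation in probabilistic form: the character of frequency 2 pi m is constant on the
    shifted lattice, so it moves inside the lattice sum, and Campbell's formula turns the result
    into a Fourier transform. *)
Lemma lattice_fourier_coefficient f m : test_function f ->
  cintegral P (fun w => cintegral (lattice_measure (U w)) f * (em m w)^*%R) = fourier f (freq m).
Proof.
move=> tf; have te := test_function_expi (freq m) tf.
rewrite fourierE -(cintegral_campbell te); congr cintegral; apply/funext => w.
have [[f1 f2] _ _] := tf; have [[e1 e2] _ _] := te.
have [[c1 c2] _ _] := test_functionZ (em m w)^*%R tf.
rewrite mulrC -cintegralZ; last by apply: test_cintegrable => //; exact: locally_finite_lattice.
apply: ae_eq_cintegral => //; apply: lattice_measure_ae => z.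
by rewrite [inner (freq m) _]innerC expiN expi_lattice_point.
Qed.

Lemma lattice_statistic_cube u x :
  cintegral (lattice_measure u) (@cube_indicator R n \o translation (- x)) = 1.
Proof.
rewrite /cintegral /cube_indicator /=.
rewrite (_ : (fun y => _) = \1_[set y : 'rV[R]_n | unit_cube (y - x)]); last first.
  by apply/funext => y; rewrite !indicE.
rewrite /Rintegral integral_indic ?setIT; [|by []|exact: measurable_cube_translate].
by rewrite [X in fine X]lattice_measure_cube integral0.
Qed.

(** Every translated unit cube has lattice statistic 1, so the value does not change with the
    translation, while the Fourier transform of the cube acquires a phase. For m different from 0
    the phase can be made -1, which forces the value 0. *)
Lemma cintegral_em_conj m : cintegral P (fun w => (em m w)^*%R) = (m == 0)%:R.
Proof.
have tc := @test_cube_indicator R n.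
have main x : cintegral P (fun w => (em m w)^*%R) =
    expi (inner (freq m) (- x)) * fourier (@cube_indicator R n) (freq m).
  rewrite -fourier_translation// -lattice_fourier_coefficient; last exact: test_function_translation.
  by congr cintegral; apply/funext => w; rewrite lattice_statistic_cube mul1r.
have [->|m0] := eqVneq m 0.
  rewrite -[RHS](cintegral_cst P); congr cintegral; apply/funext => w.
  by rewrite /em freq0 inner0r expi0 rmorph1.
have [i mi0] : exists i, m ord0 i != 0.
  apply: contrapT => h; move/eqP: m0; apply; apply/rowP => i; rewrite mxE.
  by apply/eqP; apply: contrapT => /negP mi; apply: h; exists i.
(* Translation by 1 / (2 m_i) along the i-th axis is half a period of the exponential. *)
have := main ((2 * (m ord0 i)%:~R)^-1 *: delta_mx ord0 i).
rewrite innerNr inner_delta /freq !mxE.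
have mR : (m ord0 i)%:~R != 0 :> R by rewrite intr_eq0.
rewrite (_ : _^-1 * _ = pi); last by field.
rewrite (main 0) oppr0 inner0r expi0 mul1r expiN /expi cospi sinpi => e.
set F := fourier _ _ in e *.
have : F + F = 0.
  rewrite {1}e; case: (F) => a b; rewrite -[X in X * _]/(conjc _) /=; simpc.
  by rewrite !addNr.
by rewrite -mulr2n => /eqP; rewrite mulrn_eq0/= => /eqP.
Qed.

Lemma em_orthonormal m l : cintegral P (fun w => em m w * (em l w)^*%R) = (m == l)%:R.
Proof.
rewrite -subr_eq0 -oppr_eq0 opprB -cintegral_em_conj; congr cintegral; apply/funext => w.
by rewrite /em freqD freqN innerDr innerNr expiD expiN rmorphM/= conjCK mulrC.
Qed.

End lattice_statistics.

Section square_modulus.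
Context {R : realType}.
Local Open Scope complex_scope.

Definition normsq (z : R[i]) : R := complex.Re z ^+ 2 + complex.Im z ^+ 2.

Lemma normsq_ge0 z : 0 <= normsq z.
Proof. by rewrite addr_ge0 ?sqr_ge0. Qed.

Lemma mulcJE z : z * z^*%R = (normsq z)%:C.
Proof. exact: mulcJ. Qed.

Lemma normsq0 : normsq 0 = 0.
Proof. by rewrite /normsq /= expr0n addr0. Qed.

Lemma polarization (a b : R[i]) :
  let p (c : R[i]) := c / 4%:R * ((a + c * b) * (a + c * b)^*%R) in
  a * b^*%R = p 1 + p (-1) + p 'i%C + p (- 'i%C).
Proof.
move=> p; rewrite /p !rmorphD/= !rmorphM/= !rmorphN/= rmorph1.
rewrite (_ : 'i%C^*%R = - 'i%C :> R[i]); last by apply/eqP; rewrite eq_complex /= oppr0 !eqxx.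
have i2 : 'i%C * 'i%C = -1 :> R[i] by rewrite -expr2 sqr_i.
(* [field] treats 'i as an indeterminate, and the two sides then differ by a multiple of 'i^2 + 1.
   That multiple, which is zero, is added beforehand. *)
rewrite -[LHS]addr0 -[X in _ + X](mul0r ((a^*%R * b - a * b^*%R) / 2)) -{1}(subrr (-1)) -{1}i2.
by field.
Qed.

End square_modulus.

(** * Parseval's identity *)

Section parseval.
Context {R : realType} (n : nat) d (Omega : measurableType d) (P : probability Omega R).
Variable U : Omega -> 'rV[R]_n.
Hypothesis U_uniform : uniform_on_cube P U.
Local Open Scope complex_scope.
Implicit Types (m z : 'rV[int]_n) (X : Omega -> R[i]).
Local Notation em := (@em R n _ Omega U).

Definition coef X m : R[i] := cintegral P (fun w => X w * (em m w)^*%R).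

Definition energy X : R := \int[P]_w normsq (X w).

Lemma energyE X : ess_bounded P X -> cintegral P (fun w => X w * (X w)^*%R) = (energy X)%:C.
Proof.
move=> bX; rewrite /cintegral /energy; congr (_ +i* _).
  by apply: eq_Rintegral => w _; rewrite mulcJE.
rewrite (_ : \int[P]_w _ = \int[P]_w (cst 0 w)); first by rewrite Rintegral_cst// mul0r.
by apply: eq_Rintegral => w _; rewrite mulcJE.
Qed.

Lemma energy_ge0 X : 0 <= energy X.
Proof. by apply: Rintegral_ge0 => w _; exact: normsq_ge0. Qed.

Let bem m : ess_bounded P (em m) := ess_bounded_em U_uniform m.

(** Completing the square over an orthonormal family. Taking b to be the coefficients of X gives
    Bessel's inequality; taking b from an approximating exponential sum gives the converse. *)
Lemma energy_approximation X (S : seq 'rV[int]_n) (b : 'rV[int]_n -> R[i]) :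
  ess_bounded P X -> uniq S ->
  energy (fun w => X w - \sum_(m <- S) b m * em m w) =
  energy X - \sum_(m <- S) normsq (coef X m) + \sum_(m <- S) normsq (coef X m - b m).
Proof.
move=> bX uS; apply: complexI.
pose Y w := \sum_(m <- S) b m * em m w.
have bY : ess_bounded P Y by apply: ess_bounded_sum => m; apply: ess_boundedZ; exact: bem.
have bXY : ess_bounded P (fun w => X w - Y w) by exact: ess_boundedB.
have bprod V W : ess_bounded P V -> ess_bounded P W -> ess_bounded P (fun w => V w * (W w)^*%R).
  by move=> ? ?; apply: ess_boundedM => //; exact: ess_boundedJ.
have iprod V W : ess_bounded P V -> ess_bounded P W -> cintegrable P (fun w => V w * (W w)^*%R).
  by move=> ? ?; apply: ess_bounded_P; exact: bprod.
rewrite -(energyE bXY).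
have -> : cintegral P (fun w => (X w - Y w) * (X w - Y w)^*%R) =
    cintegral P (fun w => X w * (X w)^*%R) - cintegral P (fun w => X w * (Y w)^*%R)
    - (cintegral P (fun w => Y w * (X w)^*%R) - cintegral P (fun w => Y w * (Y w)^*%R)).
  rewrite -!cintegralB//; try exact: iprod; try by apply: cintegrableB; exact: iprod.
  by congr cintegral; apply/funext => w; rewrite rmorphB/=; ring.
have XY : cintegral P (fun w => X w * (Y w)^*%R) = \sum_(m <- S) (b m)^*%R * coef X m.
  transitivity (\sum_(m <- S) cintegral P (fun w => (b m)^*%R * (X w * (em m w)^*%R))); last first.
    by apply: eq_bigr => m _; rewrite cintegralZ//; apply: iprod => //; exact: bem.
  rewrite -cintegral_sum; last by move=> m; apply: cintegrableZ; apply: iprod => //; exact: bem.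
  congr cintegral; apply/funext => w; rewrite /Y rmorph_sum/= mulr_sumr.
  by apply: eq_bigr => m _; rewrite rmorphM/= mulrCA.
have YX : cintegral P (fun w => Y w * (X w)^*%R) = \sum_(m <- S) b m * (coef X m)^*%R.
  transitivity (cintegral P (fun w => X w * (Y w)^*%R))^*%R.
    rewrite -cintegralJ; last exact: iprod.
    by congr cintegral; apply/funext => w; rewrite rmorphM/= conjCK mulrC.
  by rewrite XY rmorph_sum/=; apply: eq_bigr => m _; rewrite rmorphM/= conjCK.
have YY : cintegral P (fun w => Y w * (Y w)^*%R) = \sum_(m <- S) b m * (b m)^*%R.
  have YE m : cintegral P (fun w => Y w * (em m w)^*%R) = \sum_(l <- S) b l * (l == m)%:R.
    transitivity (\sum_(l <- S) cintegral P (fun w => b l * (em l w * (em m w)^*%R))); last first.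
      by apply: eq_bigr => l _; rewrite cintegralZ ?em_orthonormal//; apply: iprod; exact: bem.
    rewrite -cintegral_sum; last by move=> l; apply: cintegrableZ; apply: iprod; exact: bem.
    congr cintegral; apply/funext => w; rewrite /Y mulr_suml.
    by apply: eq_bigr => l _; rewrite mulrA.
  transitivity (\sum_(m <- S) cintegral P (fun w => (b m)^*%R * (Y w * (em m w)^*%R))).
    rewrite -cintegral_sum; last by move=> m; apply: cintegrableZ; apply: iprod => //; exact: bem.
    congr cintegral; apply/funext => w; rewrite {2}/Y rmorph_sum/= mulr_sumr.
    by apply: eq_bigr => m _; rewrite rmorphM/= mulrCA.
  apply: eq_big_seq => m mS; rewrite cintegralZ; last by apply: iprod => //; exact: bem.
  rewrite YE mulrC; congr (_ * _).
  rewrite (bigD1_seq m)//= eqxx mulr1 big1 ?addr0// => l lm.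
  by rewrite (negbTE lm) mulr0.
rewrite XY YX YY (energyE bX) rmorphD rmorphB/= !rmorph_sum/= -addrA -[RHS]addrA; congr (_ + _).
rewrite opprB -!sumrN -!big_split/=; apply: eq_bigr => m _.
by rewrite -!mulcJE rmorphB/=; ring.
Qed.

Lemma bessel X (S : seq 'rV[int]_n) : ess_bounded P X -> uniq S ->
  \sum_(m <- S) normsq (coef X m) <= energy X.
Proof.
move=> bX uS; have := energy_ge0 (fun w => X w - \sum_(m <- S) coef X m * em m w).
rewrite (energy_approximation (coef X) bX uS) [X in _ + X]big1 ?addr0 ?subr_ge0// => m _.
by rewrite subrr normsq0.
Qed.

(** Real and imaginary part of phi are approximated within e / 2 in L2 of the law of [U], which is
    carried by the unit cube. The defect in Bessel's inequality over the frequencies used is at most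
    the total error. *)
Lemma parseval_approximation (phi : 'rV[R]_n -> R[i]) (e : R) :
  bounded_measurable (@complex.Re R \o phi) -> bounded_measurable (@complex.Im R \o phi) ->
  0 < e -> exists2 S : seq 'rV[int]_n, uniq S &
    energy (phi \o U) <= \sum_(m <- S) normsq (coef (phi \o U) m) + e.
Proof.
move=> b1 b2 e0; have [mU UE] := U_uniform.
pose Um : {mfun _ >-> _} := HB.pack U (isMeasurableFun.Build _ _ _ _ U mU).
pose mu : {measure set 'rV[R]_n -> \bar R} := image_measure Um P.
have mufin : (mu setT < +oo)%E.
  by rewrite /mu /= /image_measure /pushforward preimage_setT probability_lt_pinfty.
have mucube : {ae mu, forall u, @unit_cube R n u}.
  exists (~` @unit_cube R n); split => //.
    by apply: measurableC; exact: measurable_unit_cube.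
  transitivity (P (U @^-1` (~` @unit_cube R n))) => //.
  rewrite UE ?setICl ?measure0//; by apply: measurableC; exact: measurable_unit_cube.
have e20 : 0 < e / 2 by rewrite divr_gt0.
have [_ /(_ _ e20)[h1 t1 d1]] := trig_poly_dense_torus mufin mucube b1.
have [_ /(_ _ e20)[h2 t2 d2]] := trig_poly_dense_torus mufin mucube b2.
have [S [b [uS b0 FE]]] := exponential_sumD (trig_poly_exponential_sum t1)
  (exponential_sumZ 'i%C (trig_poly_exponential_sum t2)).
exists S => //.
have [mf1 [M1 M1P]] := b1; have [mf2 [M2 M2P]] := b2.
have bX : ess_bounded P (phi \o U).
  split; [exact: (measurableT_comp mf1 mU)|exact: (measurableT_comp mf2 mU)|].
  exists (Num.max M1 M2); apply: nearW => w.
  by split; [rewrite le_max (M1P (U w))|rewrite le_max (M2P (U w)) orbT].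
have := energy_approximation b bX uS; set lhs := energy _ => lhsE.
suff : lhs <= e.
  rewrite lhsE; have : 0 <= \sum_(m <- S) normsq (coef (phi \o U) m - b m).
    by apply: sumr_ge0 => m _; exact: normsq_ge0.
  lra.
have [mh1 _] := trig_poly_bounded t1; have [mh2 _] := trig_poly_bounded t2.
have mq1 : measurable_fun setT (fun u => ((complex.Re (phi u) - h1 u) ^+ 2)%:E).
  exact: measurable_sqdist.
have mq2 : measurable_fun setT (fun u => ((complex.Im (phi u) - h2 u) ^+ 2)%:E).
  exact: measurable_sqdist.
have le_e : (\int[P]_w (normsq ((phi \o U) w - \sum_(m <- S) b m * em m w))%:E <= e%:E)%E.
  apply: (@le_trans _ _ ((e / 2)%:E + (e / 2)%:E)%E); last first.
    by rewrite -EFinD lee_fin; lra.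
  apply: le_trans (leeD d1 d2); rewrite /sqdist.
  rewrite !(ge0_integral_image Um)//; last 2 first.
  - by move=> u; rewrite lee_fin sqr_ge0.
  - by move=> u; rewrite lee_fin sqr_ge0.
  rewrite -ge0_integralD//; last 4 first.
  - by move=> w _; rewrite lee_fin sqr_ge0.
  - exact: (measurableT_comp mq1 mU).
  - by move=> w _; rewrite lee_fin sqr_ge0.
  - exact: (measurableT_comp mq2 mU).
  rewrite le_eqVlt; apply/orP; left; apply/eqP.
  apply: eq_integral => w _; rewrite -EFinD /normsq /=.
  by rewrite -(FE (U w)); case: (phi (U w)) => p q /=; congr ((_ ^+ 2 + _ ^+ 2)%:E); ring.
rewrite /lhs /energy /Rintegral -lee_fin fineK// ge0_fin_numE.
  exact: le_lt_trans le_e (ltry _).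
by apply: integral_ge0 => w _; rewrite lee_fin normsq_ge0.
Qed.

Lemma parseval (phi : 'rV[R]_n -> R[i]) :
  bounded_measurable (@complex.Re R \o phi) -> bounded_measurable (@complex.Im R \o phi) ->
  (\esum_(m in [set: 'rV[int]_n]) (normsq (coef (phi \o U) m))%:E = (energy (phi \o U))%:E)%E.
Proof.
move=> b1 b2; have [mU _] := U_uniform.
have [mf1 [M1 M1P]] := b1; have [mf2 [M2 M2P]] := b2.
have bX : ess_bounded P (phi \o U).
  split; [exact: (measurableT_comp mf1 mU)|exact: (measurableT_comp mf2 mU)|].
  exists (Num.max M1 M2); apply: nearW => w.
  by split; [rewrite le_max (M1P (U w))|rewrite le_max (M2P (U w)) orbT].
apply/eqP; rewrite eq_le; apply/andP; split.
  apply: ge_ereal_sup => _ [A [finA _] <-].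
  rewrite fsbig_finite//= sumEFin lee_fin; apply: bessel => //.
  exact: finmap.fset_uniq.
apply/lee_addgt0Pr => e e0.
have [S uS le] := parseval_approximation b1 b2 e0.
apply: (@le_trans _ _ ((\sum_(m <- S) normsq (coef (phi \o U) m))%:E + e%:E)%E).
  by rewrite -EFinD lee_fin.
apply: leeD => //; apply: esum_ge; exists [set` S]; first by split => //; exact: finite_seq.
by rewrite -fsbig_seq// sumEFin.
Qed.

End parseval.

(** * The spectral measure of the stationary lattice *)

Section lattice_spectral_measure.
Context {R : realType} (n : nat).
Local Notation ZZ := [set: 'rV[int]_n].

Lemma esumZl (Z : countType) (c : R) (a : Z -> \bar R) : 0 <= c -> (forall z, 0 <= a z)%E ->
  (\esum_(z in [set: Z]) (c%:E * a z) = c%:E * \esum_(z in [set: Z]) a z)%E.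
Proof.
move=> c0 a0; rewrite !esum_series//; last by move=> z; rewrite mule_ge0// lee_fin.
rewrite -nneseriesZl//; last by move=> k _; case: pickle_inv => /=.
by apply: eq_eseriesr => k _; case: pickle_inv => //=; rewrite mule0.
Qed.

Definition spectral_weight : {nonneg R} := NngNum (exprn_ge0 n (mulr_ge0 (ler0n R 2) (pi_ge0 R))).

(* The factor (2 pi)^n compensates the (2 pi)^-n in front of the spectral integral;
   the frequency 0 is left out because a covariance subtracts the means. *)
Definition lattice_spectral : {measure set 'rV[R]_n -> \bar R} :=
  lattice_sum (fun m => if m == 0 then (mzero : {measure set 'rV[R]_n -> \bar R})
                        else mscale spectral_weight (\d_(freq m))).

Lemma ge0_integral_lattice_spectral (h : 'rV[R]_n -> \bar R) : measurable_fun setT h ->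
  (forall x, 0 <= h x)%E ->
  (\int[lattice_spectral]_x h x =
   ((2 * pi) ^+ n)%:E * \esum_(m in ZZ) (if (m == 0)%R then 0 else h (freq m)))%E.
Proof.
move=> mh h0; rewrite ge0_integral_lattice_sum// -esumZl; last 2 first.
- by rewrite exprn_ge0// mulr_ge0// pi_ge0.
- by move=> m; case: ifP.
apply: eq_esum => m _; case: ifPn => m0; first by rewrite integral_measure_zero mule0.
by rewrite ge0_integral_mscale// integral_dirac// diracT mul1e.
Qed.

Lemma lattice_spectralE A : measurable A -> lattice_spectral A =
   (((2 * pi) ^+ n)%:E * \esum_(m in ZZ) (if (m == 0)%R then 0 else (\1_A (freq m))%:E))%E.
Proof.
move=> mA; rewrite -[A in LHS]setIT -integral_indic// ge0_integral_lattice_spectral//.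
exact/measurable_EFinP/measurable_indic.
Qed.

Lemma enormZ c (x : 'rV[R]_n) : 0 <= c -> enorm (c *: x) = c * enorm x.
Proof.
move=> c0; have -> : c * enorm x = Num.sqrt (c ^+ 2) * enorm x by rewrite sqrtr_sqr ger0_norm.
rewrite /enorm -sqrtrM ?sqr_ge0//.
by congr Num.sqrt; rewrite mulr_sumr; apply: eq_bigr => i _; rewrite mxE exprMn.
Qed.

Lemma lattice_spectral_near0 r : r <= 2 * pi -> lattice_spectral (eball r) = 0%E.
Proof.
move=> r2; rewrite lattice_spectralE; last exact: measurable_eball.
rewrite esum1 ?mule0// => m _; case: ifPn => // m0; rewrite indicE memNset// => /= mr.
have [i mi0] : exists i, m ord0 i != 0.
  apply: contrapT => h; move/eqP: m0; apply; apply/rowP => i; rewrite mxE.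
  by apply/eqP; apply: contrapT => /negP mi; apply: h; exists i.
have fmi : freq m ord0 i = 2 * pi * (m ord0 i)%:~R :> R by rewrite /freq !mxE.
have := norm_coord_le_enorm (freq m : 'rV[R]_n) i; rewrite fmi normrM ger0_norm ?mulr_ge0 ?pi_ge0//.
have : 1 <= `|(m ord0 i)%:~R| :> R.
  by rewrite -intr_norm -[1]/(1%:~R) ler_int -gtz0_ge1 normr_gt0.
have := pi_gt0 R; have := lt_le_trans mr r2; rewrite -/(freq m); nra.
Qed.

(** Since 2 pi >= 1, a ball that contains 2 pi m contains m, so the number of atoms is bounded by
    the number of integer points in the ball. *)
Lemma locally_finite_lattice_spectral : locally_finite lattice_spectral.
Proof.
move=> r; rewrite lattice_spectralE; last exact: measurable_eball.
have [M MP] := @lattice_measure_eball R n r.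
apply: lte_mul_pinfty => //; first by rewrite lee_fin exprn_ge0// mulr_ge0// pi_ge0.
apply: le_lt_trans (ltry M); apply: le_trans (MP 0); rewrite lattice_measureE; apply: le_esum => m _.
case: ifPn => [_|m0]; first by rewrite lee_fin.
rewrite lee_fin !indicE ler_nat; case: (boolP (freq m \in eball r)) => //; rewrite inE => mr.
rewrite mem_set//= /lattice_point addr0; apply: le_lt_trans mr.
have p2 : 1 <= 2 * pi :> R by have := pi_ge2 R; lra.
by rewrite /freq enormZ ?(le_trans ler01)// ler_peMl// sqrtr_ge0.
Qed.

Context d (Omega : measurableType d) (P : probability Omega R).
Variable U : Omega -> 'rV[R]_n.
Hypothesis U_uniform : uniform_on_cube P U.
Local Open Scope complex_scope.
Implicit Types f g : 'rV[R]_n -> R[i].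
Hypothesis measurable_spectral : forall f g, test_function f -> test_function g ->
  measurable_fun setT (@complex.Re R \o spectral_product f g) /\
  measurable_fun setT (@complex.Im R \o spectral_product f g).

Local Notation stat f := (fun w => cintegral (lattice_measure (U w)) f).

(** The Fourier coefficients of u |-> L_u(f) are the values of the Fourier transform of f on 2 pi
    Z^n, and the coefficient at 0 is the mean. Parseval's identity without that term is the
    variance. *)
Lemma lattice_spectral_quadratic f : test_function f ->
  cintegrable lattice_spectral (spectral_product f f) /\
  ccovariance P (stat f) (stat f) =
    ((2 * pi) ^- n)%:C * cintegral lattice_spectral (spectral_product f f).
Proof.
move=> tf; have [mU _] := U_uniform.
pose phi u := cintegral (lattice_measure u) f.
have [m1 m2] := measurable_lattice_statistic tf.
have [M MP] := lattice_statistic_bounded tf.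
have b1 : bounded_measurable (@complex.Re R \o phi) by split=> //; exists M => u; case: (MP u).
have b2 : bounded_measurable (@complex.Im R \o phi) by split=> //; exists M => u; case: (MP u).
have bX := ess_bounded_lattice U_uniform tf.
have coefE m : coef P U (phi \o U) m = fourier f (freq m).
  exact: lattice_fourier_coefficient.
have mean : cintegral P (stat f) = fourier f (freq 0).
  rewrite -coefE /coef; congr cintegral; apply/funext => w.
  by rewrite /em freq0 inner0r expi0 rmorph1 mulr1.
have := parseval U_uniform b1 b2.
(* The frequency 0 is split off: it contributes the squared modulus of the mean. *)
rewrite (esumID [set 0]) /=; last by move=> m _; rewrite lee_fin normsq_ge0.
rewrite setTI esum_set1; last by rewrite lee_fin normsq_ge0.
rewrite setTI esum_mkcond coefE -mean => pars.
have [m11 m12] := measurable_spectral tf tf.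
have spE k : spectral_product f f k = (normsq (fourier f k))%:C by exact: mulcJE.
have mns : measurable_fun setT (fun k => (normsq (fourier f k))%:E).
  apply/measurable_EFinP; congr (measurable_fun _ _): m11.
  by apply/funext => k; exact: (congr1 (@complex.Re R) (spE k)).
have int_ns : (\int[lattice_spectral]_k (normsq (fourier f k))%:E =
    ((2 * pi) ^+ n * (energy P (phi \o U) - normsq (cintegral P (stat f))))%:E)%E.
  rewrite ge0_integral_lattice_spectral//; last by move=> k; rewrite lee_fin normsq_ge0.
  rewrite EFinM; congr (_ * _)%E; rewrite EFinB -pars [X in (X - _)%E]addeC addeK//.
  apply: eq_esum => m _; rewrite coefE; case: eqVneq => [->|m0].
    by rewrite memNset//; apply.
  by rewrite mem_set//; exact/eqP.
have covE : ccovariance P (stat f) (stat f) =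
    (energy P (phi \o U) - normsq (cintegral P (stat f)))%:C.
  by rewrite ccovarianceE// mulcJE rmorphB/= -energyE.
have zero_im (mu : {measure set 'rV[R]_n -> \bar R}) :
    (\int[mu]_k (complex.Im (spectral_product f f k))%:E = 0)%E.
  rewrite integral0_eq// => k _; rewrite spE//.
split.
  split; apply/integrableP; split; try exact/measurable_EFinP.
    rewrite (_ : (\int[_]_k _ = \int[lattice_spectral]_k (normsq (fourier f k))%:E)%E).
      by rewrite int_ns ltry.
    apply: eq_integral => k _.
    by rewrite [X in (`|X|)%E](congr1 (EFin \o @complex.Re R) (spE k)) /= ger0_norm// normsq_ge0.
  rewrite (_ : (\int[_]_k _ = 0)%E) ?ltry//; apply: integral0_eq => k _.
  by rewrite [X in (`|X|)%E](congr1 (EFin \o @complex.Im R) (spE k)) /= normr0.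
rewrite covE; have -> : cintegral lattice_spectral (spectral_product f f) =
    ((2 * pi) ^+ n * (energy P (phi \o U) - normsq (cintegral P (stat f))))%:C.
  rewrite /cintegral /Rintegral zero_im; congr (_ +i* _).
  rewrite -[RHS]/(fine (_%:E)) -int_ns; congr fine; apply: eq_integral => k _.
  by rewrite spE.
rewrite -rmorphM/= mulKf// expf_neq0// mulf_neq0// ?pnatr_eq0//.
by rewrite gt_eqF// pi_gt0.
Qed.

End lattice_spectral_measure.

(** * Polarization: from variances to covariances *)

Section polarization_identity.
Context {R : realType}.
Local Open Scope complex_scope.

(** In contrast to [polarization], the four values are independent of each other: they stand for
    covariances, which are not products. The same multiple of 'i^2 + 1 is added before [field]. *)
Lemma polarization_identity (xx xy yx yy : R[i]) :
  let p (a : R[i]) := xx + a^*%R * xy + (a * yx + a * a^*%R * yy) in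
  xy = 1 / 4%:R * p 1 + (-1) / 4%:R * p (-1) + 'i%C / 4%:R * p 'i%C + (- 'i%C) / 4%:R * p (- 'i%C).
Proof.
move=> p; rewrite /p !rmorphN/= rmorph1 (_ : 'i%C^*%R = - 'i%C :> R[i]); last first.
  by apply/eqP; rewrite eq_complex /= oppr0 !eqxx.
have i2 : 'i%C * 'i%C = -1 :> R[i] by rewrite -expr2 sqr_i.
rewrite -[LHS]addr0 -[X in _ + X](mul0r ((yx - xy) / 2)) -{1}(subrr (-1)) -{1}i2.
by field.
Qed.

Lemma cintegral_combination4 d (T : measurableType d) (mu : {measure set T -> \bar R})
    (h1 h2 h3 h4 : T -> R[i]) (a1 a2 a3 a4 : R[i]) :
  cintegrable mu h1 -> cintegrable mu h2 -> cintegrable mu h3 -> cintegrable mu h4 ->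
  cintegrable mu (fun k => a1 * h1 k + a2 * h2 k + a3 * h3 k + a4 * h4 k) /\
  cintegral mu (fun k => a1 * h1 k + a2 * h2 k + a3 * h3 k + a4 * h4 k) =
  a1 * cintegral mu h1 + a2 * cintegral mu h2 + a3 * cintegral mu h3 + a4 * cintegral mu h4.
Proof.
move=> i1 i2 i3 i4.
have j1 := cintegrableZ a1 i1; have j2 := cintegrableZ a2 i2.
have j3 := cintegrableZ a3 i3; have j4 := cintegrableZ a4 i4.
have j12 := cintegrableD j1 j2; have j123 := cintegrableD j12 j3.
split; first exact: (cintegrableD j123 j4).
rewrite (cintegralD j123 j4) (cintegralD j12 j3) (cintegralD j1 j2).
by rewrite (cintegralZ _ i1) (cintegralZ _ i2) (cintegralZ _ i3) (cintegralZ _ i4).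
Qed.

Lemma ccovariance_combination d (T : measurableType d) (P : probability T R)
    (X Y : T -> R[i]) (a : R[i]) : ess_bounded P X -> ess_bounded P Y ->
  ccovariance P (fun w => X w + a * Y w) (fun w => X w + a * Y w) =
  ccovariance P X X + a^*%R * ccovariance P X Y
    + (a * ccovariance P Y X + a * a^*%R * ccovariance P Y Y).
Proof.
move=> bX bY; have bZ := ess_boundedZ a bY; have bXZ := ess_boundedD bX bZ.
rewrite (ccovarianceDl bX bZ bXZ) (ccovarianceDr bX bZ bX) (ccovarianceDr bX bZ bZ).
rewrite (ccovarianceZr a bY bX) (ccovarianceZl a bY bX) (ccovarianceZr a bY bZ).
by rewrite (ccovarianceZl a bY bY) mulrA [a^*%R * a]mulrC.
Qed.

End polarization_identity.

Section polarized_covariance.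
Context {R : realType} (n : nat) d (Omega : measurableType d) (P : probability Omega R).
Local Open Scope complex_scope.
Implicit Types f g : 'rV[R]_n -> R[i].
Variables (N : Omega -> {measure set 'rV[R]_n -> \bar R})
  (beta : {measure set 'rV[R]_n -> \bar R}) (c : R[i]).
Hypothesis N_finite : forall w, locally_finite (N w).
Local Notation stat f := (fun w => cintegral (N w) f).
Hypothesis stat_bounded : forall f, test_function f -> ess_bounded P (stat f).
Hypothesis quadratic : forall f, test_function f ->
  cintegrable beta (spectral_product f f) /\
  ccovariance P (stat f) (stat f) = c * cintegral beta (spectral_product f f).

Lemma polarized_covariance f g : test_function f -> test_function g ->
  cintegrable beta (spectral_product f g) /\
  ccovariance P (stat f) (stat g) = c * cintegral beta (spectral_product f g).
Proof.
move=> tf tg.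
pose fc (a : R[i]) x := f x + a * g x.
have tfc a : test_function (fc a) by apply: test_functionD => //; exact: test_functionZ.
have spE k : spectral_product f g k =
    1 / 4%:R * spectral_product (fc 1) (fc 1) k + (-1) / 4%:R * spectral_product (fc (-1)) (fc (-1)) k
    + 'i%C / 4%:R * spectral_product (fc 'i%C) (fc 'i%C) k + (- 'i%C) / 4%:R * spectral_product (fc (- 'i%C)) (fc (- 'i%C)) k.
  rewrite [LHS]polarization /spectral_product.
  have fE a : fourier (fc a) k = fourier f k + a * fourier g k.
    rewrite fourierD//; last exact: test_functionZ.
    by rewrite fourierZ.
  by rewrite !fE.
rewrite (funext spE).
have [ic ->] := cintegral_combination4 (1 / 4%:R) (-1 / 4%:R) ('i%C / 4%:R) (- 'i%C / 4%:R)
  (quadratic (tfc 1)).1 (quadratic (tfc (-1))).1 (quadratic (tfc 'i%C)).1 (quadratic (tfc (- 'i%C))).1.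
split; first exact: ic.
have bX := stat_bounded tf; have bY := stat_bounded tg.
have statE a : stat (fc a) = fun w => stat f w + a * stat g w.
  apply/funext => w; rewrite cintegralD ?cintegralZ//.
  - exact: test_cintegrable.
  - exact: test_cintegrable.
  - by apply: cintegrableZ; exact: test_cintegrable.
have covE a : c * cintegral beta (spectral_product (fc a) (fc a)) =
    ccovariance P (stat f) (stat f) + a^*%R * ccovariance P (stat f) (stat g)
    + (a * ccovariance P (stat g) (stat f) + a * a^*%R * ccovariance P (stat g) (stat g)).
  by rewrite -(quadratic (tfc a)).2 statE ccovariance_combination.
have e := polarization_identity (ccovariance P (stat f) (stat f)) (ccovariance P (stat f) (stat g))
  (ccovariance P (stat g) (stat f)) (ccovariance P (stat g) (stat g)).
rewrite {1}e -!covE !mulrDr.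
by congr (_ + _ + _ + _); rewrite mulrCA.
Qed.

End polarized_covariance.

Lemma measurable_mulJ d (T : measurableType d) {R : realType} (X Y : T -> R[i]) :
  measurable_fun setT (@complex.Re R \o X) -> measurable_fun setT (@complex.Im R \o X) ->
  measurable_fun setT (@complex.Re R \o Y) -> measurable_fun setT (@complex.Im R \o Y) ->
  measurable_fun setT (@complex.Re R \o (fun t => X t * (Y t)^*%R)) /\
  measurable_fun setT (@complex.Im R \o (fun t => X t * (Y t)^*%R)).
Proof.
move=> x1 x2 y1 y2; split.
  rewrite (_ : _ \o _ = fun t => complex.Re (X t) * complex.Re (Y t) + complex.Im (X t) * complex.Im (Y t)).
    by apply: measurable_funD; apply: measurable_funM; [exact: x1|exact: y1|exact: x2|exact: y2].
  by apply/funext => t /=; case: (X t) (Y t) => a b [c d'] /=; rewrite mulrN opprK.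
rewrite (_ : _ \o _ = fun t => complex.Im (X t) * complex.Re (Y t) - complex.Re (X t) * complex.Im (Y t)).
  by apply: measurable_funB; apply: measurable_funM; [exact: x2|exact: y1|exact: x1|exact: y2].
by apply/funext => t /=; case: (X t) (Y t) => a b [c d'] /=; rewrite mulrN addrC.
Qed.

(** * Point configurations *)

Section config_measurability.
Context {R : realType} (n : nat).

Lemma measurable_config_ev (A : set 'rV[R]_n) : measurable A ->
  measurable_fun setT (fun mu : config R n => (mu : {measure set _ -> \bar R}) A).
Proof.
move=> mA _ B mB; apply: sub_sigma_algebra; exists A => //.
by exists B => //; rewrite setTI.
Qed.

Lemma measurable_configP d (T : measurableType d) (X : T -> config R n) :
  (forall A, measurable A -> measurable_fun setT (fun w => (X w : {measure set _ -> \bar R}) A)) ->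
  measurable_fun setT X.
Proof.
move=> mX; apply: (@measurability _ _ _ _ setT X
  (\bigcup_(A in measurable) preimage_set_system [set: config R n] (@config_ev R n ^~ A) measurable)) => //.
move=> _ [_ [A mA [B mB <-]] <-]; rewrite setTI.
by rewrite setTI; have := mX A mA measurableT B mB; rewrite setTI.
Qed.

Lemma measurable_image_config (g : {mfun 'rV[R]_n >-> 'rV[R]_n}) :
  measurable_fun setT (image_config g : config R n -> config R n).
Proof.
apply: measurable_configP => A mA.
have mgA : measurable (g @^-1` A) by rewrite -[X in measurable X]setTI; exact: measurable_funP.
exact: (measurable_config_ev mgA).
Qed.

Lemma measurable_config_cintegral (f : 'rV[R]_n -> R[i]) : test_function f ->
  measurable_fun setT (fun mu : config R n => complex.Re (cintegral mu f)) /\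
  measurable_fun setT (fun mu : config R n => complex.Im (cintegral mu f)).
Proof.
move=> [[f1 f2] _ _].
exact: (measurable_cintegral_kernel (l := fun mu : config R n => mu) measurable_config_ev).
Qed.

End config_measurability.

Section equality_in_law.
Context {R : realType} d (Omega : measurableType d) (P : probability Omega R).

Lemma eq_law_Rintegral d' (T : measurableType d') (X Y : Omega -> T) (F : T -> R) :
  measurable_fun setT X -> measurable_fun setT Y -> measurable_fun setT F ->
  eq_law P X Y -> \int[P]_w F (X w) = \int[P]_w F (Y w).
Proof.
move=> mX mY mF XY.
pose Xm : {mfun _ >-> _} := HB.pack X (isMeasurableFun.Build _ _ _ _ X mX).
pose Ym : {mfun _ >-> _} := HB.pack Y (isMeasurableFun.Build _ _ _ _ Y mY).
have mF' : measurable_fun setT (EFin \o F) by exact/measurable_EFinP.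
rewrite /Rintegral; congr fine.
rewrite -[LHS](integral_image Xm P mF') -[RHS](integral_image Ym P mF').
by apply: eq_measure_integral => A mA _; exact: XY.
Qed.

Lemma eq_law_comp d1 d2 (T1 : measurableType d1) (T2 : measurableType d2)
    (X Y : Omega -> T1) (F : T1 -> T2) : measurable_fun setT F ->
  eq_law P X Y -> eq_law P (F \o X) (F \o Y).
Proof.
move=> mF XY A mA; have mFA : measurable (F @^-1` A).
  by rewrite -[X in measurable X]setTI; exact: mF.
exact: (XY _ mFA).
Qed.

Lemma eq_law_cintegral d' (T : measurableType d') (X Y : Omega -> T) (F : T -> R[i]) :
  measurable_fun setT X -> measurable_fun setT Y ->
  measurable_fun setT (@complex.Re R \o F) -> measurable_fun setT (@complex.Im R \o F) ->
  eq_law P X Y -> cintegral P (F \o X) = cintegral P (F \o Y).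
Proof.
move=> mX mY m1 m2 XY; congr Complex.
  exact: (eq_law_Rintegral mX mY m1 XY).
exact: (eq_law_Rintegral mX mY m2 XY).
Qed.

Lemma ae_eq_measure (A B : set Omega) : measurable A -> measurable B ->
  {ae P, forall w, A w <-> B w} -> P A = P B.
Proof.
move=> mA mB AB; rewrite -(setIT A) -(setIT B) -!integral_indic//.
apply: ae_eq_integral => //; [exact/measurable_EFinP/measurable_indic|exact/measurable_EFinP/measurable_indic|].
apply: filterS AB => w [h1 h2] _; rewrite !indicE; congr ((nat_of_bool _)%:R%:E).
by apply/idP/idP; rewrite !inE.
Qed.

End equality_in_law.

Section natural_sums.
Context {R : realType}.

Lemma ereal_sup_natural (S : set (\bar R)) : S !=set0 ->
  (forall x, S x -> exists k : nat, x = k%:R%:E) ->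
  ereal_sup S = +oo%E \/ exists k : nat, ereal_sup S = k%:R%:E.
Proof.
move=> [x0 Sx0] Snat.
have [[N NS]|unb] := pselect (exists N : nat, forall x, S x -> (x <= N%:R%:E)%E); last first.
  left; apply/eqyP => r r0.
  have [x Sx xr] : exists2 x, S x & ((Num.bound r)%:R%:E < x)%E.
    apply: contrapT => h; apply: unb; exists (Num.bound r) => x Sx.
    by rewrite leNgt; apply/negP => xr; apply: h; exists x.
  apply: (@le_trans _ _ x); last exact: ereal_sup_ubound.
  apply: ltW; apply: le_lt_trans xr; rewrite lee_fin ltW//.
  by apply: archi_boundP; exact: ltW.
right; pose Q k := `[< S k%:R%:E >].
have [k0 k0E] := Snat _ Sx0.
have exQ : exists k, Q k by exists k0; apply/asboolP; rewrite -k0E.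
have ubQ k : Q k -> (k <= N)%N by move=> /asboolP /NS; rewrite lee_fin ler_nat.
exists (ex_maxn exQ ubQ); case: ex_maxnP => k /asboolP Sk kmax.
apply/eqP; rewrite eq_le; apply/andP; split; last exact: ereal_sup_ubound.
apply: ge_ereal_sup => x Sx; have [j jE] := Snat _ Sx.
by rewrite jE lee_fin ler_nat; apply: kmax; apply/asboolP; rewrite -jE.
Qed.

(** This is the dichotomy that [point_process] asks of every mass. *)
Lemma esum_natural (Z : choiceType) (a : Z -> nat) :
  let s := (\esum_(z in [set: Z]) ((a z)%:R : R)%:E)%E in
  s = +oo%E \/ exists k : nat, s = k%:R%:E.
Proof.
apply: ereal_sup_natural.
  by exists 0%E; exists set0; [exact: fsets_set0|rewrite fsbig_set0].
move=> _ [A [finA _] <-]; exists (\sum_(z <- finmap.enum_fset (fset_set A)) a z)%N.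
by rewrite fsbig_finite//= sumEFin natr_sum.
Qed.

End natural_sums.

Section atoms.
Context {R : realType} (n : nat) d (T : measurableType d).
Variables (N : T -> config R n) (x : T -> 'rV[R]_n).
Hypothesis N_measurable : forall A, measurable A -> measurable_fun setT (fun w => N w A).
Hypothesis N_finite : forall w, locally_finite (N w).
Hypothesis x_measurable : measurable_fun setT x.

Lemma measurable_graph : measurable [set p : T * 'rV[R]_n | p.2 = x p.1].
Proof.
rewrite (_ : [set p | _] = \bigcap_(i in [set: 'I_n])
   [set p : T * 'rV[R]_n | p.2 ord0 i == x p.1 ord0 i]); last first.
  apply/seteqP; split=> p /=; first by move=> px i _ /=; rewrite px.
  by move=> h; apply/rowP => i; apply/eqP; exact: h.
apply: fin_bigcap_measurable => [|i _]; first exact: finite_finset.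
have m1 : measurable_fun setT (fun p : T * 'rV[R]_n => p.2 ord0 i).
  exact: (measurableT_comp (measurable_coordinate i) measurable_snd).
have m2 : measurable_fun setT (fun p : T * 'rV[R]_n => x p.1 ord0 i).
  apply: (measurableT_comp (measurable_coordinate i)).
  exact: (measurableT_comp x_measurable measurable_fst).
have := measurable_fun_eqr m1 m2 measurableT (Y := [set true]) Logic.I.
by rewrite setTI.
Qed.

(** The point moves with w, so this is no evaluation at a fixed set; it is the mass of a section of
    the graph of x. The intersection with balls keeps the masses finite, and every large ball
    contains the point. *)
Lemma measurable_atom : measurable_fun setT (fun w => N w [set x w]).
Proof.
pose k : R.-ker T ~> 'rV[R]_n :=
  HB.pack (fun w => N w : {measure set _ -> \bar R}) (isKernel.Build _ _ _ _ _ (fun w => N w) N_measurable).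
have mr (j : nat) : measurable_fun setT (fun w => N w ([set x w] `&` eball j%:R)).
  have mB := @measurable_eball R n j%:R.
  have ub w : exists M : R, forall A, measurable A -> (mrestr (k w) mB A < M%:E)%E.
    exists (fine (N w (eball j%:R)) + 1) => A mA; rewrite EFinD fineK; last first.
      by rewrite ge0_fin_numE//; exact: N_finite.
    apply: (@le_lt_trans _ _ (N w (eball j%:R))).
      by apply: le_measure; rewrite ?inE//; exact: measurableI.
    by rewrite lteDl ?lte_fin// ge0_fin_numE//; exact: N_finite.
  have [_] := measurable_prod_subset_xsection_kernel ub measurable_graph.
  congr measurable_fun; apply/funext => w; rewrite /mrestr; congr (N w (_ `&` _)).
  by apply/seteqP; split=> y /=; rewrite /xsection/= inE.
apply: (emeasurable_fun_cvg (fun (j : nat) w => N w ([set x w] `&` eball j%:R))) => // w _.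
apply: cvg_near_cst; exists (Num.bound (enorm (x w))) => // j /= wj.
congr (N w _); apply: setIidl => _ ->.
rewrite /eball /=; apply: (lt_le_trans (archi_boundP (sqrtr_ge0 _))).
by rewrite ler_nat.
Qed.

End atoms.

Section translated_balls.
Context {R : realType} (n : nat).
Implicit Types x : 'rV[R]_n.

Lemma translation_preimage_eball x r : exists r' : R, translation x @^-1` eball r `<=` eball r'.
Proof.
have [r' rP] := @enorm_bounded_coord R n (`|r| + \sum_i `|x ord0 i|).
exists r' => y /= yr; apply: rP => i.
rewrite -[y ord0 i](addrK (x ord0 i)); apply: (le_trans (ler_normB _ _)).
apply: lerD; last by rewrite (bigD1 i)//= lerDl sumr_ge0.
have := norm_coord_le_enorm (translation x y) i; rewrite /translation mxE => /le_trans; apply.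
by apply: le_trans (ler_norm r); exact: ltW.
Qed.

Lemma measurable_translation_preimage x A : measurable A ->
  measurable (translation x @^-1` A).
Proof. by move=> mA; rewrite -[X in measurable X]setTI; exact: measurable_translation. Qed.

Lemma locally_finite_translation x (mu : config R n) : locally_finite mu ->
  locally_finite (image_config (translation x) mu).
Proof.
move=> lf r; have [r' rr'] := translation_preimage_eball x r.
apply: (@le_lt_trans _ _ ((mu : {measure set 'rV[R]_n -> \bar R}) (eball r'))); last exact: lf.
change ((mu : {measure set 'rV[R]_n -> \bar R}) (translation x @^-1` eball r) <= (mu : {measure set 'rV[R]_n -> \bar R}) (eball r'))%E.
apply: le_measure; rewrite ?inE//; last exact: measurable_eball.
by apply: measurable_translation_preimage; exact: measurable_eball.
Qed.

End translated_balls.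

(** * Shifted thinnings *)

Section thinnings.
Context {R : realType} (n : nat) d (Omega : measurableType d) (P : probability Omega R).
Variables (U : Omega -> 'rV[R]_n) (Phi : Omega -> config R n).
Hypothesis U_uniform : uniform_on_cube P U.
Hypothesis Phi_process : point_process Phi.
Local Notation ZZ := [set: 'rV[int]_n].
Local Notation e := (2^-1 *: @unit_e1 R n).
Local Notation L := (stationary_lattice U).
Local Notation Psi := (shifted_lattice U Phi).
Local Notation x w z := (lattice_point (U w) z).
Implicit Types (A : set 'rV[R]_n) (z : 'rV[int]_n).

Let mPhi A : measurable A -> measurable_fun setT (fun w => Phi w A).
Proof.
by move=> mA; have [mP _] := Phi_process; exact: (measurableT_comp (measurable_config_ev mA) mP).
Qed.

Let Phi_finite w : locally_finite (Phi w).
Proof. by move=> r; have [_ /(_ w)[_]] := Phi_process; exact. Qed.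

Let measurable_point z : measurable_fun setT (fun w => x w z).
Proof. by have [mU _] := U_uniform; exact: (measurableT_comp (measurable_lattice_point z) mU). Qed.

Let measurable_Phi_atom z : measurable_fun setT (fun w => Phi w [set x w z]).
Proof. exact: measurable_atom. Qed.

Lemma ind_diracE b (y : 'rV[R]_n) A : ind_dirac b y A = ((b && (y \in A))%:R)%:E.
Proof. by case: b => //=; rewrite diracE. Qed.

(** The counts are kept in [nat], so that integrality of the masses is immediate. *)
Definition shift_count w z A : nat :=
  ((Phi w [set x w z] == 1%E) && (x w z + e \in A)) +
  ((Phi w [set x w z] == 0%E) && (x w z - e \in A)).

Lemma shifted_latticeE w A : Psi w A = (\esum_(z in ZZ) ((shift_count w z A)%:R)%:E)%E.
Proof.
apply: eq_esum => z _.
transitivity (ind_dirac (Phi w [set x w z] == 1%E) (x w z + e) A +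
    ind_dirac (Phi w [set x w z] == 0%E) (x w z - e) A)%E; first exact: measure_addE.
by rewrite !ind_diracE -EFinD -natrD.
Qed.

Lemma shifted_lattice_natural w A : Psi w A = +oo%E \/ exists k : nat, Psi w A = k%:R%:E.
Proof. by rewrite shifted_latticeE; exact: esum_natural. Qed.

(** Each lattice point moves to at most one of two places. The bound holds for every w, also where
    the thinning property fails, and [point_process] asks for local finiteness everywhere. *)
Lemma shifted_lattice_le w A :
  (Psi w A <= L w (translation e @^-1` A) + L w (translation (- e) @^-1` A))%E.
Proof.
rewrite shifted_latticeE [X in (_ <= X + _)%E]lattice_measureE [X in (_ <= _ + X)%E]lattice_measureE.
rewrite -esumD; [|by move=> z _; rewrite lee_fin|by move=> z _; rewrite lee_fin].
apply: le_esum => z _; rewrite -EFinD lee_fin natrD lerD// indicE ler_nat.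
  by rewrite (_ : (_ \in translation e @^-1` A) = (x w z + e \in A))//; case: (_ == _).
by rewrite (_ : (_ \in translation (- e) @^-1` A) = (x w z - e \in A))//; case: (_ == _).
Qed.

Lemma shifted_lattice_eball r : exists M : R, forall w, (Psi w (eball r) <= M%:E)%E.
Proof.
have [r1 r1P] := translation_preimage_eball e r.
have [r2 r2P] := translation_preimage_eball (- e) r.
have [M1 M1P] := @lattice_measure_eball R n r1.
have [M2 M2P] := @lattice_measure_eball R n r2.
exists (M1 + M2) => w; apply: (le_trans (shifted_lattice_le _ _)); rewrite EFinD; apply: leeD.
  apply: le_trans (M1P (U w)); apply: le_measure => //; rewrite inE.
    by apply: measurable_translation_preimage; exact: measurable_eball.
  exact: measurable_eball.
apply: le_trans (M2P (U w)); apply: le_measure => //; rewrite inE.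
  by apply: measurable_translation_preimage; exact: measurable_eball.
exact: measurable_eball.
Qed.

Lemma locally_finite_shifted w : locally_finite (Psi w).
Proof.
by move=> r; have [M MP] := shifted_lattice_eball r; exact: le_lt_trans (MP w) (ltry _).
Qed.

Lemma measurable_shifted_ev A : measurable A -> measurable_fun setT (fun w => Psi w A).
Proof.
move=> mA; under eq_fun do rewrite shifted_latticeE.
apply: (@measurable_esum R) => z; last by move=> w; rewrite lee_fin.
apply/measurable_EFinP.
have mb (c : \bar R) (v : 'rV[R]_n) : measurable
    [set w | (Phi w [set x w z] == c) && (x w z + v \in A)].
  rewrite (_ : [set w | _] = ((fun w => Phi w [set x w z]) @^-1` [set c]) `&`
      ((fun w => x w z) @^-1` (translation v @^-1` A))); last first.
    by apply/seteqP; split=> w /=; [move=> /andP[/eqP -> /set_mem]|move=> [-> /mem_set ->]; rewrite eqxx].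
  apply: measurableI.
    rewrite -[X in measurable X]setTI; exact: measurable_Phi_atom.
  rewrite -[X in measurable X]setTI; apply: measurable_point => //.
  exact: measurable_translation_preimage.
rewrite (_ : (fun w => _) = \1_[set w | (Phi w [set x w z] == 1%E) && (x w z + e \in A)] \+
    \1_[set w | (Phi w [set x w z] == 0%E) && (x w z + (- e) \in A)]).
  by apply: measurable_funD; apply: measurable_indic; exact: mb.
apply/funext => w; rewrite /shift_count natrD /= !indicE; congr (_%:R + _%:R);
  by congr nat_of_bool; apply/idP/idP; rewrite ?inE.
Qed.

Lemma point_process_shifted : point_process Psi.
Proof.
split; first by apply: measurable_configP => A mA; exact: measurable_shifted_ev.
by move=> w; split; [move=> A _; exact: shifted_lattice_natural|exact: locally_finite_shifted].
Qed.

Definition thinned w : Prop :=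
  (forall y, (Phi w [set y] <= 1)%E) /\ Phi w (~` range (lattice_point (U w))) = 0%E.

Lemma lattice_point_inj u : injective (@lattice_point R n u).
Proof.
move=> z z' /addIr zz'; apply/rowP => i.
have := congr1 (fun M : 'rV[R]_n => M ord0 i) zz'; rewrite !mxE => /eqP.
by rewrite eqr_int => /eqP.
Qed.

Lemma thinned_ev w A : thinned w -> measurable A ->
  Phi w A = (\esum_(z in ZZ) (Phi w [set x w z] * (\1_A (x w z))%:E))%E.
Proof.
move=> [_ out] mA.
have mrange := measurable_lattice_range (U w).
have -> : Phi w A = Phi w (A `&` range (lattice_point (U w))).
  rewrite -[in LHS](setIT A) -(setUv (range (lattice_point (U w)))) setIUr measureU//.
  - rewrite [X in (_ + X)%E](_ : _ = 0%E) ?adde0//.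
    apply: subset_measure0 out => //; last exact: measurableC.
    by apply: measurableI => //; exact: measurableC.
  - exact: measurableI.
  - by apply: measurableI => //; exact: measurableC.
  - by rewrite setIACA setICr setI0.
pose F k := oapp (fun z => A `&` [set x w z]) set0 (@pickle_inv 'rV[int]_n k).
have FE : A `&` range (lattice_point (U w)) = \bigcup_k F k.
  apply/seteqP; split=> y.
    by move=> [Ay [z _ zy]]; exists (pickle z) => //; rewrite /F pickleK_inv /= zy.
  move=> [k _]; rewrite /F; case: pickle_inv => [z|]//= [Ay yz]; split => //.
  by exists z.
have mF k : measurable (F k).
  by rewrite /F; case: pickle_inv => //= z; apply: measurableI => //; exact: measurable_rV_set1.
have tF : trivIset setT F.
  move=> i j _ _ [y []]; rewrite /F.
  case Ei : (pickle_inv i) => [z|]//=; case Ej : (pickle_inv j) => [z'|]//= [_ ->] [_ zz'].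
  have := @pickle_invK 'rV[int]_n i; have := @pickle_invK 'rV[int]_n j.
  by rewrite Ei Ej /= => <- <-; rewrite (lattice_point_inj zz').
rewrite FE measure_semi_bigcup//; last by apply: bigcupT_measurable.
rewrite esum_series; last by move=> z; rewrite mule_ge0// lee_fin.
apply: eq_eseriesr => k _; rewrite /F; case: pickle_inv => [z|]/=; last by rewrite measure0.
rewrite indicE; case: (boolP (_ \in A)) => zA.
  by rewrite mule1; congr (Phi w _); apply: setIidr => _ ->; rewrite inE in zA.
rewrite mule0 (_ : A `&` _ = set0) ?measure0//.
by apply/seteqP; split=> // y [Ay yz]; move: zA; rewrite notin_setE; apply; rewrite -yz.
Qed.

Lemma thinned_atom w z : thinned w -> Phi w [set x w z] = 0%E \/ Phi w [set x w z] = 1%E.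
Proof.
move=> [le1 _]; have := le1 (x w z); have [_ /(_ w)[nat_ev _]] := Phi_process.
have [->|[k ->]] := nat_ev _ (measurable_rV_set1 (x w z)); first by [].
by rewrite lee_fin -[1]/(1%:R) ler_nat; case: k => [|[|]]//; [left|right].
Qed.

Lemma thinned_le w A : thinned w -> measurable A -> (Phi w A <= L w A)%E.
Proof.
move=> tw mA; rewrite (thinned_ev tw mA) [leRHS]lattice_measureE; apply: le_esum => z _.
by have [->|->] := thinned_atom z tw; rewrite ?mul0e ?mul1e// lee_fin.
Qed.

(* Measures cannot be subtracted, so the identity
   Psi = (Phi shifted by e) + (lattice minus Phi, shifted by -e) is stated additively. *)
Definition shift_relation (psi phi lat : config R n) : Prop :=
  [/\ locally_finite psi, locally_finite phi, locally_finite lat &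
   forall A, measurable A ->
     (psi A + phi (translation (- e) @^-1` A) =
      phi (translation e @^-1` A) + lat (translation (- e) @^-1` A))%E].

(** Verified at each lattice point x separately: a retained point puts x + e into Psi while its x -
    e occurs once on each side, and a removed point puts x - e into Psi and into the shifted
    lattice. *)
Lemma shifted_lattice_relation w : thinned w -> shift_relation (Psi w) (Phi w) (L w).
Proof.
move=> tw; split; [exact: locally_finite_shifted|exact: Phi_finite|exact: locally_finite_lattice|].
move=> A mA.
have mAe v : measurable (translation v @^-1` A) by exact: measurable_translation_preimage.
rewrite shifted_latticeE !(thinned_ev tw)// [X in (_ = _ + X)%E]lattice_measureE.
rewrite -!esumD; try by move=> z _; rewrite ?mule_ge0// lee_fin.
apply: eq_esum => z _; rewrite /shift_count !indicE.
rewrite (_ : (_ \in translation e @^-1` A) = (x w z + e \in A))//.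
rewrite (_ : (_ \in translation (- e) @^-1` A) = (x w z - e \in A))//.
have n01 : (0 == 1 :> \bar R)%E = false by rewrite eqe eq_sym oner_eq0.
have n10 : (1 == 0 :> \bar R)%E = false by rewrite eqe oner_eq0.
have [->|->] := thinned_atom z tw; rewrite eqxx ?n01 ?n10 /= ?mul0e ?mul1e ?add0e ?adde0 ?addn0 ?add0n//.
Qed.

Lemma shift_relation_translation y psi phi lat : shift_relation psi phi lat ->
  shift_relation (image_config (translation y) psi) (image_config (translation y) phi)
    (image_config (translation y) lat).
Proof.
move=> [l1 l2 l3 rel]; split; try exact: locally_finite_translation.
move=> A mA; have := rel _ (measurable_translation_preimage y mA).
have comm v : translation v @^-1` (translation y @^-1` A) =
    translation y @^-1` (translation v @^-1` A).
  by apply/seteqP; split=> t; rewrite /= /translation addrAC.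
by rewrite !comm.
Qed.

End thinnings.

(** * Recovering Psi from Phi and the lattice *)

Section shift_relation_measurability.
Context {R : realType} (n : nat).
Local Notation e := (2^-1 *: @unit_e1 R n).
Local Open Scope ereal_scope.
Implicit Types (psi phi lat : config R n) (B : set 'rV[R]_n).

(* Subtraction is only meaningful where the masses are finite, hence the balls. *)
Definition shift_approx B (m : nat) (p : config R n * config R n) : \bar R :=
  p.1 (translation e @^-1` (B `&` eball m%:R)) + p.2 (translation (- e) @^-1` (B `&` eball m%:R))
  - p.1 (translation (- e) @^-1` (B `&` eball m%:R)).

Lemma measurable_shift_approx B m : measurable B -> measurable_fun setT (shift_approx B m).
Proof.
move=> mB; have mBm : measurable (B `&` eball m%:R).
  by apply: measurableI => //; exact: measurable_eball.
have mT v := measurable_translation_preimage v mBm.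
apply: emeasurable_funB; first apply: emeasurable_funD.
- exact: (measurableT_comp (measurable_config_ev (mT e)) measurable_fst).
- exact: (measurableT_comp (measurable_config_ev (mT (- e)%R)) measurable_snd).
- exact: (measurableT_comp (measurable_config_ev (mT (- e)%R)) measurable_fst).
Qed.

(** The limit superior is a measurable function on all pairs of configurations, including pairs
    outside the relation, where the sequence need not converge. *)
Lemma shift_relation_ev psi phi lat B : measurable B -> shift_relation psi phi lat ->
  psi B = limn_esup (fun m => shift_approx B m (phi, lat)).
Proof.
move=> mB [lpsi lphi llat rel].
have mBm (m : nat) : measurable (B `&` eball m%:R).
  by apply: measurableI => //; exact: measurable_eball.
have -> : (fun m => shift_approx B m (phi, lat)) = (fun m : nat => psi (B `&` eball m%:R)).
  apply/funext => m; rewrite /shift_approx /= -rel// addeK//.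
  rewrite ge0_fin_numE//.
  apply: (le_lt_trans _ (locally_finite_translation (- e)%R lphi m%:R)).
  change (phi (translation (- e) @^-1` (B `&` eball m%:R)) <= phi (translation (- e) @^-1` eball m%:R)).
  apply: le_measure; rewrite ?inE; [exact: measurable_translation_preimage| |by move=> y []].
  by apply: measurable_translation_preimage; exact: measurable_eball.
have cv : (fun m : nat => psi (B `&` eball m%:R)) @ \oo --> psi B.
  rewrite -[X in _ --> psi X](_ : \bigcup_m (B `&` eball m%:R) = B).
    apply: nondecreasing_cvg_mu => //; first exact: bigcupT_measurable.
    move=> i j ij; apply/subsetPset => y [By yi]; split => //.
    by apply: lt_le_trans yi _; rewrite ler_nat.
  rewrite -setI_bigcupr; apply: setIidl => y _.
  by exists (Num.bound (enorm y)) => //=; apply: archi_boundP; exact: sqrtr_ge0.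
by rewrite is_cvg_limn_esupE; [apply/esym/cvg_lim|apply/cvg_ex; exists (psi B)].
Qed.

(** On the relation psi is a function of the pair. This is expressed through events and not through
    a map, since off the relation the difference of masses need not be a measure. The events that
    can be so translated form a sigma-algebra containing the generators. *)
Lemma shift_relation_measurable (A : set (config R n)) : measurable A ->
  exists2 A' : set (config R n * config R n), measurable A' &
    forall psi phi lat, shift_relation psi phi lat -> (A psi <-> A' (phi, lat)).
Proof.
pose S := [set A : set (config R n) |
  exists2 A' : set (config R n * config R n), measurable A' &
    forall psi phi lat, shift_relation psi phi lat -> (A psi <-> A' (phi, lat))].
suff : measurable `<=` S by apply.
apply: smallest_sub; first split.
- by exists set0.
- move=> B [B' mB' BB']; exists (~` B'); first exact: measurableC.
  by move=> psi phi lat /BB' h; rewrite setTD; split=> /= hn /h.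
- move=> F SF.
  have [F' F'P] := choice (fun i => let: ex_intro2 A' h1 h2 := SF i in ex_intro _ A' (conj h1 h2)).
  exists (\bigcup_i F' i); first by apply: bigcupT_measurable => i; case: (F'P i).
  move=> psi phi lat rel; split=> -[i _ Fi]; exists i => //.
    by apply/((F'P i).2 _ _ _ rel).
  by apply/((F'P i).2 _ _ _ rel).
move=> _ [B mB [C mC <-]].
exists ((fun p => limn_esup (fun m => shift_approx B m p)) @^-1` C).
  rewrite -[X in measurable X]setTI.
  by apply: measurable_fun_limn_esup => // m; exact: measurable_shift_approx.
by move=> psi phi lat rel; rewrite setTI /= /config_ev (shift_relation_ev mB rel).
Qed.

End shift_relation_measurability.

(** * Stationarity and linear statistics of the shifted thinning *)

Section stationarity.
Context {R : realType} (n : nat) d (Omega : measurableType d) (P : probability Omega R).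
Variables (U : Omega -> 'rV[R]_n) (Phi : Omega -> config R n).
Hypothesis U_uniform : uniform_on_cube P U.
Hypothesis Phi_thinning : stationary_thinning P U Phi.
Local Notation e := (2^-1 *: @unit_e1 R n).
Local Notation L := (stationary_lattice U).
Local Notation Psi := (shifted_lattice U Phi).

Let Phi_process : point_process Phi.
Proof. by case: Phi_thinning. Qed.

Lemma ae_thinned : {ae P, forall w, thinned U Phi w}.
Proof. by have [_ h1 h2 _] := Phi_thinning; apply: filterS2 h1 h2 => w; split. Qed.

Lemma measurable_stationary_lattice : measurable_fun setT L.
Proof.
have [mU _] := U_uniform; apply: measurable_configP => A mA.
exact: (measurableT_comp (measurable_lattice_measure mA) mU).
Qed.

Lemma measurable_Phi : measurable_fun setT Phi.
Proof. by case: Phi_process. Qed.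

(** Translations preserve the relation between Psi, Phi and the lattice. Up to null sets an event of
    the translated Psi is thus an event of the translated pair, to which joint stationarity
    applies. *)
Lemma stationary_shifted : stationary P Psi.
Proof.
move=> y A mA; have [A' mA' AA'] := shift_relation_measurable mA.
have [mPsi _] := point_process_shifted U_uniform Phi_process.
pose W w := (Phi w, L w).
pose Wy w := (image_config (translation y) (Phi w), image_config (translation y) (L w)).
have mW : measurable_fun setT W.
  by apply: measurable_fun_pair; [exact: measurable_Phi|exact: measurable_stationary_lattice].
have mWy : measurable_fun setT Wy.
  apply: measurable_fun_pair.
    exact: (measurableT_comp (measurable_image_config _) measurable_Phi).
  exact: (measurableT_comp (measurable_image_config _) measurable_stationary_lattice).
have m1 : measurable ((fun w => image_config (translation y) (Psi w)) @^-1` A).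
  rewrite -[X in measurable X]setTI.
  exact: (measurableT_comp (measurable_image_config _) mPsi).
have m2 : measurable (Psi @^-1` A) by rewrite -[X in measurable X]setTI; exact: mPsi.
have m3 : measurable (W @^-1` A') by rewrite -[X in measurable X]setTI; exact: mW.
have m4 : measurable (Wy @^-1` A') by rewrite -[X in measurable X]setTI; exact: mWy.
transitivity (P (Wy @^-1` A')).
  apply: ae_eq_measure => //; apply: filterS ae_thinned => w tw.
  have rel := shifted_lattice_relation Phi_process tw.
  exact: (AA' _ _ _ (shift_relation_translation y rel)).
transitivity (P (W @^-1` A')).
  by have [_ _ _ js] := Phi_thinning; exact: js.
apply: ae_eq_measure => //; apply: filterS ae_thinned => w tw.
have rel := shifted_lattice_relation Phi_process tw.
by have [h1 h2] := AA' _ _ _ rel; split.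
Qed.

Lemma second_moment_shifted : (\int[P]_w (Psi w (eball 1) ^+ 2) < +oo)%E.
Proof.
have [M MP] := shifted_lattice_eball U Phi 1.
have mb := measurable_shifted_ev U_uniform Phi_process (@measurable_eball R n 1).
apply: (@le_lt_trans _ _ (\int[P]_w (cst (M%:E * M%:E)%E w))%E).
  apply: ge0_le_integral => //.
  - by move=> w _; rewrite expe2 mule_ge0.
  - by under eq_fun do rewrite expe2; exact: emeasurable_funM.
  - by move=> w _; rewrite expe2 lee_pmul.
by rewrite integral_cst// [X in (_ * X)%E]probability_setT mule1 -EFinM ltry.
Qed.

Implicit Types f g : 'rV[R]_n -> R[i].
Local Notation PhiS f := (fun w => cintegral (Phi w) f).
Local Notation LS f := (fun w => cintegral (L w) f).
Local Notation PsiS f := (fun w => cintegral (Psi w) f).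

Lemma ess_bounded_Phi f : test_function f -> ess_bounded P (PhiS f).
Proof.
move=> tf; have [m1 m2] := measurable_config_cintegral tf.
split; [exact: (measurableT_comp m1 measurable_Phi)|exact: (measurableT_comp m2 measurable_Phi)|].
have [r [M MP]] := test_cintegral_bound tf.
have [C CP] := @lattice_measure_eball R n r.
exists (M * C); apply: filterS ae_thinned => w tw; apply: MP.
  by move=> r'; have [_ /(_ w)[_]] := Phi_process; exact.
by apply: le_trans (CP (U w)); apply: thinned_le => //; exact: measurable_eball.
Qed.

Lemma ess_bounded_L f : test_function f -> ess_bounded P (LS f).
Proof. exact: ess_bounded_lattice. Qed.

Lemma ess_bounded_Psi f : test_function f -> ess_bounded P (PsiS f).
Proof.
move=> tf; have [m1 m2] := measurable_config_cintegral tf.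
have [mPsi _] := point_process_shifted U_uniform Phi_process.
split; [exact: (measurableT_comp m1 mPsi)|exact: (measurableT_comp m2 mPsi)|].
have [r [M MP]] := test_cintegral_bound tf.
have [C CP] := shifted_lattice_eball U Phi r.
by exists (M * C); apply: nearW => w; apply: MP => //; exact: locally_finite_shifted.
Qed.

Lemma cintegral_measure_add (m1 m2 : {measure set 'rV[R]_n -> \bar R}) f :
  cintegrable m1 f -> cintegrable m2 f ->
  cintegral (measure_add m1 m2) f = cintegral m1 f + cintegral m2 f.
Proof.
move=> [i1 j1] [i2 j2].
have main (h : 'rV[R]_n -> R) : m1.-integrable setT (EFin \o h) -> m2.-integrable setT (EFin \o h) ->
    \int[measure_add m1 m2]_x h x = \int[m1]_x h x + \int[m2]_x h x.
  move=> h1 h2; have /integrableP[mh _] := h1.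
  rewrite /Rintegral (integral_measure_add measurableT h1 h2).
  by rewrite fineD//; [exact: (integrable_fin_num measurableT h1)|exact: (integrable_fin_num measurableT h2)].
by rewrite /cintegral !main.
Qed.

Lemma cintegrable_measure_add (m1 m2 : {measure set 'rV[R]_n -> \bar R}) f :
  cintegrable m1 f -> cintegrable m2 f -> cintegrable (measure_add m1 m2) f.
Proof.
have main (h : 'rV[R]_n -> \bar R) : m1.-integrable setT h -> m2.-integrable setT h ->
    (measure_add m1 m2).-integrable setT h.
  move=> /integrableP[mh h1] /integrableP[_ h2]; apply/integrableP; split=> //.
  rewrite ge0_integral_measure_add//; first exact: lte_add_pinfty.
  exact: measurableT_comp.
by move=> [i1 j1] [i2 j2]; split; exact: main.
Qed.

Definition increment f (y : 'rV[R]_n) : R[i] :=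
  (f \o translation e) y + (-1) * (f \o translation (- e)) y.

Lemma test_increment f : test_function f -> test_function (increment f).
Proof.
move=> tf; apply: test_functionD; first exact: test_function_translation.
by apply: test_functionZ; exact: test_function_translation.
Qed.

(** The additive relation is integrated as it stands, and the shifted copy of phi is subtracted only
    afterwards, among complex numbers. *)
Lemma cintegral_shift_relation (psi phi lat : config R n) f : test_function f ->
  shift_relation psi phi lat ->
  cintegral psi f = cintegral phi (increment f) + cintegral lat (f \o translation (- e)).
Proof.
move=> tf [lpsi lphi llat rel].
have tp := test_function_translation e tf; have tm := test_function_translation (- e) tf.
have [[m1 m2] _ _] := tf.
pose mphi : {measure set 'rV[R]_n -> \bar R} := image_measure (translation (- e)) phi.
pose pphi : {measure set 'rV[R]_n -> \bar R} := image_measure (translation e) phi.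
pose mlat : {measure set 'rV[R]_n -> \bar R} := image_measure (translation (- e)) lat.
have lf1 : locally_finite mphi := locally_finite_translation (- e) lphi.
have lf2 : locally_finite pphi := locally_finite_translation e lphi.
have lf3 : locally_finite mlat := locally_finite_translation (- e) llat.
have : cintegral (measure_add psi mphi) f = cintegral (measure_add pphi mlat) f.
  apply: eq_measure_cintegral => A mA.
  have h1 := measure_addE psi mphi A; have h2 := measure_addE pphi mlat A.
  exact: (etrans (etrans h1 (rel A mA)) (esym h2)).
rewrite !cintegral_measure_add; try exact: test_cintegrable.
rewrite !cintegral_image// => h.
rewrite cintegralD; last 2 first.
- exact: test_cintegrable.
- by apply: cintegrableZ; exact: test_cintegrable.
rewrite cintegralZ; last exact: test_cintegrable.
by rewrite mulN1r addrAC -h addrK.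
Qed.

Lemma ae_shifted_statistic f : test_function f ->
  {ae P, forall w, cintegral (Psi w) f =
    cintegral (Phi w) (increment f) + cintegral (L w) (f \o translation (- e))}.
Proof.
move=> tf; apply: filterS ae_thinned => w tw.
by apply: cintegral_shift_relation => //; exact: shifted_lattice_relation.
Qed.

Lemma lattice_statistic_periodic u f : test_function f ->
  cintegral (@lattice_measure R n u) (f \o translation (@unit_e1 R n)) = cintegral (lattice_measure u) f.
Proof.
move=> [[m1 m2] _ _]; rewrite -cintegral_image//; apply: eq_measure_cintegral => A mA.
pose z1 : 'rV[int]_n := \row_i (val i == 0%N)%:R.
have z1E : map_mx intr z1 = @unit_e1 R n by apply/rowP => i; rewrite !mxE; case: eqP.
transitivity (lattice_measure u (translation (@unit_e1 R n) @^-1` A)) => //.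
rewrite !lattice_measureE.
rewrite [RHS](reindex_esum [set: 'rV[int]_n] _ (fun z => z + z1)); last first.
  split=> //; first by move=> x y _ _ /addIr.
  by move=> z _; exists (z - z1) => //; rewrite subrK.
apply: eq_esum => z _; rewrite !indicE; congr ((nat_of_bool _)%:R%:E).
suff -> : lattice_point u (z + z1) = translation (@unit_e1 R n) (lattice_point u z) by [].
by rewrite /lattice_point /translation map_mxD z1E addrAC.
Qed.

Lemma half_steps f : (f \o translation (- e)) \o translation (@unit_e1 R n) = f \o translation e.
Proof.
apply/funext => y /=; rewrite /translation -addrA; congr (f (_ + _)).
by apply/rowP => i; rewrite !mxE; lra.
Qed.

Lemma joint_period f g : test_function f -> test_function g ->
  cintegral P (fun w => cintegral (Phi w) (f \o translation (@unit_e1 R n)) * (cintegral (L w) g)^*%R) =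
  cintegral P (fun w => cintegral (Phi w) f * (cintegral (L w) g)^*%R).
Proof.
move=> tf tg; have [_ _ _ js] := Phi_thinning.
have [[f1 f2] _ _] := tf; have [[g1 g2] _ _] := tg.
pose F (p : config R n * config R n) := cintegral p.1 f * (cintegral p.2 g)^*%R.
have [mf1 mf2] := measurable_config_cintegral tf; have [mg1 mg2] := measurable_config_cintegral tg.
have mfst (h : config R n -> R) : measurable_fun setT h ->
  measurable_fun setT (fun p : config R n * config R n => h p.1).
  by move=> mh; exact: (measurableT_comp mh measurable_fst).
have msnd (h : config R n -> R) : measurable_fun setT h ->
  measurable_fun setT (fun p : config R n * config R n => h p.2).
  by move=> mh; exact: (measurableT_comp mh measurable_snd).
have [mF1 mF2] := measurable_mulJ (X := fun p : config R n * config R n => cintegral p.1 f)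
  (Y := fun p => cintegral p.2 g) (mfst _ mf1) (mfst _ mf2) (msnd _ mg1) (msnd _ mg2).
have mW : measurable_fun setT (fun w => (Phi w, L w)).
  by apply: measurable_fun_pair; [exact: measurable_Phi|exact: measurable_stationary_lattice].
have mWy : measurable_fun setT (fun w => (image_config (translation (@unit_e1 R n)) (Phi w),
    image_config (translation (@unit_e1 R n)) (L w))).
  apply: measurable_fun_pair.
    exact: (measurableT_comp (measurable_image_config _) measurable_Phi).
  exact: (measurableT_comp (measurable_image_config _) measurable_stationary_lattice).
rewrite -[RHS](eq_law_cintegral mWy mW mF1 mF2 (js (@unit_e1 R n))).
congr cintegral; apply/funext => w; rewrite /F /= /image_config !cintegral_image//.
by congr (_ * _^*%R); exact: (esym (lattice_statistic_periodic (U w) tg)).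
Qed.

End stationarity.

(** * Covariances and Bartlett measure of the shifted thinning *)

Section covariances.
Context {R : realType} (n : nat) d (Omega : measurableType d) (P : probability Omega R).
Variables (U : Omega -> 'rV[R]_n) (Phi : Omega -> config R n).
Hypothesis U_uniform : uniform_on_cube P U.
Hypothesis Phi_thinning : stationary_thinning P U Phi.
Local Notation e := (2^-1 *: @unit_e1 R n).
Local Notation L := (stationary_lattice U).
Local Notation Psi := (shifted_lattice U Phi).
Local Notation PhiS f := (fun w => cintegral (Phi w) f).
Local Notation LS f := (fun w => cintegral (L w) f).
Local Notation PsiS f := (fun w => cintegral (Psi w) f).
Implicit Types f g : 'rV[R]_n -> R[i].

Let bPhi f (tf : test_function f) := ess_bounded_Phi Phi_thinning tf.
Let bL f (tf : test_function f) := ess_bounded_L U_uniform tf.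
Let bPsi f (tf : test_function f) := ess_bounded_Psi U_uniform Phi_thinning tf.

Lemma mean_period f : test_function f ->
  cintegral P (PhiS (f \o translation (@unit_e1 R n))) = cintegral P (PhiS f).
Proof.
move=> tf; have [Phi_process _ _ js] := Phi_thinning.
have [[f1 f2] _ _] := tf; have [mf1 mf2] := measurable_config_cintegral tf.
have mPhi := measurable_Phi Phi_thinning.
have mPhi1 := measurableT_comp (measurable_image_config (translation (@unit_e1 R n))) mPhi.
have law := eq_law_comp (F := fst) measurable_fst (js (@unit_e1 R n)).
rewrite -(eq_law_cintegral mPhi1 mPhi mf1 mf2 law).
by congr cintegral; apply/funext => w; rewrite /= /image_config cintegral_image.
Qed.

Lemma covariance_period f g : test_function f -> test_function g ->
  ccovariance P (PhiS (f \o translation (@unit_e1 R n))) (LS g) = ccovariance P (PhiS f) (LS g).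
Proof.
move=> tf tg; have tf1 := test_function_translation (@unit_e1 R n) tf.
rewrite (ccovarianceE (bPhi tf1) (bL tg)) (ccovarianceE (bPhi tf) (bL tg)).
by rewrite (joint_period U_uniform Phi_thinning tf tg) (mean_period tf).
Qed.

Lemma Phi_increment f : test_function f -> PhiS (increment f) =
  fun w => cintegral (Phi w) (f \o translation e) + (-1) * cintegral (Phi w) (f \o translation (- e)).
Proof.
move=> tf; apply/funext => w; have tp := test_function_translation e tf.
have tm := test_function_translation (- e) tf.
have lf : locally_finite (Phi w).
  by have [[_ /(_ w)[_ lf]] _ _ _] := Phi_thinning.
have i1 := test_cintegrable lf tp; have i2 := test_cintegrable lf tm.
by rewrite -(cintegralZ _ i2) -(cintegralD i1 (cintegrableZ _ i2)).
Qed.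

(* Both halves of the increment differ by the lattice vector e_1, which fixes the lattice. *)
Lemma increment_uncorrelated f g : test_function f -> test_function g ->
  ccovariance P (PhiS (increment f)) (LS g) = 0.
Proof.
move=> tf tg; have tp := test_function_translation e tf.
have tm := test_function_translation (- e) tf.
have bm := bPhi tm.
rewrite Phi_increment// (ccovarianceDl (bPhi tp) (ess_boundedZ _ bm) (bL tg)).
rewrite (ccovarianceZl _ bm (bL tg)) -half_steps (covariance_period tm tg).
by rewrite mulN1r subrr.
Qed.

Lemma covariance_shifted f g : test_function f -> test_function g ->
  ccovariance P (PsiS f) (PsiS g) =
  ccovariance P (PhiS (increment f)) (PhiS (increment g)) +
  ccovariance P (LS (f \o translation (- e))) (LS (g \o translation (- e))).
Proof.
move=> tf tg; have tf' := test_increment tf; have tg' := test_increment tg.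
have tfm := test_function_translation (- e) tf; have tgm := test_function_translation (- e) tg.
have bf := ess_boundedD (bPhi tf') (bL tfm); have bg := ess_boundedD (bPhi tg') (bL tgm).
rewrite (ae_eq_ccovariance (bPsi tf) (bPsi tg) bf bg
  (ae_shifted_statistic Phi_thinning tf) (ae_shifted_statistic Phi_thinning tg)).
rewrite (ccovarianceDl (bPhi tf') (bL tfm) bg).
rewrite (ccovarianceDr (bPhi tg') (bL tgm) (bPhi tf')) (ccovarianceDr (bPhi tg') (bL tgm) (bL tfm)).
have z : ccovariance P (LS (f \o translation (- e))) (PhiS (increment g)) = 0.
  by rewrite (ccovarianceC (bPhi tg') (bL tfm)) (increment_uncorrelated tg tfm) rmorph0.
by rewrite [X in _ + X + _ = _](increment_uncorrelated tf tgm) [X in _ + (X + _) = _]z addr0 add0r.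
Qed.

Local Open Scope complex_scope.

Lemma fourier_increment f k : test_function f ->
  fourier (increment f) k = (expi (inner k e) - (expi (inner k e))^*%R) * fourier f k.
Proof.
move=> tf; have tp := test_function_translation e tf.
have tm := test_function_translation (- e) tf.
rewrite (fourierD _ tp (test_functionZ _ tm)) (fourierZ _ _ tm) !fourier_translation//.
by rewrite innerNr expiN; ring.
Qed.

(** The factor is the squared modulus of exp(i t) - exp(-i t) = 2 i sin t with t = <k, e>. *)
Lemma spectral_increment f g k : test_function f -> test_function g ->
  spectral_product (increment f) (increment g) k =
  ((2 * sin (inner k e)) ^+ 2)%:C * spectral_product f g k.
Proof.
move=> tf tg; rewrite /spectral_product !fourier_increment// rmorphM/=.
set z := expi _ - _; rewrite mulrACA; congr (_ * _).
rewrite mulcJ; congr (_ %:C); rewrite /z /expi -[_^*%R]/(conjc _) /=; ring.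
Qed.

Lemma spectral_translation x f g k : test_function f -> test_function g ->
  spectral_product (f \o translation x) (g \o translation x) k = spectral_product f g k.
Proof.
move=> tf tg; rewrite /spectral_product !fourier_translation// rmorphM/=.
by rewrite mulrACA expiMJ mul1r.
Qed.

Variable beta : {measure set 'rV[R]_n -> \bar R}.
Hypothesis beta_bartlett : bartlett_measure P Phi beta.

(** Measurability of products of Fourier transforms is read off from the Bartlett measure of Phi,
    whose definition includes their integrability. *)
Lemma measurable_spectral_product f g : test_function f -> test_function g ->
  measurable_fun setT (@complex.Re R \o spectral_product f g) /\
  measurable_fun setT (@complex.Im R \o spectral_product f g).
Proof.
move=> tf tg; have [_ _ _ _ /(_ f g tf tg)/=[[i1 i2] _]] := beta_bartlett.
have /integrableP[/measurable_EFinP m1 _] := i1; have /integrableP[/measurable_EFinP m2 _] := i2.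
by split; [exact: m1|exact: m2].
Qed.

Lemma lattice_covariance f g : test_function f -> test_function g ->
  cintegrable (@lattice_spectral R n) (spectral_product f g) /\
  ccovariance P (LS f) (LS g) =
    ((2 * pi) ^- n)%:C * cintegral (@lattice_spectral R n) (spectral_product f g).
Proof.
apply: (polarized_covariance (N := L)).
- by move=> w; exact: locally_finite_lattice.
- exact: bL.
- by move=> h th; exact: (lattice_spectral_quadratic U_uniform measurable_spectral_product th).
Qed.

Let weight_fun (k : 'rV[R]_n) := (2 * sin (inner k e)) ^+ 2.

Let measurable_weight : measurable_fun setT weight_fun.
Proof.
apply: (@measurable_funX _ _ R setT (fun k : 'rV[R]_n => 2 * sin (inner k e)) 2).
apply: measurable_funM; first exact: measurable_cst.
apply: measurableT_comp; last exact: measurable_inner.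
by apply: continuous_measurable_fun; exact: continuous_sin.
Qed.

Definition sine_weight : {mfun 'rV[R]_n >-> R} :=
  HB.pack weight_fun (isMeasurableFun.Build _ _ _ _ weight_fun measurable_weight).

Lemma sine_weightE k : sine_weight k = (2 * sin (inner k e)) ^+ 2.
Proof. by []. Qed.

Lemma sine_weight_ge0 k : 0 <= sine_weight k.
Proof. exact: sqr_ge0. Qed.

Lemma sine_weight_le4 k : sine_weight k <= 4.
Proof.
rewrite sine_weightE; have := sin_geN1 (inner k e); have := sin_le1 (inner k e).
set t := sin _; nra.
Qed.

Definition shifted_spectral : {measure set 'rV[R]_n -> \bar R} :=
  measure_add (density sine_weight beta) (@lattice_spectral R n).

Lemma shifted_spectralE A : shifted_spectral A = (density sine_weight beta A + @lattice_spectral R n A)%E.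
Proof. exact: measure_addE. Qed.

Lemma locally_finite_density_sine : locally_finite (density sine_weight beta).
Proof.
move=> r; have [_ _ _ lf _] := beta_bartlett.
rewrite /= /density; apply: (@le_lt_trans _ _ (\int[beta]_(k in eball r) (cst 4%:E k))%E).
  apply: ge0_le_integral => //.
  - exact: measurable_eball.
  - by apply: measurable_funTS; exact: measurable_density_fun.
  - by move=> k _; rewrite /= lee_fin ger0_norm ?sine_weight_ge0// sine_weight_le4.
rewrite integral_cst; last exact: measurable_eball.
by rewrite lte_mul_pinfty.
Qed.

Lemma bartlett_shifted : bartlett_measure P Psi shifted_spectral.
Proof.
have [Phi_process _ _ lf phi_cov] := beta_bartlett.
split.
- exact: (point_process_shifted U_uniform Phi_process).
- exact: (stationary_shifted U_uniform Phi_thinning).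
- exact: (second_moment_shifted U_uniform Phi_thinning).
- move=> r; rewrite shifted_spectralE; apply: lte_add_pinfty.
    exact: locally_finite_density_sine.
  exact: locally_finite_lattice_spectral.
move=> f g tf tg h; rewrite -/(spectral_product f g) in h *.
have tf' := test_increment tf; have tg' := test_increment tg.
have tfm := test_function_translation (- e) tf; have tgm := test_function_translation (- e) tg.
have [m1 m2] := measurable_spectral_product tf tg.
have [il cl] := lattice_covariance tfm tgm.
have [ip cp] := phi_cov _ _ tf' tg'.
have spE : spectral_product (increment f) (increment g) =
    fun k => (sine_weight k)%:C * spectral_product f g k.
  by apply/funext => k; rewrite spectral_increment.
(* Both functions are translated by the same vector, so their phases are conjugate and cancel; the
   lattice part keeps its spectral measure. *)
have slE : spectral_product (f \o translation (- e)) (g \o translation (- e)) = spectral_product f g.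
  by apply/funext => k; rewrite spectral_translation.
rewrite slE in il cl.
have id : cintegrable (density sine_weight beta) (spectral_product f g).
  apply/(cintegrable_density _ _ m1 m2); first exact: sine_weight_ge0.
  by rewrite -spE; exact: ip.
split; first exact: cintegrable_measure_add.
have E := cintegral_measure_add id il.
rewrite (cintegral_density beta sine_weight_ge0 m1 m2) -spE in E.
by rewrite covariance_shifted// cl cp -mulrDr; congr (_ * _); exact: (esym E).
Qed.

End covariances.

(** * Second moments near the origin *)

Section moments.
Context {R : realType} (n : nat).
Implicit Types (beta : {measure set 'rV[R]_n -> \bar R}) (k : 'rV[R]_n).

Definition moment beta i r : \bar R := (\int[beta]_(k in eball r) ((k ord0 i) ^+ 2)%:E)%E.

Lemma measurable_coord_sqr i : measurable_fun setT (fun k => ((k ord0 i) ^+ 2)%:E).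
Proof.
apply/measurable_EFinP; apply: (@measurable_funX _ _ R setT (fun k => k ord0 i) 2).
exact: (@measurable_coordinate R n i).
Qed.

Lemma enorm_sqr k : enorm k ^+ 2 = \sum_i k ord0 i ^+ 2.
Proof. by rewrite sqr_sqrtr// sumr_ge0// => i _; exact: sqr_ge0. Qed.

Lemma eball_le r r' : r <= r' -> @eball R n r `<=` eball r'.
Proof. by move=> rr' k kr; exact: lt_le_trans rr'. Qed.

Lemma enorm_coord_perm (s : {perm 'I_n}) k : enorm (coord_perm s k) = enorm k.
Proof.
rewrite /enorm [in RHS](reindex_inj (@perm_inj _ s))/=.
by congr Num.sqrt; apply: eq_bigr => i _; rewrite mxE.
Qed.

(* Chebyshev's inequality on the shell between the radii r and r'. *)
Lemma shell_moment_bound beta r r' : 0 < r -> r <= r' ->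
  (beta (eball r') <= beta (eball r) + (r ^- 2)%:E * \sum_i moment beta i r')%E.
Proof.
move=> r0 rr'; have mr := @measurable_eball R n r; have mr' := @measurable_eball R n r'.
rewrite -ge0_integral_sum//; last first.
- by move=> i k _; rewrite lee_fin sqr_ge0.
- by move=> i; apply: measurable_funTS; exact: measurable_coord_sqr.
have msum (D : set 'rV[R]_n) : measurable_fun D (fun k => \sum_i ((k ord0 i) ^+ 2)%:E)%E.
  by apply: measurable_funTS; apply: emeasurable_sum => i; exact: measurable_coord_sqr.
have sum0 k : (0 <= \sum_i ((k ord0 i) ^+ 2)%:E)%E.
  by apply: sume_ge0 => i _; rewrite lee_fin sqr_ge0.
have -> : beta (eball r') = (beta (eball r) + beta (eball r' `\` eball r))%E.
  rewrite -measureU//; [by rewrite setDUK//; exact: eball_le|exact: measurableD|exact: setDIK].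
apply: leeD => //.
have mD : measurable (eball r' `\` @eball R n r) by exact: measurableD.
rewrite -[X in beta X]setIT -integral_indic//.
rewrite -ge0_integralZl//; last by rewrite lee_fin invr_ge0 exprn_ge0// ltW.
apply: (@le_trans _ _ (\int[beta]_(k in eball r' `\` eball r) ((r ^- 2)%:E * \sum_i ((k ord0 i) ^+ 2)%:E))%E); last first.
  apply: ge0_subset_integral => //.
  - by apply: measurable_funeM; exact: msum.
  - by move=> k _; rewrite mule_ge0// lee_fin invr_ge0 exprn_ge0// ltW.
rewrite -[X in (X <= _)%E]/(\int[beta]_x (\1_(eball r' `\` eball r) x)%:E)%E.
rewrite integral_indic// setIT -[X in beta X]setIid -[X in (X <= _)%E]integral_indic//.
apply: ge0_le_integral => //.
- by apply/measurable_EFinP; exact: measurable_indic.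
- by apply: measurable_funeM; exact: msum.
move=> k [_ /negP kr]; rewrite sumEFin -enorm_sqr -EFinM lee_fin.
apply: (@le_trans _ _ 1); first by rewrite indicE; case: (_ \in _).
rewrite mulrC ler_pdivlMr ?exprn_gt0// mul1r.
by apply: lerXn2r; rewrite ?nnegrE ?sqrtr_ge0 ?(ltW r0)// leNgt.
Qed.

Lemma moment_image_perm beta (s : {perm 'I_n}) i r :
  moment (image_measure (coord_perm s) beta) i r = moment beta (s i) r.
Proof.
have mB := @measurable_eball R n r.
rewrite /moment integral_mkcond [RHS]integral_mkcond ge0_integral_image.
- apply: eq_integral => k _; rewrite !patchE.
  rewrite (_ : (coord_perm s k \in eball r) = (k \in eball r)) ?mxE//.
  by apply/idP/idP; rewrite !inE /eball /= enorm_coord_perm.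
- apply/(measurable_restrictT _ mB); apply: measurable_funTS; exact: measurable_coord_sqr.
- by move=> k; rewrite patchE; case: ifP; rewrite // lee_fin sqr_ge0.
Qed.

End moments.

(** * Growth rates at the origin *)

Section scaling.
Context {R : realType} (n : nat).
Implicit Types (beta : {measure set 'rV[R]_n -> \bar R}) (s : R).

Lemma scaled_mass_le beta c s (r : R) : 0 < r ->
  (`|scaled_mass beta r| <= c * `|r `^ (- n%:R + s)|) = (fine (beta (eball r)) <= c * r `^ s).
Proof.
move=> r0; have rn : 0 < r ^- n by rewrite invr_gt0 exprn_gt0.
rewrite /scaled_mass ger0_norm; last by apply: mulr_ge0; [exact: ltW|exact: fine_ge0].
rewrite ger0_norm ?powR_ge0// powRD; last by rewrite (gt_eqF r0) implybT.
by rewrite (powR_invn n (ltW r0)) mulrCA ler_pM2l.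
Qed.

(** Degree -n + s amounts to growth r^s of the ball masses themselves, the form in which the
    estimates are carried out. *)
Lemma scaled_mass_bigO beta s :
  (scaled_mass beta =O_ (0^'+) (fun e : R => e `^ (- n%:R + s))) <->
  (exists2 c, 0 < c & \forall r \near 0^'+, fine (beta (eball r)) <= c * r `^ s).
Proof.
rewrite eqO_exP; split=> -[c c0 cP]; exists c => //.
  by near=> r; rewrite -scaled_mass_le//; near: r.
by near=> r; rewrite scaled_mass_le//; near: r.
Unshelve. all: by end_near. Qed.

Lemma scaled_mass_littleo beta s :
  (scaled_mass beta =o_ (0^'+) (fun e : R => e `^ (- n%:R + s))) <->
  (forall c, 0 < c -> \forall r \near 0^'+, fine (beta (eball r)) <= c * r `^ s).
Proof.
rewrite eqoP; split=> h c c0; have cP := h c c0.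
  by near=> r; rewrite -scaled_mass_le//; near: r.
by near=> r; rewrite scaled_mass_le//; near: r.
Unshelve. all: by end_near. Qed.

Lemma near0_scale (Q : R -> Prop) (a : R) : 0 < a -> (\forall r \near 0^'+, Q r) ->
  \forall r \near 0^'+, Q (a * r).
Proof.
move=> a0 [e /= e0 eQ]; exists (e / a); first by rewrite /= divr_gt0.
move=> r /=; rewrite sub0r normrN => re r0; apply: eQ; last by rewrite mulr_gt0.
by rewrite /= sub0r normrN normrM (gtr0_norm a0) mulrC -ltr_pdivlMr.
Qed.

(* Masses of order r^(2+p) for the second moments force r^p for the measure
   once its mass is already known to be O(r^p). *)
Lemma littleo_of_moments (m q : R -> R) (p K : R) : 0 < p -> 0 < K ->
  (forall r r', 0 < r -> r <= r' -> r' <= 1 -> m r' <= m r + K * r ^- 2 * q r') ->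
  (exists2 c, 0 < c & \forall r \near 0^'+, m r <= c * r `^ p) ->
  (forall c, 0 < c -> \forall r \near 0^'+, q r <= c * r `^ (2 + p)) ->
  forall c, 0 < c -> \forall r \near 0^'+, m r <= c * r `^ p.
Proof.
move=> p0 K0 rec [C C0 mC] qo c c0.
(* The ratio a of the radii is fixed first, so that the inner ball takes at most half of the allowed
   mass; a^p becomes small because p > 0. *)
have [a [a0 a1 aC]] : exists a : R, [/\ 0 < a, a <= 1 & C * a `^ p <= c / 2].
  have := @powR_cvg0 R p p0; move=> /cvgrPdist_le/(_ (c / 2 / C)).
  have cC : 0 < c / 2 / C by rewrite !divr_gt0.
  move=> /(_ cC) h.
  near ((0 : R)^'+) => a; exists a; split => //.
    by near: a; apply: nbhs_right_le.
  have : `|0 - a `^ p| <= c / 2 / C by near: a.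
  by rewrite sub0r normrN ger0_norm ?powR_ge0// ler_pdivlMr// mulrC.
(* This constant compensates the factor K (a r)^-2 in front of the second moments and leaves the
   other half, c / 2. *)
have b0 : 0 < c / 2 / K * a ^+ 2 by rewrite !mulr_gt0 ?invr_gt0 ?exprn_gt0.
have qb := qo _ b0; have mCa := near0_scale a0 mC.
near=> r.
have r0 : 0 < r by [].
have ar : a * r <= r by rewrite ler_piMl// ltW.
have r1 : r <= 1 by near: r; apply: nbhs_right_le.
apply: (le_trans (rec (a * r) r (mulr_gt0 a0 r0) ar r1)).
rewrite [c in leRHS]splitr mulrDl; apply: lerD.
  have h : m (a * r) <= C * (a * r) `^ p by near: r.
  apply: (le_trans h); rewrite (powRM p (ltW a0) (ltW r0)) mulrA; apply: ler_wpM2r => //; exact: powR_ge0.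
have h : q r <= c / 2 / K * a ^+ 2 * r `^ (2 + p) by near: r.
apply: (@le_trans _ _ (K * (a * r) ^- 2 * (c / 2 / K * a ^+ 2 * r `^ (2 + p)))).
  by rewrite ler_wpM2l// mulr_ge0 ?ltW// invr_gt0 exprn_gt0// mulr_gt0.
rewrite powRD; last by rewrite (gt_eqF r0) implybT.
rewrite (powR_mulrn 2 (ltW r0)) le_eqVlt; apply/orP; left; apply/eqP; field.
by rewrite !gt_eqF.
Unshelve. all: by end_near. Qed.

End scaling.

(** * Symmetry of the spectral measure under coordinate permutations *)

Section lattice_isometries.
Context {R : realType} (n : nat) d (Omega : measurableType d) (P : probability Omega R).
Variable Phi : Omega -> config R n.
Local Open Scope complex_scope.
Local Notation PhiS f := (fun w => cintegral (Phi w) f).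
Implicit Types (f h : 'rV[R]_n -> R[i]) (s : {perm 'I_n}).

Lemma lattice_isometry_coord_perm s : lattice_isometry (@coord_perm R n s).
Proof.
split.
  move=> x y; rewrite -(enorm_coord_perm s (x - y)); congr enorm.
  by apply/rowP => i; rewrite !mxE.
have sub t : @coord_perm R n t @` @integer_lattice R n `<=` @integer_lattice R n.
  move=> _ [_ [z _ <-] <-]; exists (\row_i z ord0 (t i)) => //.
  by apply/rowP => i; rewrite !mxE.
apply/seteqP; split; first exact: sub.
move=> x zx; exists (coord_perm s^-1%g x); first by apply: (sub s^-1%g); exists x.
by apply/rowP => i; rewrite !mxE permK.
Qed.

Lemma covariance_image (g : {mfun 'rV[R]_n >-> 'rV[R]_n}) f h :
  measurable_fun setT Phi -> (forall k, test_function k -> ess_bounded P (PhiS k)) ->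
  eq_law P (fun w => image_config g (Phi w)) Phi ->
  test_function f -> test_function h -> test_function (f \o g) -> test_function (h \o g) ->
  ccovariance P (PhiS (f \o g)) (PhiS (h \o g)) = ccovariance P (PhiS f) (PhiS h).
Proof.
move=> mPhi bPhi law tf th tfg thg.
rewrite (ccovarianceE (bPhi _ tfg) (bPhi _ thg)) (ccovarianceE (bPhi _ tf) (bPhi _ th)).
have mg := measurableT_comp (measurable_image_config g) mPhi.
have gE k w : test_function k -> cintegral (Phi w) (k \o g) = cintegral (image_config g (Phi w)) k.
  by move=> [[k1 k2] _ _]; rewrite /image_config cintegral_image.
have [f1 f2] := measurable_config_cintegral tf; have [h1 h2] := measurable_config_cintegral th.
have [fh1 fh2] := measurable_mulJ f1 f2 h1 h2.
rewrite -(eq_law_cintegral mg mPhi f1 f2 law) -(eq_law_cintegral mg mPhi h1 h2 law).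
rewrite -(eq_law_cintegral mg mPhi fh1 fh2 law).
have Ef := congr1 (cintegral P) (funext (fun w => gE f w tf)).
have Eh := congr1 (cintegral P) (funext (fun w => gE h w th)).
have Efh := congr1 (cintegral P)
  (funext (fun w => congr2 (fun a b => a * b^*%R) (gE f w tf) (gE h w th))).
exact: (congr2 (fun a b => a - b) Efh (congr2 (fun a b => a * b^*%R) Ef Eh)).
Qed.

Variable beta : {measure set 'rV[R]_n -> \bar R}.
Hypothesis beta_bartlett : bartlett_measure P Phi beta.
Hypothesis Phi_isometries : lattice_isometry_invariant P Phi.
Hypothesis Phi_bounded : forall f, test_function f -> ess_bounded P (PhiS f).

Lemma covariance_spectral_inj beta1 beta2 f h :
  ccovariance P (PhiS f) (PhiS h) = ((2 * pi) ^- n)%:C * cintegral beta1 (spectral_product f h) ->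
  ccovariance P (PhiS f) (PhiS h) = ((2 * pi) ^- n)%:C * cintegral beta2 (spectral_product f h) ->
  cintegral beta1 (spectral_product f h) = cintegral beta2 (spectral_product f h).
Proof.
move=> -> /mulfI; apply; rewrite (inj_eq (@complexI R)) invr_eq0 expf_neq0//.
by rewrite mulf_neq0 ?pnatr_eq0// gt_eqF// pi_gt0.
Qed.

(** Coordinate permutations are orthogonal and preserve Lebesgue measure, so they commute with the
    Fourier transform; invariance of the covariances under s thus becomes equality of the integrals
    of all spectral products. *)
Lemma spectral_perm s : same_spectral_integrals beta (image_measure (coord_perm s) beta).
Proof.
have [[mPhi _] _ _ _ cov] := beta_bartlett.
move=> f h tf th; have [i1 c1] := cov _ _ tf th.
have tfs := test_function_perm s tf; have ths := test_function_perm s th.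
have [i2 c2] := cov _ _ tfs ths.
have spE : spectral_product (f \o coord_perm s) (h \o coord_perm s) =
    spectral_product f h \o coord_perm s.
  by apply/funext => k; rewrite /spectral_product /= !fourier_perm.
have [m1 m2] := measurable_spectral_product beta_bartlett tf th.
have i2' : cintegrable beta (spectral_product f h \o coord_perm s) by rewrite -spE.
split; first exact: i1.
  by split; apply: integrable_image; [exact/measurable_EFinP|case: i2'|exact/measurable_EFinP|case: i2'].
apply: (covariance_spectral_inj (f := f) (h := h)); first exact: c1.
have E : cintegral (image_measure (coord_perm s) beta) (spectral_product f h) =
    cintegral beta (spectral_product (f \o coord_perm s) (h \o coord_perm s)).
  by rewrite spE; exact: cintegral_image.
rewrite E.
exact: (etrans (esym (covariance_image mPhi Phi_bounded
  (Phi_isometries (lattice_isometry_coord_perm s)) tf th tfs ths)) c2).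
Qed.

Lemma small_eball (r : R) k : r * n%:R <= 2^-1 -> @eball R n r k -> \sum_i `|k ord0 i| <= 2^-1.
Proof.
move=> rn kr; apply: le_trans rn.
rewrite mulr_natr -[X in _ *+ X](card_ord n) -sumr_const; apply: ler_sum => i _.
by apply: (le_trans (norm_coord_le_enorm _ _)); exact: ltW.
Qed.

(** The transposition of i and j exchanges the two moments. The condition on r keeps the ball inside
    the region where the spectral measure is determined. *)
Lemma moment_symmetric i j (r : R) : r * n%:R <= 2^-1 -> moment beta i r = moment beta j r.
Proof.
move=> rn; have -> : j = tperm i j i by rewrite tpermL.
rewrite -moment_image_perm; apply: eq_measure_integral => A mA Ar.
by apply: (spectral_measure_unique (spectral_perm _)) => // k /Ar; exact: small_eball.
Qed.

End lattice_isometries.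

Section sine_bounds.
Context {R : realType} (n : nat) (i0 : 'I_n).
Hypothesis i0E : val i0 = 0%N.
Implicit Types (beta : {measure set 'rV[R]_n -> \bar R}) (k : 'rV[R]_n).

Lemma inner_half_e1 k : inner k (2^-1 *: @unit_e1 R n) = k ord0 i0 / 2.
Proof.
rewrite (_ : @unit_e1 R n = delta_mx ord0 i0) ?inner_delta 1?mulrC//.
by apply/rowP => i; rewrite !mxE eqxx /= -i0E (inj_eq val_inj).
Qed.

Lemma sine_weight_le_sqr k : sine_weight n k <= k ord0 i0 ^+ 2.
Proof.
rewrite sine_weightE inner_half_e1; set t := k ord0 i0 / 2.
have -> : k ord0 i0 = 2 * t by rewrite mulrC divfK.
clearbody t.
rewrite !exprMn ler_pM2l// -(real_normK (num_real (sin t))) -(real_normK (num_real t)).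
by apply: lerXn2r; rewrite ?nnegrE// norm_sin_le.
Qed.

(** With t = k_1 / 2 and |t| <= 1/2 one has |t| <= |sin t| + t^2 <= |sin t| + |t| / 2, hence |t| <=
    2 |sin t|; squaring gives the constant 4. *)
Lemma sqr_le_sine_weight k : `|k ord0 i0| <= 1 -> k ord0 i0 ^+ 2 <= 4 * sine_weight n k.
Proof.
rewrite sine_weightE inner_half_e1; set t := k ord0 i0 / 2.
have -> : k ord0 i0 = 2 * t by rewrite mulrC divfK.
clearbody t.
rewrite normrM ger0_norm// => t1.
have := norm_sinB_le t; rewrite -(real_normK (num_real t)) => sint.
have : `|t| <= `|sin t| + `|t| ^+ 2.
  apply: le_trans (lerD (lexx _) sint); rewrite -[X in `|X| <= _](subKr (sin t)).
  exact: ler_normB.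
rewrite !exprMn -(real_normK (num_real (sin t))) -(real_normK (num_real t)).
have := normr_ge0 (sin t); have := normr_ge0 t.
move: t1; set a := `|t|; set b := `|sin t| => a1 a0 b0 ab.
have a2 : a ^+ 2 <= 2^-1 * a by rewrite expr2 ler_wpM2r//; lra.
have {}ab : a <= 2 * b by lra.
have : a ^+ 2 <= (2 * b) ^+ 2 by apply: lerXn2r; rewrite ?nnegrE// mulr_ge0.
rewrite exprMn; lra.
Qed.

Lemma density_sine_le beta r : 0 < r ->
  (density (@sine_weight R n) beta (eball r) <= (r ^+ 2)%:E * beta (eball r))%E.
Proof.
move=> r0; have mr := @measurable_eball R n r.
rewrite /= /density -integral_cst//; apply: ge0_le_integral => //.
- by apply: measurable_funTS; exact: measurable_density_fun.
- move=> k kr; rewrite /= lee_fin ger0_norm ?sine_weight_ge0//.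
  apply: (le_trans (sine_weight_le_sqr k)); rewrite -(real_normK (num_real _)).
  apply: lerXn2r; rewrite ?nnegrE ?(ltW r0)//.
  by apply: (le_trans (norm_coord_le_enorm _ _)); exact: ltW.
Qed.

Lemma moment_le_density_sine beta r : r <= 1 ->
  (moment beta i0 r <= 4%:E * density (@sine_weight R n) beta (eball r))%E.
Proof.
move=> r1; have mr := @measurable_eball R n r.
rewrite /= /density -ge0_integralZl//; last first.
  by apply: measurable_funTS; exact: measurable_density_fun.
apply: ge0_le_integral => //.
- by move=> k _; rewrite lee_fin sqr_ge0.
- by apply: measurable_funTS; exact: measurable_coord_sqr.
- by apply: measurable_funeM; apply: measurable_funTS; exact: measurable_density_fun.
move=> k kr; rewrite -EFinM lee_fin ger0_norm ?sine_weight_ge0//.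
apply: sqr_le_sine_weight; apply: (le_trans (norm_coord_le_enorm _ _)).
by apply: le_trans r1; exact: ltW.
Qed.

End sine_bounds.

(** * Comparison of the two spectral measures near the origin *)

Section spectral_scaling.
Context {R : realType} (n : nat) d (Omega : measurableType d) (P : probability Omega R).
Variables (U : Omega -> 'rV[R]_n) (Phi : Omega -> config R n) (p : R).
Hypothesis n_gt0 : (0 < n)%N.
Hypothesis U_uniform : uniform_on_cube P U.
Hypothesis Phi_thinning : stationary_thinning P U Phi.
Hypothesis Phi_isometries : lattice_isometry_invariant P Phi.
Variable beta : {measure set 'rV[R]_n -> \bar R}.
Hypothesis beta_bartlett : bartlett_measure P Phi beta.
Local Notation Psi := (shifted_lattice U Phi).
Local Notation i0 := (Ordinal n_gt0).
Local Notation mass mu r := (fine (mu (@eball R n r))).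

Let beta_finite r : beta (eball r) \is a fin_num.
Proof. by rewrite ge0_fin_numE//; case: beta_bartlett => _ _ _ lf _; exact: lf. Qed.

Let density_finite r : density (@sine_weight R n) beta (eball r) \is a fin_num.
Proof. by rewrite ge0_fin_numE//; exact: (locally_finite_density_sine beta_bartlett). Qed.

Lemma shifted_spectral_eball r : r <= 1 ->
  shifted_spectral beta (eball r) = density (@sine_weight R n) beta (eball r).
Proof.
move=> r1; rewrite shifted_spectralE lattice_spectral_near0 ?adde0//.
by apply: (le_trans r1); have := pi_ge2 R; lra.
Qed.

Lemma shifted_spectral_le r : 0 < r -> r <= 1 ->
  mass (shifted_spectral beta) r <= r ^+ 2 * mass beta r.
Proof.
move=> r0 r1; rewrite shifted_spectral_eball// -lee_fin EFinM !fineK//.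
exact: (density_sine_le (i0 := i0)).
Qed.

(** By symmetry the n second moments coincide, and the first of them is at most 4 times the mass of
    the sine density, whence the constant 4 n. *)
Lemma mass_le_shifted_spectral r r' : 0 < r -> r <= r' -> r' * n%:R <= 2^-1 -> r' <= 1 ->
  mass beta r' <= mass beta r + 4 * n%:R * r ^- 2 * mass (shifted_spectral beta) r'.
Proof.
move=> r0 rr' r'n r1; rewrite shifted_spectral_eball// -lee_fin EFinD 3!EFinM !fineK//.
apply: (le_trans (shell_moment_bound beta r0 rr')); apply: leeD => //.
have sym i : moment beta i r' = moment beta i0 r'.
  apply: (moment_symmetric beta_bartlett Phi_isometries) => // f tf.
  exact: (ess_bounded_Phi Phi_thinning tf).
have -> : (\sum_i moment beta i r' = n%:R%:E * moment beta i0 r')%E.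
  under eq_bigr do rewrite sym.
  by rewrite sumr_const card_ord mule_natl.
have := moment_le_density_sine (i0 := i0) erefl beta r1.
set D := density _ _ _; set M := moment _ _ _ => MD.
rewrite [(_ * (r ^- 2)%:E)%E]muleC -muleA [(_ * (n%:R)%:E)%E]muleC -muleA.
apply: lee_wpmul2l; first by rewrite lee_fin invr_ge0 exprn_ge0// ltW.
by apply: lee_wpmul2l; rewrite ?lee_fin.
Qed.

Lemma s_uniform_shifted :
  scaled_mass beta =O_ (0^'+) (fun e : R => e `^ (- n%:R + p)) ->
  s_uniform P Psi (- n%:R + (2 + p)).
Proof.
move=> /scaled_mass_bigO[c c0 cP]; exists (shifted_spectral beta).
  exact: bartlett_shifted.
apply/scaled_mass_bigO; exists c => //; near=> r.
have r0 : 0 < r by [].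
have r1 : r <= 1 by near: r; apply: nbhs_right_le.
apply: (le_trans (shifted_spectral_le r0 r1)).
rewrite powRD; last by rewrite (gt_eqF r0) implybT.
rewrite (powR_mulrn 2 (ltW r0)) mulrCA ler_pM2l ?exprn_gt0//.
by near: r.
Unshelve. all: by end_near. Qed.

(** [beyond_s_uniform] comes with a Bartlett measure of Psi of its own, which has to be tied to the
    explicit one. *)
Lemma same_spectral_shifted beta' : bartlett_measure P Psi beta' ->
  same_spectral_integrals beta' (shifted_spectral beta).
Proof.
move=> [_ _ _ _ cov'] f h tf th.
have [_ _ _ _ cov] := bartlett_shifted U_uniform Phi_thinning beta_bartlett.
have [i1 c1] := cov' _ _ tf th; have [i2 c2] := cov _ _ tf th.
split; [exact: i1|exact: i2|exact: (covariance_spectral_inj c1 c2)].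
Qed.

Lemma beyond_of_beyond_shifted : 0 < p ->
  scaled_mass beta =O_ (0^'+) (fun e : R => e `^ (- n%:R + p)) ->
  beyond_s_uniform P Psi (- n%:R + (2 + p)) ->
  beyond_s_uniform P Phi (- n%:R + p).
Proof.
move=> p0 /scaled_mass_bigO bigO [beta' b' /scaled_mass_littleo lito]; exists beta => //.
have n0 : 0 < n%:R :> R by rewrite ltr0n.
have nbig : \forall r \near 0^'+, r * n%:R <= (2^-1 : R).
  have h : 0 < (2 * n%:R)^-1 :> R by rewrite invr_gt0 mulr_gt0.
  near=> r; rewrite -ler_pdivlMr// -invfM; near: r; exact: nbhs_right_le.
have same r : r * n%:R <= 2^-1 -> mass beta' r = mass (shifted_spectral beta) r.
  move=> rn; congr fine; apply: (spectral_measure_unique (same_spectral_shifted b')).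
    exact: measurable_eball.
  by move=> k; exact: small_eball.
apply/scaled_mass_littleo.
(* The masses are cut off to 0 at large radii, so that the shell inequality, known only for small
   balls, holds for all radii up to 1; near 0 nothing changes. *)
pose m r := if r * n%:R <= 2^-1 then mass beta r else 0.
pose q r := if r * n%:R <= 2^-1 then mass (shifted_spectral beta) r else 0.
have mE : \forall r \near 0^'+, m r = mass beta r.
  by near=> r; rewrite /m ifT//; near: r.
have qE : \forall r \near 0^'+, q r = mass beta' r.
  by near=> r; have rn : r * n%:R <= 2^-1 by [near: r]; rewrite /q rn same.
suff H : forall c, 0 < c -> \forall r \near 0^'+, m r <= c * r `^ p.
  move=> c c0; have Hc := H c c0; near=> r.
  by have <- : m r = mass beta r by [near: r]; near: r.
apply: (@littleo_of_moments _ m q p (4 * n%:R)) => //.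
- by rewrite mulr_gt0.
- move=> r r' r0 rr' r1; rewrite /m /q; case: ifPn => [r'n|_].
    have rn : r * n%:R <= 2^-1 by apply: le_trans r'n; rewrite ler_pM2r.
    by rewrite rn; exact: mass_le_shifted_spectral.
  by rewrite mulr0 addr0; case: ifP => // _; exact: fine_ge0.
- case: bigO => c c0 cP; exists c => //; near=> r.
  by have -> : m r = mass beta r by [near: r]; near: r.
- move=> c c0; have cP := lito c c0; near=> r.
  by have -> : q r = mass beta' r by [near: r]; near: r.
Unshelve. all: by end_near. Qed.

End spectral_scaling.

Theorem propositionD6 (R : realType) (d : nat) (p : R)
    (dO : measure_display) (Omega : measurableType dO) (P : probability Omega R)
    (U : Omega -> 'rV[R]_d) (Phi : Omega -> config R d)
    (d_gt0 : (0 < d)%N) (p_gt0 : 0 < p) (p_lt1 : p < 1)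
    (U_uniform : uniform_on_cube P U)
    (Phi_thinning : stationary_thinning P U Phi)
    (Phi_degree : solely_s_uniform P Phi (- d%:R + p))
    (Phi_isometries : lattice_isometry_invariant P Phi) :
  solely_s_uniform P (shifted_lattice U Phi) (- d%:R + 2 + p) /\
  (- d%:R + 2 + p < 0 <-> (3 <= d)%N).
Proof.
have [[beta b bigO] notbeyond] := Phi_degree.
split.
  rewrite -addrA; split; first exact: (s_uniform_shifted d_gt0 U_uniform Phi_thinning b bigO).
  move=> h; apply: notbeyond.
  exact: (beyond_of_beyond_shifted d_gt0 U_uniform Phi_thinning Phi_isometries b p_gt0 bigO h).
(* As 0 < p < 1, the natural numbers above 2 + p are those from 3 on. *)
split=> [dp|d3].
  rewrite ltnNge; apply/negP => d2; have : d%:R <= 2%:R :> R by rewrite ler_nat.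
  lra.
have : 3%:R <= d%:R :> R by rewrite ler_nat.
lra.
Qed.
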